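(* Let $d\ge 1$, $k\in\{0,1,\ldots,d-1\}$, and consider a great hypersphere tessellation of $\mathbb{S}^d$ with non-degenerate directional distribution $\kappa$ and intensity $n\ge d-k$. For $\kappa_k$-almost all $S\in\mathbb{G}_s(d,k)$ and all Borel sets $A\subset\mathbb{K}_s(d)$ one has $$\mathbf{P}(W_{n,d}^{(k)}\in A\,|\,D(W_{n,d}^{(k)})=S)=\mathbf{P}(Z_U(T_{n-d+k,S})\in A),$$ where $U$ is a uniform random point in $S$ which is independent of $T_{n-d+k,S}$, and $Z_U(T_{n-d+k,S})$ is the almost surely unique cell of $T_{n-d+k,S}$ containing $U$ in its relative interior.
   Context: $\mathbb{S}^d$ is the unit sphere of $\mathbb{R}^{d+1}$. For $k\in\{0,\ldots,d\}$, $\mathbb{G}_s(d,k)$ is the set of $k$-dimensional great subspheres of $\mathbb{S}^d$ (intersections of $\mathbb{S}^d$ with $(k+1)$-dimensional linear subspaces); elements of $\mathbb{G}_s(d,d-1)$ are great hyperspheres. $\mathcal{H}^k$ is $k$-dimensional Hausdorff measure. $\mathbb{K}_s(d)$ is the set of all $C\cap\mathbb{S}^d$ with $C\subset\mathbb{R}^{d+1}$ a closed convex cone different from $\{0\}$, with the topology of the spherical Hausdorff distance (a Polish space). A spherical polytope is $P=C\cap\mathbb{S}^d$ with $C\ne\{0\}$ a polyhedral cone; its $\ell$-dimensional faces are the intersections of $\mathbb{S}^d$ with the $(\ell+1)$-dimensional faces of $C$; $\mathcal{F}_\ell(P)$ is the set of these. Tessellation: let $\kappa^\circ$ be an even Borel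 probability measure on $\mathbb{S}^d$ with $\kappa^\circ(S)=0$ for every $S\in\mathbb{G}_s(d,d-1)$, and let $\kappa$ be its image under $u\mapsto u^\perp\cap\mathbb{S}^d$; such a $\kappa$ is what is meant here by a non-degenerate directional distribution. For $n\ge1$ let $S_1,\ldots,S_n$ be independent random great hyperspheres with distribution $\kappa$. The great hypersphere tessellation $T_{n,d}=T_d(S_1,\ldots,S_n)$ of intensity $n$ and directional distribution $\kappa$ is the random finite collection of spherical polytopes (cells) that are the closures of the connected components of $\mathbb{S}^d\setminus(S_1\cup\cdots\cup S_n)$; $T_{0,d}=\{\mathbb{S}^d\}$. Put $\mathcal{F}_k(T_{n,d})=\bigcup_{P\in T_{n,d}}\mathcal{F}_k(P)$ and ${\rm skel}_k(T_{n,d})=\bigcup_{F\in\mathcal{F}_k(T_{n,d})}F$. Weighted typical spherical $k$-face: $W_{n,d}^{(k)}$ is the almost surely unique $F\in\mathcal{F}_k(T_{n,d})$ containing in its relative interior a random point $v$ which, given $T_{n,d}$, is distributed on ${\rm skel}_k(T_{n,d})$ according to normalized $\mathcal{H}^k$. For fixed $S\in\mathbb{G}_s(d,k)$ and $m\ge0$, $T_{m,S}=T_{m,d}\cap S$ is the collection of cells $P\cap S$, $P\in T_{m,d}$ with interior meeting $S$ (where $T_{m,d}$ has directional distribution $\kappa$). The direction of $K\in\mathbb{K}_s(d)$ with $\dim\mathrm{lin}(K)=k+1$ is $D(K)=\mathrm{lin}(K)\cap\mathbb{S}^d\in\mathbb{G}_s(d,k)$. $\kappa_k$ is the distribution of $S_1\cap\cdots\cap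 S_{d-k}$ where $S_1,\ldots,S_{d-k}$ are independent with distribution $\kappa$; the distribution of $D(W_{n,d}^{(k)})$ is $\kappa_k$. $\mathbf{P}(W_{n,d}^{(k)}\in A\,|\,D(W_{n,d}^{(k)})=S)$ denotes the regular conditional distribution of $W_{n,d}^{(k)}$ given $D(W_{n,d}^{(k)})=S$. *)

(* Defs.v *)
From HB Require Import structures.
From mathcomp Require Import all_boot all_order all_algebra.
From mathcomp Require Import all_classical all_reals all_analysis.
Import Order.TTheory GRing.Theory Num.Theory.
Import numFieldTopology.Exports numFieldNormedType.Exports.

Set Implicit Arguments.
Unset Strict Implicit.
Unset Printing Implicit Defensive.

Local Open Scope classical_set_scope.
Local Open Scope ring_scope.

Section euclidean.
Variables (R : realType) (d : nat).
Notation E := 'rV[R]_d.+1.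

Definition dotp (x y : E) : R := \sum_i x 0 i * y 0 i.

(* The library norm on 'rV is the sup norm (it induces the same topology);
   lengths are measured with the Euclidean norm. *)
Definition enorm (x : E) : R := Num.sqrt (dotp x x).

Definition usphere : set E := [set x | enorm x = 1].

Definition perp (u : E) : set E := [set x | dotp u x = 0].

Definition lin (K : set E) : set E :=
  \bigcap_(V in [set V : {vspace E} | K `<=` [set` V]]) [set` V].

Definition has_dim (K : set E) (m : nat) : Prop :=
  exists2 V : {vspace E}, lin K = [set` V] & \dim V = m.

Definition great_subsphere (k : nat) (S : set E) : Prop :=
  exists2 V : {vspace E}, \dim V = k.+1 & S = [set` V] `&` usphere.

Definition rel_interior (L K : set E) : set E :=
  [set x | L x /\ within L (nbhs x) K].

(* For K = C `&` usphere with C a convex cone, this is the intersection of the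
   sphere with the relative interior of C. *)
Definition relint (K : set E) : set E := rel_interior (lin K `&` usphere) K.

Definition closed_convex_cone (C : set E) : Prop :=
  [/\ closed C, C !=set0 &
      forall (a b : R) (x y : E), 0 <= a -> 0 <= b -> C x -> C y ->
        C (a *: x + b *: y)].

Definition polyhedral_cone (C : set E) : Prop :=
  exists (m : nat) (a : 'I_m -> E), C = [set x | forall i, 0 <= dotp (a i) x].

(* a = 0 gives the improper face C. *)
Definition cone_face (C G : set E) : Prop :=
  exists2 a : E, (forall x, C x -> 0 <= dotp a x) & G = C `&` perp a.

Definition spherical_face (l : nat) (P F : set E) : Prop :=
  exists C G : set E,
    [/\ polyhedral_cone C, C <> [set 0] & P = C `&` usphere] /\
    [/\ cone_face C G, has_dim G l.+1 & F = G `&` usphere].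

Definition ediam (U : set E) : \bar R :=
  ereal_sup [set (enorm (p.1 - p.2))%:E | p in U `*` U].

Definition hausdorff_content (k : nat) (delta : R) (A : set E) : \bar R :=
  ereal_inf [set (\sum_(0 <= i <oo | U i != set0) ediam (U i) ^+ k)%E
    | U in [set U : (set E)^nat |
        A `<=` \bigcup_i U i /\ forall i, (ediam (U i) <= delta%:E)%E]].

(* Not rescaled to agree with Lebesgue measure: only ratios of values of this
   measure are used. *)
Definition hausdorff_measure (k : nat) (A : set E) : \bar R :=
  ereal_sup [set hausdorff_content k delta A | delta in [set e : R | 0 < e]].

Definition normalized_hausdorff (k : nat) (X A : set E) : \bar R :=
  (hausdorff_measure k (A `&` X) / hausdorff_measure k X)%E.

Definition tessellation (n : nat) (S : 'I_n -> set E) : set (set E) :=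
  let X := usphere `\` \bigcup_i S i in
  [set closure (connected_component X x) | x in X].

Definition faces (k : nat) (T : set (set E)) : set (set E) :=
  [set F | exists2 P, T P & spherical_face k P F].

Definition skel (k : nat) (T : set (set E)) : set E :=
  \bigcup_(F in faces k T) F.

Definition section (T : set (set E)) (S : set E) : set (set E) :=
  [set P `&` S | P in [set P | T P /\ rel_interior usphere P `&` S !=set0]].

Definition spherical_convex (K : set E) : Prop :=
  exists C : set E,
    [/\ closed_convex_cone C, C <> [set 0] & K = C `&` usphere].

End euclidean.
Arguments usphere {R d}.

Record sbody (R : realType) (d : nat) := SBody {
  sset : set 'rV[R]_d.+1 ;
  sbodyP : spherical_convex sset }.

HB.instance Definition _ (R : realType) (d : nat) := gen_eqMixin (sbody R d).
HB.instance Definition _ (R : realType) (d : nat) :=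
  gen_choiceMixin (sbody R d).

Section bodies.
Variables (R : realType) (d : nat).
Notation E := 'rV[R]_d.+1.

Lemma closed_vspace (V : {vspace E}) : closed [set` V].
Proof.
pose M : 'M[R]_d.+1 := 1%:M - lin1_mx (projv V).
have -> : [set` V] =
    \bigcap_(j in [set: 'I_d.+1]) [set x : E | (x *m M) 0 j = 0].
  apply/seteqP; split=> [x xV j _|x /= xM].
    by rewrite /= /M mulmxBr mulmx1 mul_rV_lin1 /= (projv_id xV) subrr mxE.
  have /eqP : x *m M = 0.
    by apply/rowP => j; rewrite xM// mxE.
  by rewrite /M mulmxBr mulmx1 mul_rV_lin1 /= subr_eq0 => /eqP ->;
    exact: memv_proj.
apply: closed_bigI => j _.
have -> : [set x : E | (x *m M) 0 j = 0] =
    (fun x : E => \sum_i x 0 i * M i j) @^-1` [set 0].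
  by apply/seteqP; split=> x /=; rewrite mxE.
apply: preimage_closed; last exact: closed_eq.
move=> x _; apply: continuous_big; first exact: add_continuous.
move=> i _ y.
by apply: (@continuousM R E (fun x => x 0 i) (cst (M i j)) y);
  [exact: (@coord_continuous R 1 d.+1 0 i y)|exact: cst_continuous].
Qed.

Lemma sub_lin (K : set E) : K `<=` lin K.
Proof. by move=> x Kx V; exact. Qed.

Lemma closed_convex_cone_lin (K : set E) : closed_convex_cone (lin K).
Proof.
split.
- by apply: closed_bigI => V _; exact: closed_vspace.
- by exists 0 => V _ /=; exact: mem0v.
- move=> a b x y _ _ Kx Ky V KV.
  by rewrite /= rpredD// rpredZ//; [exact: Kx|exact: Ky].
Qed.

Lemma dotpZ (a : R) (x : E) : dotp (a *: x) (a *: x) = a ^+ 2 * dotp x x.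
Proof.
rewrite /dotp mulr_sumr; apply: eq_bigr => i _.
by rewrite !mxE expr2 mulrACA.
Qed.

Lemma dotp_eq0 (x : E) : dotp x x = 0 -> x = 0.
Proof.
move=> /eqP; rewrite psumr_eq0; last by move=> i _; rewrite -expr2 sqr_ge0.
move=> /allP x0; apply/rowP => i; rewrite mxE.
by have := x0 i (mem_index_enum _); rewrite /= mulf_eq0 orbb => /eqP.
Qed.

Lemma usphere0 : ~ usphere (0 : E).
Proof.
rewrite /usphere /= /enorm /dotp big1; last by move=> i _; rewrite mxE mul0r.
by rewrite sqrtr0 => /eqP; rewrite eq_sym oner_eq0.
Qed.

Lemma cone_neq0_usphere (C : set E) :
  closed_convex_cone C -> C <> [set 0] -> C `&` usphere !=set0.
Proof.
move=> [_ [z Cz] CC] C0.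
have [x Cx x0] : exists2 x, C x & x != 0.
  apply: contrapT => H; apply: C0; apply/seteqP; split=> x /=.
    by move=> Cx; apply: contrapT => /eqP x0; apply: H; exists x.
  move=> ->; have := CC 0 0 z z (lexx 0) (lexx 0) Cz Cz.
  by rewrite !scale0r addr0.
have xx0 : 0 < dotp x x.
  rewrite lt_neqAle eq_sym; apply/andP; split.
    by apply: contra_neq x0; exact: dotp_eq0.
  by apply: sumr_ge0 => i _; rewrite -expr2 sqr_ge0.
exists ((enorm x)^-1 *: x); split.
  have := CC (enorm x)^-1 0 x x _ (lexx 0) Cx Cx.
  by rewrite scale0r addr0; apply; rewrite invr_ge0 sqrtr_ge0.
rewrite /usphere /= {1}/enorm dotpZ /enorm exprVn sqr_sqrtr ?ltW//.
by rewrite mulVf ?gt_eqF// sqrtr1.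
Qed.

Lemma direction_subproof (K : sbody R d) :
  spherical_convex (lin (sset K) `&` usphere).
Proof.
exists (lin (sset K)); split=> //; first exact: closed_convex_cone_lin.
have [C [CC C0 KE]] := sbodyP K => L0.
have [x] := cone_neq0_usphere CC C0; rewrite -KE => Kx.
have := sub_lin Kx; rewrite L0 /= => x0.
by move: Kx; rewrite KE x0 => -[_]; exact: usphere0.
Qed.

Definition direction (K : sbody R d) : sbody R d :=
  SBody (direction_subproof K).

Lemma usphere_subproof : spherical_convex (usphere : set E).
Proof.
exists setT; split; last by rewrite setTI.
  by split; [exact: closedT|exists 0|].
move=> /seteqP [/(_ (const_mx 1) I) /= /rowP /(_ 0)] + _.
by rewrite !mxE => /eqP; rewrite oner_eq0.
Qed.

HB.instance Definition _ :=
  isPointed.Build (sbody R d) (SBody usphere_subproof).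

Definition sdist (x y : E) : R := acos (dotp x y).

Definition hausdorff_dist (K L : sbody R d) : R :=
  inf [set r : R | [/\ 0 <= r,
    forall x, sset K x -> exists2 y, sset L y & sdist x y <= r &
    forall y, sset L y -> exists2 x, sset K x & sdist x y <= r]].

Definition hausdorff_open : set (set (sbody R d)) :=
  [set U | forall K, U K -> exists2 e : R, 0 < e &
    forall L, hausdorff_dist K L < e -> U L].

End bodies.

Notation borelE R d := (g_sigma_algebraType (@open 'rV[R]_d.+1)).
Notation borelK R d := (g_sigma_algebraType (@hausdorff_open R d)).

Section random.
Variables (R : realType) (d : nat).
Notation E := (borelE R d).
Notation KS := (borelK R d).

(* A Borel measure on the sphere is encoded as a Borel measure on the ambient
   space for which the sphere has full measure. *)
Definition nondegenerate_directional_distribution (kappa : probability KS R)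
    : Prop :=
  exists kappa0 : probability E R,
    [/\ kappa0 usphere = 1%E,
        forall A : set E, measurable A -> kappa0 (-%R @` A) = kappa0 A,
        forall S : set E, great_subsphere d.-1 S -> kappa0 S = 0%E &
        forall B : set KS, measurable B -> kappa B =
          kappa0 [set u | usphere u /\
                   (@sset R d @` B) (perp u `&` usphere)]].

Definition iid_hyperspheres (kappa : probability KS R) (n : nat)
    (disp : measure_display) (Omega : measurableType disp)
    (P : probability Omega R) (S : 'I_n -> {RV P >-> KS}) : Prop :=
  [/\ forall i w, great_subsphere d.-1 (sset (S i w)),
      forall i (B : set KS), measurable B -> distribution P (S i) B = kappa B &
      forall B : 'I_n -> set KS, (forall i, measurable (B i)) ->
        P (\bigcap_i (S i @^-1` B i)) = (\prod_(i < n) P (S i @^-1` B i))%E].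

Definition intersection_distribution (kappa : probability KS R) (k : nat)
    (kappak : probability KS R) : Prop :=
  exists (disp : measure_display) (Omega : measurableType disp)
    (P : probability Omega R) (S : 'I_(d - k) -> {RV P >-> KS}),
    iid_hyperspheres kappa S /\
    forall B : set KS, measurable B ->
      kappak B = P [set w | (@sset R d @` B) (\bigcap_i sset (S i w))].

Section on_probability_space.
Context (disp : measure_display) (Omega : measurableType disp)
  (P : probability Omega R).

(* The sigma-algebra generated by a random finite collection of spherically
   convex sets, i.e. by the events that the collection meets B, for B Borel. *)
Definition sigma_collection (T : Omega -> set (set E)) : set (set Omega) :=
  <<s [set [set w | exists2 K, B K & T w (sset K)]
      | B in (measurable : set (set KS))] >>.

Definition conditional_distribution_given (T : Omega -> set (set E))
    (X : {RV P >-> E}) (mu : Omega -> set E -> \bar R) : Prop :=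
  forall (H : set Omega) (A : set E), sigma_collection T H -> measurable A ->
    P (H `&` X @^-1` A) = (\int[P]_(w in H) mu w A)%E.

Definition independent_of (T : Omega -> set (set E)) (X : {RV P >-> E})
    : Prop :=
  forall (H : set Omega) (A : set E), sigma_collection T H -> measurable A ->
    P (H `&` X @^-1` A) = (P H * P (X @^-1` A))%E.

Definition weighted_typical_face (k : nat) (T : Omega -> set (set E))
    (W : {RV P >-> KS}) : Prop :=
  exists v : {RV P >-> E},
    conditional_distribution_given T v
      (fun w => normalized_hausdorff k (skel k (T w))) /\
    {ae P, forall w, faces k (T w) (sset (W w)) /\ relint (sset (W w)) (v w)}.

Definition uniform_on (k : nat) (S : set E) (U : {RV P >-> E}) : Prop :=
  forall A : set E, measurable A ->
    distribution P U A = normalized_hausdorff k S A.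

Definition cell_containing (T : Omega -> set (set E)) (U : {RV P >-> E})
    (Z : {RV P >-> KS}) : Prop :=
  {ae P, forall w, T w (sset (Z w)) /\ relint (sset (Z w)) (U w)}.

Definition regular_conditional_distribution (X : {RV P >-> KS})
    (Y : Omega -> KS) (Q : R.-pker KS ~> KS) : Prop :=
  forall A B : set KS, measurable A -> measurable B ->
    P (X @^-1` A `&` Y @^-1` B) = (\int[P]_(w in Y @^-1` B) Q (Y w) A)%E.

End on_probability_space.
End random.

(* Main.v *)
(** Call a k-subsphere an intersection of S^d with a linear subspace of
    dimension k+1.  Almost surely the given hyperspheres S_1, ..., S_n are in
    general position, so the intersection S_J of the S_j with j in J is a
    k-subsphere whenever |J| = d-k, and the k-skeleton of the tessellation is
    the union of these S_J, which overlap in null sets.  The point v is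
    therefore uniform on S_J for a uniformly chosen J.  The k-face through v is
    the cell, containing v, of the section by S_J of the tessellation of the
    remaining n-d+k hyperspheres, and its direction is S_J.  Since those
    hyperspheres are independent of S_J, and S_J has law kappa_k, the law of the
    pair (face, direction) is the mixture over L ~ kappa_k of the law of the cell
    of a uniform point of L in T_{n-d+k,L}.  This identifies the conditional
    distribution for almost every L simultaneously on a countable pi-system
    generating the Borel sets of K_s(d).

    The conditional law of v and the independence of U are only given relative
    to the sigma-algebra of the tessellation; the face through a point x is
    measurable for it because it is the intersection of all cells containing
    x. *)
Require Import Defs.
From HB Require Import structures.
From mathcomp Require Import all_boot all_order all_algebra.
From mathcomp Require Import all_classical all_reals all_analysis.
From mathcomp Require Import measurable_realfun.
From mathcomp Require Import ring lra zify.
Import Order.TTheory GRing.Theory Num.Theory.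
Import numFieldTopology.Exports numFieldNormedType.Exports.

Set Implicit Arguments.
Unset Strict Implicit.
Unset Printing Implicit Defensive.

Local Open Scope classical_set_scope.
Local Open Scope ring_scope.

(** * Euclidean geometry *)

(** The exceptional [kappak]-null set has to be chosen before the probability space that carries the
    uniform point and its cell. Both sides are therefore compared with [zero_cell_law], a function
    of a subsphere and an event that depends only on a law of families of hyperspheres. Random
    families are replaced by their laws on a product space, where independence becomes Fubini's
    theorem. Most of the work is measurability. The Borel sets of the space of bodies are generated
    by the events that a body hits a rational ball, and set-valued constructions are shown
    measurable through approximate hitting conditions and compactness. The Hausdorff measure of the
    skeleton is computed from subadditivity and from additivity on sets at positive distance. Its
    formula in terms of the subspheres is derived in general position; the exceptional tessellations
    are removed from integrals whose integrand is not known to be measurable. *)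

Section euclid.
Variables (R : realType) (d : nat).
Notation E := 'rV[R]_d.+1.
Implicit Types (a x y z : E) (c : R).

Lemma dotpC x y : dotp x y = dotp y x.
Proof. by apply: eq_bigr => i _; rewrite mulrC. Qed.

Lemma dotpDl x y z : dotp (x + y) z = dotp x z + dotp y z.
Proof. by rewrite /dotp -big_split; apply: eq_bigr => i _; rewrite mxE mulrDl. Qed.

Lemma dotpDr x y z : dotp x (y + z) = dotp x y + dotp x z.
Proof. by rewrite dotpC dotpDl !(dotpC x). Qed.

Lemma dotpZl c x y : dotp (c *: x) y = c * dotp x y.
Proof. by rewrite /dotp mulr_sumr; apply: eq_bigr => i _; rewrite mxE mulrA. Qed.

Lemma dotpZr c x y : dotp x (c *: y) = c * dotp x y.
Proof. by rewrite dotpC dotpZl dotpC. Qed.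

Lemma dotpNl x y : dotp (- x) y = - dotp x y.
Proof. by rewrite -scaleN1r dotpZl mulN1r. Qed.

Lemma dotpNr x y : dotp x (- y) = - dotp x y.
Proof. by rewrite dotpC dotpNl dotpC. Qed.

Lemma dotpBl x y z : dotp (x - y) z = dotp x z - dotp y z.
Proof. by rewrite dotpDl dotpNl. Qed.

Lemma dotpBr x y z : dotp x (y - z) = dotp x y - dotp x z.
Proof. by rewrite dotpDr dotpNr. Qed.

Lemma dotp0l x : dotp 0 x = 0.
Proof. by rewrite -(scale0r 0) dotpZl mul0r. Qed.

Lemma dotp0r x : dotp x 0 = 0.
Proof. by rewrite dotpC dotp0l. Qed.

Lemma dotp_mulmx x y : dotp x y = (x *m y^T) 0 0.
Proof. by rewrite mxE; apply: eq_bigr => i _; rewrite mxE. Qed.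

Lemma dotp_ge0 x : 0 <= dotp x x.
Proof. by apply: sumr_ge0 => i _; rewrite -expr2 sqr_ge0. Qed.

Lemma dotp_gt0 x : x != 0 -> 0 < dotp x x.
Proof.
move=> x0; rewrite lt_neqAle dotp_ge0 andbT eq_sym.
by apply: contra_neq x0; exact: dotp_eq0.
Qed.

Lemma enorm_ge0 x : 0 <= enorm x.
Proof. exact: sqrtr_ge0. Qed.

Lemma enorm_sqr x : enorm x ^+ 2 = dotp x x.
Proof. by rewrite sqr_sqrtr// dotp_ge0. Qed.

Lemma enorm_gt0 x : x != 0 -> 0 < enorm x.
Proof. by move=> x0; rewrite sqrtr_gt0 dotp_gt0. Qed.

Lemma enormZ c x : enorm (c *: x) = `|c| * enorm x.
Proof. by rewrite /enorm dotpZ sqrtrM ?sqr_ge0// sqrtr_sqr. Qed.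

Lemma enormN x : enorm (- x) = enorm x.
Proof. by rewrite -scaleN1r enormZ normrN1 mul1r. Qed.

Lemma usphereE x : usphere x <-> dotp x x = 1.
Proof.
rewrite /usphere /=; split=> [x1|x1]; first by rewrite -enorm_sqr x1 expr1n.
by rewrite /enorm x1 sqrtr1.
Qed.

Lemma usphere_neq0 x : usphere x -> x != 0.
Proof. by move=> sx; apply/eqP => x0; move: sx; rewrite x0; exact: usphere0. Qed.

Lemma normalize_usphere x : x != 0 -> usphere ((enorm x)^-1 *: x).
Proof.
move=> x0; rewrite /usphere /= enormZ ger0_norm ?invr_ge0 ?enorm_ge0//.
by rewrite mulVf// gt_eqF// enorm_gt0.
Qed.

Lemma cauchy_schwarz x y : `|dotp x y| <= enorm x * enorm y.
Proof.
have [->|y0] := eqVneq y 0.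
  by rewrite dotp0r normr0 mulr_ge0 ?enorm_ge0.
rewrite -(@ler_pXn2r _ 2) ?nnegrE ?mulr_ge0 ?enorm_ge0//.
rewrite real_normK ?num_real// exprMn !enorm_sqr.
have yy := dotp_gt0 y0.
have := dotp_ge0 (dotp y y *: x - dotp x y *: y).
have -> : dotp (dotp y y *: x - dotp x y *: y) (dotp y y *: x - dotp x y *: y) =
    dotp y y * (dotp x x * dotp y y - dotp x y ^+ 2).
  by rewrite !(dotpBl, dotpBr, dotpZl, dotpZr) (dotpC y x); ring.
by rewrite pmulr_rge0// subr_ge0.
Qed.

Lemma enormD x y : enorm (x + y) <= enorm x + enorm y.
Proof.
rewrite -(@ler_pXn2r _ 2) ?nnegrE ?addr_ge0 ?enorm_ge0//.
rewrite enorm_sqr !(dotpDl, dotpDr) (dotpC y x) sqrrD !enorm_sqr.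
have := le_trans (ler_norm _) (cauchy_schwarz x y); lra.
Qed.

Lemma enormB x y : enorm (x - y) = enorm (y - x).
Proof. by rewrite -enormN opprB. Qed.

Lemma enorm_triangle z x y : enorm (x - y) <= enorm (x - z) + enorm (z - y).
Proof.
by apply: le_trans (enormD _ _); rewrite addrA subrK.
Qed.

Lemma coord_le_norm x i : `|x 0 i| <= `|x|.
Proof.
rewrite [leRHS]/Num.norm /= mx_normrE.
by apply/bigmax_geP; right => /=; exists (ord0, i).
Qed.

Lemma norm_lt_coord x c : 0 < c -> (forall i, `|x 0 i| < c) -> `|x| < c.
Proof.
move=> c0 H; rewrite [ltLHS]/Num.norm /= mx_normrE.
by apply/bigmax_ltP; split => // -[i j] _ /=; rewrite (ord1 i).
Qed.

Lemma norm_le_enorm x : `|x| <= enorm x.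
Proof.
apply/ler_addgt0Pl => e e0; apply/ltW/norm_lt_coord => [|i].
  by rewrite ltr_wpDr// enorm_ge0.
apply: (@le_lt_trans _ _ (enorm x)); last by rewrite ltrDr.
rewrite -(@ler_pXn2r _ 2) ?nnegrE ?enorm_ge0// enorm_sqr real_normK ?num_real//.
rewrite /dotp (bigD1 i)//= -expr2 lerDl sumr_ge0// => j _.
by rewrite -expr2 sqr_ge0.
Qed.

Lemma enorm_le_norm x : enorm x <= d.+1%:R * `|x|.
Proof.
rewrite -(@ler_pXn2r _ 2) ?nnegrE ?enorm_ge0 ?mulr_ge0// enorm_sqr exprMn.
apply: (@le_trans _ _ (\sum_(i < d.+1) `|x| ^+ 2)).
  apply: ler_sum => i _; rewrite -expr2 -[leLHS]real_normK ?num_real//.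
  by rewrite ler_pXn2r ?nnegrE// coord_le_norm.
rewrite sumr_const card_ord -[leLHS]mulr_natl ler_wpM2r ?sqr_ge0//.
by rewrite -natrX ler_nat -mulnn leq_pmulr.
Qed.

Lemma dotp_unit_sub x y : usphere x -> usphere y ->
  dotp x y = 1 - enorm (x - y) ^+ 2 / 2.
Proof.
move=> /usphereE x1 /usphereE y1; rewrite enorm_sqr !(dotpBl, dotpBr) x1 y1.
by rewrite (dotpC y x); field.
Qed.

Lemma dotp_continuous a : continuous (dotp a : E -> R).
Proof.
apply: continuous_big; first exact: add_continuous.
move=> i _ y.
by apply: (@continuousM R E (cst (a 0 i)) (fun x => x 0 i) y);
  [exact: cst_continuous|exact: (@coord_continuous R 1 d.+1 0 i y)].
Qed.

Lemma dotp_sqr_continuous : continuous (fun x : E => dotp x x).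
Proof.
apply: continuous_big; first exact: add_continuous.
move=> i _ y.
by apply: (@continuousM R E (fun x => x 0 i) (fun x => x 0 i) y);
  exact: (@coord_continuous R 1 d.+1 0 i y).
Qed.

Lemma enorm_continuous : continuous (@enorm R d).
Proof.
move=> x; apply: continuous_comp; first exact: dotp_sqr_continuous.
exact: sqrt_continuous.
Qed.

Lemma closed_usphere : closed (usphere : set E).
Proof.
have -> : usphere = (@enorm R d) @^-1` [set 1] by [].
by apply: preimage_closed; [move=> x _; exact: enorm_continuous|exact: closed_eq].
Qed.

Lemma compact_usphere : compact (usphere : set E).
Proof.
apply: bounded_closed_compact closed_usphere.
exists 1; split => // M M1 x /= x1.
by rewrite (le_trans (norm_le_enorm _))// x1 ltW.
Qed.

End euclid.

(** * Orthogonal maps and linear subspaces *)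

Section linear.
Variables (R : realType) (d : nat).
Notation E := 'rV[R]_d.+1.
Implicit Types (a x y z : E) (c : R) (V : {vspace E}).

Lemma orthogonal_inv (O : 'M[R]_d.+1) : O *m O^T = 1%:M -> O^T *m O = 1%:M.
Proof. exact: mulmx1C. Qed.

Lemma dotp_orthogonal (O : 'M[R]_d.+1) x y : O *m O^T = 1%:M ->
  dotp (x *m O) (y *m O) = dotp x y.
Proof.
move=> OO; rewrite !dotp_mulmx trmx_mul mulmxA -(mulmxA x) OO.
by rewrite mulmx1.
Qed.

(** Householder reflection in the hyperplane orthogonal to [w]; the identity for [w = 0]. *)
Definition reflection (w : E) : 'M[R]_d.+1 :=
  1%:M - (2 / dotp w w) *: (w^T *m w).

Lemma mul_reflection x w :
  x *m reflection w = x - (2 / dotp w w * dotp x w) *: w.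
Proof.
rewrite /reflection mulmxBr mulmx1 -scalemxAr mulmxA.
have -> : x *m w^T = (dotp x w)%:M.
  by rewrite dotp_mulmx [LHS]mx11_scalar.
by rewrite mul_scalar_mx scalerA.
Qed.

Lemma reflection_orthogonal w : reflection w *m (reflection w)^T = 1%:M.
Proof.
have symm : (reflection w)^T = reflection w.
  by rewrite /reflection linearB /= trmx1 linearZ /= trmx_mul trmxK.
rewrite symm; apply/row_matrixP => i; rewrite row_mul -{1}[reflection w]mul1mx.
rewrite row_mul; set x := row i 1%:M; rewrite !mul_reflection.
have [->|w0] := eqVneq w 0; first by rewrite !scaler0 !subr0.
rewrite dotpBl dotpZl -addrA -opprD -scalerDl.
have -> : 2 / dotp w w * dotp x w + 2 / dotp w w *
    (dotp x w - 2 / dotp w w * dotp x w * dotp w w) = 0.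
  by field; rewrite gt_eqF// dotp_gt0.
by rewrite scale0r subr0.
Qed.

Lemma reflection_swap x y : usphere x -> usphere y ->
  x *m reflection (x - y) = y.
Proof.
move=> /usphereE x1 /usphereE y1; rewrite mul_reflection.
have [->|xy] := eqVneq x y; first by rewrite subrr scaler0 subr0.
have H : dotp (x - y) (x - y) != 0.
  by rewrite gt_eqF// dotp_gt0// subr_eq0.
have E2 : dotp (x - y) (x - y) = 2 * dotp x (x - y).
  by rewrite !(dotpBl, dotpBr) x1 y1 (dotpC y x); ring.
have -> : 2 / dotp (x - y) (x - y) * dotp x (x - y) = 1.
  by rewrite mulrAC -E2 divff.
by rewrite scale1r opprB addrC subrK.
Qed.

(** The span of the first [j] coordinate vectors, presented as a kernel. *)
Definition std_space (j : nat) : {vspace E} :=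
  lker (linfun (fun x : E => \row_(i < d.+1) (x 0 i *+ (j <= i)%N))).

Let zero_low_linear j :
  linear (fun x : E => \row_(i < d.+1) (x 0 i *+ (j <= i)%N)).
Proof.
by move=> c x y; apply/rowP => i; rewrite !mxE mulrnDl mulrnAr.
Qed.

Lemma mem_std_space j x :
  x \in std_space j <-> forall i : 'I_d.+1, (j <= i)%N -> x 0 i = 0.
Proof.
pose f : {linear E -> E} := HB.pack (fun x : E => \row_(i < d.+1)
  (x 0 i *+ (j <= i)%N)) (GRing.isLinear.Build _ _ _ _ _ (zero_low_linear j)).
rewrite memv_ker (_ : linfun _ = linfun f)// lfunE /=; split=> [/eqP/rowP H i ji|H].
  by have := H i; rewrite !mxE ji.
apply/eqP/rowP => i; rewrite !mxE; have [ji|//] := boolP (j <= i)%N.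
by rewrite H.
Qed.

(** Gram-Schmidt by Householder reflections. Once the span of [X] is carried to the first [j]
    coordinates, the part of the image of [v] in the other coordinates is normalized to [u]. The
    reflection that swaps [u] with the next coordinate vector [e] fixes the span of the first [j]
    ones, because [u - e] vanishes in these coordinates. *)
Lemma orthogonal_to_std (X : seq E) : free X ->
  exists2 O : 'M[R]_d.+1, O *m O^T = 1%:M &
    forall x, x \in <<X>>%VS <-> x *m O \in std_space (size X).
Proof.
elim: X => [_|v X IH].
  exists 1%:M; first by rewrite trmx1 mulmx1.
  move=> x; rewrite mulmx1 span_nil memv0 mem_std_space.
  by split=> [/eqP -> i _|H]; [rewrite mxE|apply/eqP/rowP => i; rewrite H ?mxE].
rewrite free_cons => /andP[vX fX]; have [M OO XO] := IH fX.
have OinvO := orthogonal_inv OO.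
have szX : (size X < d.+1)%N.
  have : (size (v :: X) <= \dim {:E})%N.
    rewrite -(eqnP (_ : free (v :: X))) ?dimvS ?subvf// free_cons vX fX //.
  by rewrite dimvf /dim /= mul1n.
set j := size X in szX XO *.
pose jo := Ordinal szX.
pose low : E := \row_i ((v *m M) 0 i *+ (i < j)%N).
pose v' := v *m M - low.
have lowW : low \in std_space j.
  by apply/mem_std_space => i ji; rewrite mxE ltnNge ji.
have v'E i : v' 0 i = (v *m M) 0 i *+ (j <= i)%N.
  by rewrite !mxE ltnNge; case: (j <= i)%N; rewrite /= ?subr0 ?subrr.
have v'0 : v' != 0.
  apply/eqP => v'0; move/negP: vX; apply; apply/XO/mem_std_space => i ji.
  by have := v'E i; rewrite v'0 ji mxE.
pose u := (enorm v')^-1 *: v'.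
have uS : usphere u := normalize_usphere v'0.
have uW (i : 'I_d.+1) : (i < j)%N -> u 0 i = 0.
  by move=> ij; rewrite /u mxE v'E leqNgt ij mulr0.
have vO : v *m M = low + enorm v' *: u.
  by rewrite scalerA divff ?scale1r 1?addrC ?subrK// gt_eqF// enorm_gt0.
have uE : u *m M^T = (enorm v')^-1 *: (v - low *m M^T).
  by rewrite -scalemxAl mulmxBl -mulmxA OO mulmx1.
clearbody v'; clearbody u low.
pose e : E := delta_mx 0 jo.
have eS : usphere e.
  apply/usphereE; rewrite /dotp (bigD1 jo)//= !mxE !eqxx mulr1 big1 ?addr0//.
  by move=> i ij; rewrite !mxE (negbTE ij) andbF mulr0.
have HH := reflection_orthogonal (u - e).
have uH : u *m reflection (u - e) = e by exact: reflection_swap.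
have wH w : w \in std_space j -> w *m reflection (u - e) = w.
  move=> /mem_std_space wj; rewrite mul_reflection (_ : dotp w _ = 0).
    by rewrite mulr0 scale0r subr0.
  rewrite /dotp big1// => i _; have [ji|ij] := leqP j i; first by rewrite wj// mul0r.
  rewrite !mxE uW// add0r.
  rewrite (_ : i == jo = false) ?andbF ?oppr0 ?mulr0//.
  by apply/negbTE; rewrite -val_eqE /= ltn_eqF.
exists (M *m reflection (u - e)).
  by rewrite trmx_mul mulmxA -(mulmxA M) HH mulmx1.
move=> x; rewrite span_cons mulmxA; split.
  move=> /memv_addP[_ /vlineP[c ->] [w /XO wX ->]].
  rewrite mulmxDl -scalemxAl vO scalerDr scalerA 2!mulmxDl -!scalemxAl.
  rewrite uH !wH//; apply/mem_std_space => i ji; rewrite !mxE.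
  have ji' : (j <= i)%N := ltnW ji.
  move/mem_std_space : wX => /(_ i ji'); rewrite mxE => ->.
  move/mem_std_space : lowW => /(_ i ji') ->; rewrite mulr0 add0r addr0.
  rewrite (_ : i == jo = false) ?andbF ?mulr0//.
  by apply/negbTE; rewrite -val_eqE /= gtn_eqF.
set y := x *m M; set z := y *m reflection (u - e) => /mem_std_space yH.
have HT (t : E) : t *m reflection (u - e) *m (reflection (u - e))^T = t.
  by rewrite -mulmxA HH mulmx1.
have eH : e *m (reflection (u - e))^T = u by have := HT u; rewrite uH.
have zy : z *m (reflection (u - e))^T = y by rewrite HT.
clearbody z.
pose zl : E := \row_i (z 0 i *+ (i < j)%N).
have zlW : zl \in std_space j.
  by apply/mem_std_space => i ji; rewrite mxE ltnNge ji.
have zE : z = zl + z 0 jo *: e.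
  apply/rowP => i; rewrite !mxE /=; have [ij|ji|ij] := ltngtP i j.
  - rewrite (_ : i == jo = false) ?andbF ?mulr0 ?addr0//.
    by apply/negbTE; rewrite -val_eqE /= ltn_eqF.
  - rewrite (_ : i == jo = false) ?andbF ?mulr0 ?add0r//; last first.
      by apply/negbTE; rewrite -val_eqE /= gtn_eqF.
    by rewrite yH.
  - have -> : i = jo by exact/val_inj.
    by rewrite eqxx mulr1 mulr0n add0r.
have yE : y = zl + z 0 jo *: u.
  by rewrite -zy {1}zE mulmxDl -scalemxAl eH -{1}(wH _ zlW) HT.
have xE : x = y *m M^T by rewrite /y -mulmxA OO mulmx1.
rewrite xE yE mulmxDl -scalemxAl uE.
have back w : w \in std_space j -> w *m M^T \in <<X>>%VS.
  by move=> wj; apply/XO; rewrite -mulmxA OinvO mulmx1.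
rewrite addrC -span_cons; apply: rpredD.
  rewrite !rpredZ//; apply: rpredB; first by rewrite memv_span// mem_head.
  by have := back _ lowW; apply/subvP; rewrite span_cons addvSr.
by have := back _ zlW; apply/subvP; rewrite span_cons addvSr.
Qed.

Lemma orthogonal_transport V V' : \dim V = \dim V' ->
  exists2 O : 'M[R]_d.+1, O *m O^T = 1%:M &
    forall x, x \in V <-> x *m O \in V'.
Proof.
move=> VV'.
have [Q1 Q1O H1] := orthogonal_to_std (basis_free (vbasisP V)).
have [Q2 Q2O H2] := orthogonal_to_std (basis_free (vbasisP V')).
exists (Q1 *m Q2^T).
  by rewrite trmx_mul trmxK mulmxA -(mulmxA Q1) (orthogonal_inv Q2O) mulmx1.
move=> x; rewrite -{1}(span_basis (vbasisP V)) -(span_basis (vbasisP V')).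
rewrite H1 H2 !size_tuple VV' mulmxA -mulmxA.
by rewrite (orthogonal_inv Q2O) mulmx1.
Qed.

(** Rank-nullity for the functional [dotp a], whose image on any subspace has dimension 0 or 1. *)
Lemma perp_vspace a : exists2 V : {vspace E}, perp a = [set` V] &
  forall U : {vspace E}, (\dim U <= (\dim (U :&: V)).+1)%N /\
    ((exists2 x, x \in U & dotp a x != 0) -> \dim U = (\dim (U :&: V)).+1).
Proof.
have lin_a : linear (fun x : E => dotp a x : R^o).
  by move=> c x y; rewrite dotpDr dotpZr.
pose f : {linear E -> R^o} :=
  HB.pack (fun x : E => dotp a x : R^o) (GRing.isLinear.Build _ _ _ _ _ lin_a).
have fE x : linfun f x = dotp a x by rewrite lfunE.
exists (lker (linfun f)).
  apply/seteqP; split=> x; rewrite /perp /= memv_ker fE; first by move=> ->.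
  by move=> /eqP.
move=> U; have dimU := limg_ker_dim (linfun f) U.
have le1 : (\dim (linfun f @: U) <= 1)%N.
  by have := dimvS (subvf (linfun f @: U)%VS); rewrite dimvf /dim.
split.
  by rewrite -dimU -[X in (_ <= X)%N]addn1 leq_add2l.
move=> [x xU ax].
suff : \dim (linfun f @: U) != 0%N.
  move: dimU le1; case: (\dim (linfun f @: U)) => [|[|]]//= <- _ _.
  by rewrite addn1.
rewrite dimv_eq0; apply/eqP => f0.
have : linfun f x \in (linfun f @: U)%VS by exact: memv_img.
by rewrite f0 memv0 fE (negbTE ax).
Qed.

End linear.

(** * Linear hulls and great subspheres *)

Section subspheres.
Variables (R : realType) (d : nat).
Notation E := 'rV[R]_d.+1.
Implicit Types (a x y z : E) (c : R) (V : {vspace E}) (K S : set E).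

Lemma lin_sub_vspace K V : K `<=` [set` V] -> lin K `<=` [set` V].
Proof. by move=> KV x; apply. Qed.

(** A free family of points of [K] of maximal size spans [lin K]. The intersection that defines
    [lin] is thereby replaced by linear combinations of points of [K]. *)
Lemma lin_free K : exists X : seq E,
  [/\ forall x, x \in X -> K x, free X & lin K = [set` <<X>>%VS]].
Proof.
pose p n := `[< exists X : seq E, [/\ forall x, x \in X -> K x, free X & size X = n] >].
have p0 : exists n, p n.
  by exists 0%N; apply/asboolP; exists [::]; split => //; exact: nil_free.
have pmax n : p n -> (n <= d.+1)%N.
  move=> /asboolP[X [_ fX <-]]; rewrite -(eqnP fX).
  by rewrite (leq_trans (dimvS (subvf _)))// dimvf /dim /= mul1n.
have [n /asboolP[X [XK fX Xn]] nmax] := ex_maxnP p0 pmax.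
exists X; split=> //; apply/seteqP; split.
  apply: lin_sub_vspace => x Kx /=; apply: contrapT => /negP xX.
  have : p n.+1.
    apply/asboolP; exists (x :: X); split => [y| |/=]; last by rewrite Xn.
    - by rewrite inE => /orP[/eqP -> //|/XK].
    - by rewrite free_cons xX.
  by move=> /nmax; rewrite ltnn.
move=> x /= xX V KV; move: xX => /=; apply/subvP/span_subvP => y /XK.
exact: KV.
Qed.

Lemma linD K x y : lin K x -> lin K y -> lin K (x + y).
Proof.
by have [X [_ _ ->]] := lin_free K; move=> /= xX yX; exact: rpredD.
Qed.

Lemma linZ K c x : lin K x -> lin K (c *: x).
Proof. by have [X [_ _ ->]] := lin_free K; move=> /= xX; exact: rpredZ. Qed.

Lemma lin0 K : lin K 0.
Proof. by have [X [_ _ ->]] := lin_free K; rewrite /= mem0v. Qed.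

Lemma linB K x y : lin K x -> lin K y -> lin K (x - y).
Proof.
by have [X [_ _ ->]] := lin_free K; move=> /= xX yX; exact: rpredB.
Qed.

Lemma lin_sphere V : lin ([set` V] `&` usphere) = [set` V].
Proof.
apply/seteqP; split; first exact: lin_sub_vspace (@subIsetl _ _ _).
move=> x xV; have [->|x0] := eqVneq x 0; first exact: lin0.
rewrite -[x]scale1r -(@divff _ (enorm x)) ?gt_eqF ?enorm_gt0// -scalerA.
apply/linZ/sub_lin; split; last exact: normalize_usphere.
by rewrite /= rpredZ.
Qed.

Lemma great_subsphereP k S : great_subsphere k S <->
  lin S `&` usphere = S /\ exists X : seq E,
    [/\ forall x, x \in X -> S x, free X, size X = k.+1 & lin S = [set` <<X>>%VS]].
Proof.
split=> [[V Vk ->]|[LS [X [XS fX Xk LX]]]].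
  rewrite lin_sphere; split=> //.
  have [X [XS fX LX]] := lin_free ([set` V] `&` usphere).
  exists X; split=> //; last by rewrite -LX lin_sphere.
  rewrite -Vk -(eqnP fX); congr (\dim _); apply/vspaceP => x.
  have := congr1 (fun P : set E => P x) LX; rewrite lin_sphere /= => e.
  by apply/idP/idP; rewrite e.
by exists <<X>>%VS; [rewrite (eqnP fX)|rewrite -LX].
Qed.

Lemma lin_great_subsphere k S : great_subsphere k S -> lin S `&` usphere = S.
Proof. by move=> /great_subsphereP[]. Qed.

Lemma great_subsphere_nonempty k S : great_subsphere k S -> S !=set0.
Proof.
move=> /great_subsphereP[_ [[|x X] [XS _ // _ _]]].
by exists x; apply: XS; rewrite mem_head.
Qed.

Lemma great_subsphere_convex k S :
  great_subsphere k S -> spherical_convex S.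
Proof.
move=> Sk; have LS := lin_great_subsphere Sk; exists (lin S); split => //.
  exact: closed_convex_cone_lin.
move=> L0; have [x Sx] := great_subsphere_nonempty Sk.
have := sub_lin Sx; rewrite L0 /= => x0.
by move: Sx; rewrite -LS x0 => -[_]; exact: usphere0.
Qed.

Lemma great_subsphere_cut k S a x : great_subsphere k.+1 S -> S x ->
  dotp a x != 0 -> great_subsphere k (S `&` perp a).
Proof.
move=> [V Vk ->] [/= xV _] ax; have [W -> WU] := perp_vspace a.
exists (V :&: W)%VS.
  have [_ /(_ (ex_intro2 _ _ x xV ax))] := WU V.
  by rewrite Vk => -[].
rewrite -setIA [usphere `&` _]setIC setIA; congr (_ `&` _).
by apply/seteqP; split=> y /=; rewrite memv_cap => /andP.
Qed.

Lemma perp_great_subsphere a : (0 < d)%N -> a != 0 ->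
  great_subsphere d.-1 (perp a `&` usphere).
Proof.
move=> d0 a0; rewrite setIC; apply: (@great_subsphere_cut _ _ _ ((enorm a)^-1 *: a)).
- exists fullv; first by rewrite dimvf /dim /= mul1n prednK.
  by apply/seteqP; split => [y|y []//]; rewrite /= memvf.
- exact: normalize_usphere.
- by rewrite dotpZr mulf_neq0// ?invr_neq0// gt_eqF// ?enorm_gt0// dotp_gt0.
Qed.

Lemma hypersphere_normal S : (0 < d)%N -> great_subsphere d.-1 S ->
  exists2 a, usphere a & S = perp a `&` usphere.
Proof.
move=> d0 [V]; rewrite prednK// => Vd ->.
have [M MM] := orthogonal_to_std (basis_free (vbasisP V)).
rewrite (span_basis (vbasisP V)) size_tuple Vd => VM.
pose e : E := delta_mx 0 ord_max.
have eE i : e 0 i = (i == ord_max)%:R by rewrite mxE.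
have ee : dotp e e = 1.
  rewrite /dotp (bigD1 ord_max)//= !eE eqxx mulr1 big1 ?addr0//.
  by move=> i ij; rewrite !eE (negbTE ij) mulr0.
(* [M] carries [V] to the first [d] coordinates, so the last coordinate vector, carried back by
   [M^T], is normal to [V]. *)
exists (e *m M^T).
  by apply/usphereE; rewrite dotp_orthogonal// trmxK orthogonal_inv.
congr (_ `&` _); apply/seteqP.
have H x : dotp (e *m M^T) x = (x *m M) 0 ord_max.
  rewrite -(@dotp_orthogonal _ _ M)// -mulmxA (orthogonal_inv MM) mulmx1.
  rewrite /dotp (bigD1 ord_max)//= eE eqxx mul1r big1 ?addr0//.
  by move=> i ij; rewrite eE (negbTE ij) mul0r.
rewrite /perp; split=> x /=; rewrite H.
  by move=> /VM/mem_std_space; exact.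
move=> xd; apply/VM/mem_std_space => i di; rewrite -[RHS]xd; congr (_ _ _).
by apply/val_inj/eqP; rewrite eqn_leq di -ltnS ltn_ord.
Qed.

(** The vectors are the rows of a matrix with a right inverse [B]. A linear relation [v] among
    nearby vectors satisfies [v = v *m ((A X - A Y) *m B)], and the radius makes this map a
    contraction, so that [v = 0]. *)
Lemma free_open n (X : n.-tuple E) : free X -> exists2 e : R, 0 < e &
  forall Y : n.-tuple E, (forall i : 'I_n, `|X`_i - Y`_i| < e) -> free Y.
Proof.
move=> fX; pose A (Z : n.-tuple E) : 'M[R]_(n, d.+1) := \matrix_i Z`_i.
have fA (Z : n.-tuple E) : free Z <-> row_free (A Z).
  split=> [/freeP fZ|/row_free_inj fZ].
    apply: inj_row_free => v vA; apply/rowP => i; rewrite mxE.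
    apply: (fZ (fun i => v 0 i)); rewrite -[RHS]vA mulmx_sum_row.
    by apply: eq_bigr => j _; rewrite rowK.
  apply/freeP => k k0 i; have : \row_i k i = 0.
    apply: fZ; rewrite mul0mx mulmx_sum_row -[RHS]k0; apply: eq_bigr => j _.
    by rewrite rowK mxE.
  by move/rowP => /(_ i); rewrite !mxE.
have /row_freeP[B AB] : row_free (A X) by exact/fA.
pose b := 1 + \sum_i \sum_j `|B i j|.
have b0 : 0 < b by rewrite ltr_pwDl// !sumr_ge0// => i _; rewrite sumr_ge0.
have Bb j : \sum_i `|B i j| <= b.
  rewrite /b [leLHS](_ : _ = 0 + \sum_i `|B i j|) ?add0r// ler_wpDl// exchange_big.
  by rewrite /= (bigD1 j)//= lerDl sumr_ge0// => i _; rewrite sumr_ge0.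
have n0 : 0 < n.+1%:R :> R by [].
(* [b] bounds the column sums of the absolute values in [B], so the entries of [(A X - A Y) *m B]
   are at most [1 / (n + 1)]; summing [n] of them gives a factor below 1. *)
exists (b * n.+1%:R)^-1; first by rewrite invr_gt0 mulr_gt0.
move=> Y XY; apply/fA; apply: inj_row_free => v vY.
have vB : v = v *m ((A X - A Y) *m B).
  by rewrite mulmxBl mulmxBr AB mulmx1 (mulmxA v (A Y)) vY mul0mx subr0.
have Db i j : `|((A X - A Y) *m B) i j| <= n.+1%:R^-1.
  rewrite mxE (le_trans (ler_norm_sum _ _ _))//.
  apply: (@le_trans _ _ (\sum_k (b * n.+1%:R)^-1 * `|B k j|)).
    apply: ler_sum => k _; rewrite normrM ler_wpM2r//.
    have := XY i => /ltW; apply: le_trans.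
    by rewrite -[leLHS](_ : `|(X`_i - Y`_i) 0 k| = _) ?coord_le_norm// !mxE.
  rewrite -mulr_sumr (le_trans (ler_wpM2l _ (Bb j)))//.
    by rewrite invr_ge0 ltW// mulr_gt0.
  by rewrite invfM mulrAC mulVf ?mul1r// gt_eqF.
pose m := \big[Num.max/0]_i `|v 0 i|.
have vm i : `|v 0 i| <= m by exact: le_bigmax.
have m0 : 0 <= m by exact: bigmax_ge_id.
have mle : m <= n%:R / n.+1%:R * m.
  apply/bigmax_leP; split => [|i _]; first by rewrite mulr_ge0// divr_ge0.
  rewrite {1}vB mxE (le_trans (ler_norm_sum _ _ _))//.
  apply: (@le_trans _ _ (\sum_(j < n) m * n.+1%:R^-1)).
    by apply: ler_sum => j _; rewrite normrM ler_pM.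
  by rewrite sumr_const card_ord -[leLHS]mulr_natl mulrA mulrAC.
have m00 : m = 0.
  apply/eqP; rewrite eq_le m0 andbT.
  have : m * (1 - n%:R / n.+1%:R) <= 0 by rewrite mulrBr mulr1 subr_le0 mulrC.
  rewrite pmulr_lle0// subr_gt0 ltr_pdivrMr// mul1r ltr_nat//.
by apply/rowP => i; apply/eqP; rewrite mxE -normr_le0 -m00.
Qed.

(** A point of [lin K] combines finitely many points of [K]. With the coefficients kept fixed,
    replacing these points by nearby points of [K'] moves the combination only a little. *)
Lemma lin_hits_open K (G : set E) y : open G -> lin K y -> G y ->
  exists2 e : R, 0 < e & forall K',
    (forall x, K x -> exists2 x', K' x' & `|x - x'| < e) -> lin K' `&` G !=set0.
Proof.
move=> oG Ky Gy; have [X [XK fX LX]] := lin_free K.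
have := Ky; rewrite LX /= => /(coord_span (X := in_tuple X)) yE.
have /nbhs_ballP[e /= e0 eG] : nbhs y G by exact: open_nbhs_nbhs.
pose b := 1 + \sum_(i < size X) `|coord (in_tuple X) i y|.
have b0 : 0 < b by rewrite ltr_pwDl// sumr_ge0.
exists (e / b); first by rewrite divr_gt0.
move=> K' KK'.
have /choice[x' x'P] : forall i : 'I_(size X), exists x', K' x' /\ `|X`_i - x'| < e / b.
  by move=> i; have [x' K'x' Xx'] := KK' _ (XK _ (mem_nth 0 (ltn_ord i))); exists x'.
exists (\sum_i coord (in_tuple X) i y *: x' i); split.
  elim/big_ind : _ => [||i _]; [exact: lin0|exact: linD|].
  by apply/linZ/sub_lin; have [] := x'P i.
apply: eG; rewrite -ball_normE /= {1}yE -sumrB (le_lt_trans (ler_norm_sum _ _ _))//.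
apply: (@le_lt_trans _ _ (\sum_(i < size X) `|coord (in_tuple X) i y| * (e / b))).
  apply: ler_sum => i _; rewrite -scalerBr normrZ ler_wpM2l//.
  by have [_ /ltW] := x'P i.
rewrite -mulr_suml mulrC mulrAC ltr_pdivrMr// ltr_pM2l//.
by rewrite /b ltrDr.
Qed.

End subspheres.

(** * The space of spherically convex bodies *)

Section bodies.
Variables (R : realType) (d : nat).
Notation E := 'rV[R]_d.+1.
Notation KS := (sbody R d).
Implicit Types (x y z : E) (K L : KS) (G C : set E) (e r : R).

Lemma sset_inj : injective (@sset R d).
Proof.
move=> [A HA] [B HB] /= AB; move: HA HB; rewrite AB => HA HB.
by congr SBody; exact: Prop_irrelevance.
Qed.

Lemma sset_sphere K x : sset K x -> usphere x.
Proof. by have [C [_ _ ->]] := sbodyP K => -[]. Qed.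

Lemma sset_nonempty K : sset K !=set0.
Proof. by have [C [CC C0 ->]] := sbodyP K; exact: cone_neq0_usphere. Qed.

Lemma closed_sset K : closed (sset K).
Proof.
have [C [[cC _ _] _ ->]] := sbodyP K.
by apply: closedI => //; exact: closed_usphere.
Qed.

Lemma compact_sset K : compact (sset K).
Proof.
refine (subclosed_compact (@closed_sset K) (@compact_usphere R d) _).
by move=> x; exact: sset_sphere.
Qed.

Lemma usphere_dotp_itv x y : usphere x -> usphere y -> -1 <= dotp x y <= 1.
Proof.
move=> sx sy; rewrite -ler_norml (le_trans (cauchy_schwarz _ _))//.
by rewrite sx sy mulr1.
Qed.

Lemma sdist_small e : 0 < e -> exists2 r, 0 < r &
  forall x y, usphere x -> usphere y -> sdist x y < r -> enorm (x - y) < e.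
Proof.
move=> e0.
have e20 : 0 < e ^+ 2 / 2 by rewrite divr_gt0// exprn_gt0.
have /cvgrPdist_lt/(_ _ e20) := @continuous_cos R 0.
move=> /nbhs_ballP[r /= r0 rP]; exists r => // x y sx sy.
have xy := usphere_dotp_itv sx sy.
move=> sr; have := rP (sdist x y).
rewrite /ball /= sub0r normrN ger0_norm ?acos_ge0// => /(_ sr).
rewrite /sdist acosK ?in_itv//= dotp_unit_sub// cos0 subKr.
rewrite ger0_norm ?divr_ge0 ?sqr_ge0// ltr_pM2r//.
by rewrite ltr_pXn2r ?nnegrE ?enorm_ge0// ltW.
Qed.

Lemma enorm_small r : 0 < r -> exists2 e, 0 < e &
  forall x y, usphere x -> usphere y -> enorm (x - y) < e -> sdist x y <= r.
Proof.
move=> r0; have [rpi|pir] := leP r pi; last first.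
  exists 1 => // x y sx sy _; apply: le_trans (ltW pir).
  by rewrite acos_lepi// usphere_dotp_itv.
have c1 : cos r < 1.
  by rewrite -(@cos0 R) ltr_cos// in_itv/= ?lexx ?pi_ge0 ?rpi ?ltW.
have e20 : 0 < 2 * (1 - cos r) by rewrite mulr_gt0// subr_gt0.
exists (Num.sqrt (2 * (1 - cos r))); first by rewrite sqrtr_gt0.
move=> x y sx sy xy; rewrite leNgt; apply/negP => rxy.
have dxy := usphere_dotp_itv sx sy.
have i1 : sdist x y \in `[0, pi] by rewrite in_itv/= acos_ge0//= acos_lepi.
have i2 : r \in `[0, pi] by rewrite in_itv/= (ltW r0).
move: rxy; rewrite -ltr_cos//.
rewrite /sdist acosK ?in_itv//= dotp_unit_sub// ltNge => /negP; apply.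
have : enorm (x - y) ^+ 2 < 2 * (1 - cos r).
  by rewrite -[ltRHS]sqr_sqrtr ?(ltW e20)// ltr_pXn2r ?nnegrE ?enorm_ge0 ?sqrtr_ge0.
by lra.
Qed.

Lemma hausdorff_dist_small e : 0 < e -> exists2 r, 0 < r & forall K L,
  hausdorff_dist K L < r ->
  (forall x, sset K x -> exists2 y, sset L y & `|x - y| < e) /\
  (forall y, sset L y -> exists2 x, sset K x & `|x - y| < e).
Proof.
move=> e0; have [r r0 H] := sdist_small e0; exists r => // K L.
move=> /inf_lt[|s [s0 KL LK] sr].
  (* [pi] bounds every spherical distance, so the set whose [inf] is taken is not empty. *)
  exists pi; split; [exact: pi_ge0| |].
  - move=> x Kx; have [y Ly] := sset_nonempty L; exists y => //.
    by rewrite acos_lepi// (usphere_dotp_itv (sset_sphere Kx) (sset_sphere Ly)).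
  - move=> y Ly; have [x Kx] := sset_nonempty K; exists x => //.
    by rewrite acos_lepi// (usphere_dotp_itv (sset_sphere Kx) (sset_sphere Ly)).
split=> [x Kx|y Ly].
  have [y Ly xy] := KL _ Kx; exists y => //.
  apply: le_lt_trans (norm_le_enorm _) _; exact: H (sset_sphere Kx) (sset_sphere Ly) (le_lt_trans xy sr).
have [x Kx xy] := LK _ Ly; exists x => //.
apply: le_lt_trans (norm_le_enorm _) _; exact: H (sset_sphere Kx) (sset_sphere Ly) (le_lt_trans xy sr).
Qed.

Lemma small_hausdorff_dist r : 0 < r -> exists2 e, 0 < e & forall K L,
  (forall x, sset K x -> exists2 y, sset L y & `|x - y| < e) ->
  (forall y, sset L y -> exists2 x, sset K x & `|x - y| < e) ->
  hausdorff_dist K L < r.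
Proof.
move=> r0; have [e e0 H] := @enorm_small (r / 2) (divr_gt0 r0 (ltr0n _ 2)).
exists (e / d.+1%:R); first by rewrite divr_gt0.
have H' x y : usphere x -> usphere y -> `|x - y| < e / d.+1%:R -> sdist x y <= r / 2.
  move=> sx sy xy; apply: H => //; apply: le_lt_trans (enorm_le_norm _) _.
  by rewrite mulrC -ltr_pdivlMr.
move=> K L KL LK; apply: (@le_lt_trans _ _ (r / 2)); last by lra.
apply: ge_inf; first by exists 0 => s [].
split => [|x Kx|y Ly]; first by rewrite divr_ge0// ltW.
  have [y Ly xy] := KL _ Kx; exists y => //; exact: H' (sset_sphere Kx) (sset_sphere Ly) xy.
have [x Kx xy] := LK _ Ly; exists x => //; exact: H' (sset_sphere Kx) (sset_sphere Ly) xy.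
Qed.

Lemma hits_open G : open G -> hausdorff_open [set K | sset K `&` G !=set0].
Proof.
move=> oG K [x [Kx Gx]].
have /nbhs_ballP[e /= e0 eG] : nbhs x G by exact: open_nbhs_nbhs.
have [r r0 H] := hausdorff_dist_small e0; exists r => // L /H[/(_ _ Kx)[y Ly xy] _].
by exists y; split => //; apply: eG; rewrite -ball_normE.
Qed.

Lemma compact_sub_open K G : open G -> sset K `<=` G ->
  exists2 e, 0 < e & forall x y, sset K x -> `|x - y| < e -> G y.
Proof.
move=> oG KG.
have /compact_near_coveringP/(_ R (nbhs 0^'+)
  (fun e x => forall y, `|x - y| < e -> G y)) := @compact_sset K.
move=> /(_ _ _)[|e /= e0 eP].
  move=> x Kx; have /nbhs_ballP[e /= e0 eG] : nbhs x G.
    by apply: open_nbhs_nbhs; split => //; exact: KG.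
  have e20 : 0 < e / 2 by rewrite divr_gt0.
  exists (ball x (e / 2), [set r | r < e / 2]).
    by split; [exact: nbhsx_ballx|exact: nbhs_right_lt].
  move=> [z r] /= [xz rE] y zy; apply: eG; rewrite -ball_normE /=.
  move: xz; rewrite -ball_normE /= => xz.
  rewrite -(subrK z x) -addrA (le_lt_trans (ler_normD _ _))//.
  by rewrite (splitr e) ltrD// (lt_trans zy).
exists (e / 2) => [|x y Kx]; first by rewrite divr_gt0.
apply: (eP (e / 2)) => //=; last by rewrite divr_gt0.
by rewrite sub0r normrN gtr0_norm ?divr_gt0//; lra.
Qed.

Lemma misses_closed_open C : closed C ->
  hausdorff_open [set K | sset K `&` C = set0].
Proof.
move=> cC K /= KC.
have [|e e0 eP] := @compact_sub_open K (~` C) (closed_openC cC).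
  by move=> x Kx Cx; have : (sset K `&` C) x by []; rewrite KC.
have [r r0 H] := hausdorff_dist_small e0; exists r => // L /H[_ LK] /=.
apply/seteqP; split => // y [Ly Cy].
by have [x Kx /(eP _ _ Kx)] := LK _ Ly; exact.
Qed.

Lemma lin_hits_hausdorff_open G : open G ->
  hausdorff_open [set K | lin (sset K) `&` G !=set0].
Proof.
move=> oG K [y [Ky Gy]].
have [e e0 H] := lin_hits_open oG Ky Gy.
have [r r0 H'] := hausdorff_dist_small e0; exists r => // L /H'[KL _].
exact: H.
Qed.

Lemma rank_ge_open n : hausdorff_open [set K | exists X : n.-tuple E,
  free X /\ forall i : 'I_n, sset K X`_i].
Proof.
move=> K [X [fX XK]]; have [e e0 H] := free_open fX.
have [r r0 H'] := hausdorff_dist_small e0; exists r => // L /H'[KL _].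
have /choice[Y YP] : forall i : 'I_n, exists y, sset L y /\ `|X`_i - y| < e.
  by move=> i; have [y ? ?] := KL _ (XK i); exists y.
exists [tuple Y i | i < n]; split.
  by apply: H => i; rewrite nth_mktuple; have [] := YP i.
by move=> i; rewrite nth_mktuple; have [] := YP i.
Qed.

End bodies.

Section countable_ops.
Context (disp : measure_display) (T : measurableType disp) (I : countType).

Lemma bigcup_countType_measurable (F : I -> set T) :
  (forall i, measurable (F i)) -> measurable (\bigcup_i F i).
Proof. by move=> mF; apply: countable_bigcupT_measurable => //; exact: countableP. Qed.

Lemma bigcap_countType_measurable (F : I -> set T) :
  (forall i, measurable (F i)) -> measurable (\bigcap_i F i).
Proof.
move=> mF; rewrite -[X in measurable X]setCK setC_bigcap; apply: measurableC.
by apply: bigcup_countType_measurable => i; exact: measurableC.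
Qed.

End countable_ops.

(** * The Borel sigma-algebra of the space of bodies *)

Section measurability.
Variables (R : realType) (d : nat).
Notation E := 'rV[R]_d.+1.
Notation KS := (sbody R d).
Notation bidx := ('rV[rat]_d.+1 * nat)%type.
Implicit Types (x y z : E) (K L : KS) (G C : set E) (e r : R).

Definition rpoint (q : 'rV[rat]_d.+1) : E := map_mx ratr q.

Definition rball (b : bidx) : set E :=
  [set y | `|rpoint b.1 - y| < b.2.+1%:R^-1].

Lemma rad_gt0 i : 0 < i.+1%:R^-1 :> R.
Proof. by rewrite invr_gt0. Qed.

Lemma rad_small e : 0 < e -> exists i : nat, i.+1%:R^-1 < e.
Proof.
move=> e0; have [i _ H] := near_infty_natSinv_lt (PosNum e0).
by exists i; exact: (H i (leqnn i)).
Qed.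

Lemma rpoint_dense x e : 0 < e -> exists q, `|rpoint q - x| < e.
Proof.
move=> e0.
have /choice[f fP] : forall i, exists q : rat, `|ratr q - x 0 i| < e.
  move=> i; have [|q] := @rat_in_itvoo R (x 0 i - e) (x 0 i + e); first by lra.
  by rewrite in_itv/= => /andP[? ?]; exists q; rewrite ltr_norml; lra.
exists (\row_i f i); apply: norm_lt_coord => // i.
by rewrite !mxE.
Qed.

Lemma open_rball b : open (rball b).
Proof.
have -> : rball b = ball (rpoint b.1) b.2.+1%:R^-1 by rewrite -ball_normE.
by apply: ball_open; exact: rad_gt0.
Qed.

Lemma open_rball_sub G x : open G -> G x -> exists b, rball b x /\ rball b `<=` G.
Proof.
move=> oG Gx; have /nbhs_ballP[e /= e0 eG] : nbhs x G by exact: open_nbhs_nbhs.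
have [i ie] := @rad_small (e / 2) (divr_gt0 e0 (ltr0n _ 2)).
have [q qx] := @rpoint_dense x _ (rad_gt0 i).
exists (q, i); split => // y; rewrite /rball /= => qy; apply: eG.
rewrite -ball_normE /= -(subrK (rpoint q) x) -addrA (le_lt_trans (ler_normD _ _))//.
by rewrite distrC (splitr e) ltrD// (lt_trans _ ie).
Qed.

Definition hits (b : bidx) : set KS := [set K | sset K `&` rball b !=set0].

Lemma hits_rballE K L : (forall b, hits b K -> hits b L) -> sset K `<=` sset L.
Proof.
move=> KL x Kx; apply: contrapT => Lx.
have [b [bx bL]] := open_rball_sub (closed_openC (@closed_sset _ _ L)) Lx.
have [|y [Ly by_]] := KL b; first by exists x.
exact: bL by_ Ly.
Qed.

Lemma rational_net i : exists s : seq 'rV[rat]_d.+1,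
  forall x, usphere x -> exists2 q, q \in s & rball (q, i) x.
Proof.
have := @compact_usphere R d; rewrite compact_cover.
move=> /(_ _ setT (fun q => rball (q, i)))[q _| |D _ Dc].
- exact: open_rball.
- move=> x _; have [q qx] := @rpoint_dense x _ (rad_gt0 i).
  by exists q.
- exists (finmap.enum_fset D) => x /Dc[q /= qD qx].
  by exists q.
Qed.

(** For each [i] finitely many balls of radius [1 / (i + 1)] cover the sphere. Bodies that hit the
    same balls of this net are within [2 / (i + 1)] of one another, so an open set is the union of
    the classes that it contains; the classes, indexed by [i] and a finite list, are countably
    many. *)
Lemma hausdorff_open_generated (U : set KS) : @hausdorff_open R d U ->
  <<s range hits >> U.
Proof.
move=> oU; have /choice[net netP] := rational_net.
pose cls (p : nat * seq 'rV[rat]_d.+1) : set KS :=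
  [set K | forall q, q \in net p.1 -> (hits (q, p.1) K <-> q \in p.2)].
pose T := g_sigma_algebraType (range hits).
have mhits b : measurable (hits b : set T).
  by apply: sub_sigma_algebra; exists b.
have mcls p : measurable (cls p : set T).
  have -> : cls p = \bigcap_q [set K | q \in net p.1 -> (hits (q, p.1) K <-> q \in p.2)].
    by apply/seteqP; split => [K H q _|K H q]; [exact: H|exact: (H q I)].
  apply: (@bigcap_countType_measurable _ T) => q.
  have [qn|qn] := boolP (q \in net p.1); last first.
    by rewrite (_ : mkset _ = setT)//; apply/seteqP; split.
  have [qp|qp] := boolP (q \in p.2).
    rewrite (_ : mkset _ = hits (q, p.1))//.
    by apply/seteqP; split => K /=; [move=> /(_ isT)[_]; exact|].
  rewrite (_ : mkset _ = ~` hits (q, p.1)); first exact: measurableC.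
  by apply/seteqP; split => K /=; [move=> /(_ isT)[H _] /H|move=> H _; split].
have -> : U = \bigcup_p (if `[< cls p `<=` U >] then cls p else set0).
  apply/seteqP; split => [K UK|K [p _]]; last by case: asboolP => // pU /pU.
  have [r r0 rU] := oU _ UK; have [e e0 eH] := small_hausdorff_dist d r0.
  have [i ie] := @rad_small (e / 2) (divr_gt0 e0 (ltr0n _ 2)).
  pose s := [seq q <- net i | `[< hits (q, i) K >]].
  have Ks : cls (i, s) K.
    move=> q /= qn; rewrite mem_filter qn andbT.
    by split => [?|/asboolP//]; apply/asboolP.
  have close L M : cls (i, s) L -> cls (i, s) M -> forall x, sset L x ->
      exists2 y, sset M y & `|x - y| < e.
    move=> Ls Ms x Lx; have [q qn qx] := netP i _ (sset_sphere Lx).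
    have /(Ls _ qn) /(Ms _ qn)[y [My qy]] : hits (q, i) L by exists x.
    exists y => //; rewrite -(subrK (rpoint q) x) -addrA.
    rewrite (le_lt_trans (ler_normD _ _))// distrC (splitr e) ltrD//.
      exact: lt_trans qx ie.
    exact: lt_trans qy ie.
  exists (i, s) => //; case: asboolP => // -[]; move=> L Ls; apply/rU/eH.
    exact: close.
  move=> y Ly; have [x Kx yx] := close _ _ Ls Ks _ Ly.
  by exists x => //; rewrite distrC.
apply: (@bigcup_countType_measurable _ T) => p.
by case: asboolP => _; [exact: mcls|exact: measurable0].
Qed.

Lemma borelK_generated :
  (measurable : set (set (borelK R d))) = <<s range hits >>.
Proof.
apply/seteqP; split.
  by apply: smallest_sub; [exact: smallest_sigma_algebra|
    exact: hausdorff_open_generated].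
apply: smallest_sub; first exact: smallest_sigma_algebra.
move=> _ [b _ <-]; apply: sub_sigma_algebra; apply: hits_open.
exact: open_rball.
Qed.

Lemma measurable_hausdorff_open (U : set KS) : @hausdorff_open R d U ->
  measurable (U : set (borelK R d)).
Proof. by move=> oU; exact: sub_sigma_algebra. Qed.

Lemma measurable_hits b : measurable (hits b : set (borelK R d)).
Proof. by apply: measurable_hausdorff_open; apply: hits_open; exact: open_rball. Qed.

Lemma measurable_fun_borelK (disp : measure_display) (T : measurableType disp)
    (f : T -> borelK R d) :
  (forall b, measurable (f @^-1` hits b)) -> measurable_fun setT f.
Proof.
move=> mf; apply: (measurability _ borelK_generated) => _ [_ [b _ <-] <-].
by rewrite setTI.
Qed.

Lemma measurable_openE G : open G -> measurable (G : set (borelE R d)).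
Proof. by move=> oG; exact: sub_sigma_algebra. Qed.

Lemma measurable_closedE C : closed C -> measurable (C : set (borelE R d)).
Proof.
move=> cC; rewrite -[C]setCK; apply: measurableC.
by apply: measurable_openE; exact: closed_openC.
Qed.

Lemma measurable_rball b : measurable (rball b : set (borelE R d)).
Proof. by apply: measurable_openE; exact: open_rball. Qed.

Lemma measurable_continuousE (f : E -> E) : continuous f ->
  measurable_fun setT (f : borelE R d -> borelE R d).
Proof.
move=> cf; apply: (@measurability _ _ (borelE R d) (borelE R d) setT f open) => //.
move=> _ [G oG <-].
by rewrite setTI; apply: measurable_openE; exact: open_comp.
Qed.

Lemma measurable_mem :
  measurable [set p : borelK R d * borelE R d | sset p.1 p.2].
Proof.
have -> : [set p : borelK R d * borelE R d | sset p.1 p.2] =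
    ~` \bigcup_b (~` hits b `*` rball b).
  apply/seteqP; split => [[K x] /= Kx [b _ [/= Kb bx]]|[K x] /= H].
    by apply: Kb; exists x.
  apply: contrapT => Kx.
  have [b [bx bK]] := open_rball_sub (closed_openC (@closed_sset _ _ K)) Kx.
  by apply: H; exists b => //; split => //= -[y [Ky /bK]]; exact.
apply: measurableC; apply: bigcup_countType_measurable => b.
apply: measurableX; last exact: measurable_rball.
by apply: measurableC; exact: measurable_hits.
Qed.

Lemma measurable_incl :
  measurable [set p : borelK R d * borelK R d | sset p.1 `<=` sset p.2].
Proof.
have -> : [set p : borelK R d * borelK R d | sset p.1 `<=` sset p.2] =
    \bigcap_b ~` (hits b `*` ~` hits b).
  apply/seteqP; split => [[K L] /= KL b _ [/= [x [Kx bx]]]|[K L] /= H].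
    by apply; exists x; split => //; exact: KL.
  apply: hits_rballE => b Kb; apply: contrapT => Lb.
  by have := H b I; apply; split.
apply: bigcap_countType_measurable => b; apply: measurableC; apply: measurableX.
  exact: measurable_hits.
by apply: measurableC; exact: measurable_hits.
Qed.

(** The open cone over [G]: it turns a condition on the trace of [lin K] on the sphere into an open
    condition on [lin K]. The first conjunct removes 0, which normalizes to itself. *)
Lemma open_normalize G : open G ->
  open [set y | (enorm y)^-1 *: y != 0 /\ G ((enorm y)^-1 *: y)].
Proof.
move=> oG; pose f (y : E) := (enorm y)^-1 *: y.
have -> : [set y | (enorm y)^-1 *: y != 0 /\ G ((enorm y)^-1 *: y)] =
    f @^-1` (~` [set 0] `&` G).
  by apply/seteqP; split => y /= [/eqP].
apply: open_comp; last by apply: openI => //; apply: closed_openC; exact: accessible_closed_set1 (hausdorff_accessible (@norm_hausdorff _ _)) _.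
move=> y /set_mem[fy0 _].
have y0 : enorm y != 0.
  by apply/eqP => y0; apply: fy0; rewrite /f y0 invr0 scale0r.
exact: (cvgZ (cvgV y0 (@enorm_continuous R d y)) cvg_id).
Qed.

Lemma measurable_direction :
  measurable_fun setT (@direction R d : borelK R d -> borelK R d).
Proof.
apply: measurable_fun_borelK => b.
rewrite (_ : _ @^-1` _ = [set K | lin (sset K) `&`
    [set y | (enorm y)^-1 *: y != 0 /\ rball b ((enorm y)^-1 *: y)] !=set0]).
  apply: measurable_hausdorff_open; apply: lin_hits_hausdorff_open.
  by apply: open_normalize; exact: open_rball.
apply/seteqP; split=> K /= [y].
  move=> [[/= Ky sy] by_]; exists y; split => //=.
  rewrite (_ : enorm y = 1)// invr1 scale1r; split => //.
  exact: usphere_neq0.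
move=> [Ky /= [y0 by_]]; exists ((enorm y)^-1 *: y); split => //=.
split; first exact: linZ.
by apply: normalize_usphere; apply: contra_neq y0 => ->; rewrite scaler0.
Qed.

(** A great [k]-subsphere is a body that equals its own direction, which [D] expresses by hits, and
    contains [k + 1] but not [k + 2] linearly independent points. Containing a given number of
    independent points is an open condition. *)
Lemma measurable_great_subsphere k :
  measurable [set K : borelK R d | great_subsphere k (sset K)].
Proof.
pose rk n := [set K : borelK R d | exists X : n.-tuple E,
  free X /\ forall i : 'I_n, sset K X`_i].
have mrk n : measurable (rk n).
  by apply: measurable_hausdorff_open; exact: rank_ge_open.
pose D := \bigcap_b (~` (hits b) `|` (@direction R d) @^-1` (hits b)) `&`
  \bigcap_b (hits b `|` ~` ((@direction R d) @^-1` (hits b))).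
have -> : [set K : borelK R d | great_subsphere k (sset K)] =
    D `&` rk k.+1 `&` ~` (rk k.+2).
  apply/seteqP; split => K /=.
    move=> /great_subsphereP[LK [X [XK fX Xk LX]]].
    have DK : direction K = K by apply: sset_inj.
    split; first split.
    - rewrite /D; split => b _ /=; rewrite DK; last exact: EM.
      by rewrite orC; exact: EM.
    - by move/eqP : Xk => Xk; exists (Tuple Xk); split => // i; apply: XK;
        rewrite /= mem_nth//= (eqP Xk).
    - move=> [Y [fY YK]].
      suff : (size Y <= size X)%N by rewrite size_tuple Xk ltnn.
      rewrite -(eqnP fY) -(eqnP fX).
      apply: dimvS; apply/span_subvP => y /tnthP[i ->].
      by have := sub_lin (YK i); rewrite LX /= (tnth_nth 0).
  move=> [[[D1 D2] [X [fX XK]]] nrk].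
  have LK : lin (sset K) `&` usphere = sset K.
    apply/seteqP; split.
      apply: (@hits_rballE (direction K) K) => b DKb.
      by have [//|] := D2 b I.
    apply: (@hits_rballE K (direction K)) => b Kb.
    by have [|//] := D1 b I.
  apply/great_subsphereP; split => //.
  have [Y [YK fY LY]] := lin_free (sset K).
  exists Y; split => //; apply/eqP; rewrite eqn_leq; apply/andP; split.
    rewrite leqNgt; apply/negP => kY; apply: nrk.
    have sz : size (take k.+2 Y) == k.+2 by rewrite size_takel.
    exists (Tuple sz); split => /=.
      by move: fY; rewrite -{1}(cat_take_drop k.+2 Y); exact: catl_free.
    move=> i; apply: YK; apply: (@mem_take k.+2); rewrite /= mem_nth//.
    by rewrite (eqP sz).
  suff : (size X <= size Y)%N by rewrite size_tuple.
  rewrite -(eqnP fY) -(eqnP fX); apply: dimvS.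
  apply/span_subvP => y /tnthP[i ->].
  by have := sub_lin (XK i); rewrite LY /= (tnth_nth 0).
have mdir b : measurable ((@direction R d : borelK R d -> borelK R d) @^-1` hits b).
  rewrite -[X in measurable X]setTI.
  by apply: measurable_direction => //; exact: measurable_hits.
apply: measurableI; last exact: measurableC.
apply: measurableI => //; apply: measurableI.
  apply: bigcap_countType_measurable => b; apply: measurableU => //.
  by apply: measurableC; exact: measurable_hits.
apply: bigcap_countType_measurable => b; apply: measurableU; last exact: measurableC.
exact: measurable_hits.
Qed.

End measurability.

(** * Hausdorff measure *)

Section ereal_aux.
Variable R : realType.
Local Open Scope ereal_scope.

Lemma ereal_inf_add_ge (c : \bar R) (S1 S2 : set (\bar R)) :
  (forall u, S1 u -> 0 <= u) -> (forall v, S2 v -> 0 <= v) ->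
  (forall u v, S1 u -> S2 v -> c <= u + v) -> c <= ereal_inf S1 + ereal_inf S2.
Proof.
move=> S1_0 S2_0 H.
have i1 : 0 <= ereal_inf S1 by exact: le_ereal_inf_tmp.
have i2 : 0 <= ereal_inf S2 by exact: le_ereal_inf_tmp.
have [->|f1] := eqVneq (ereal_inf S1) +oo.
  by rewrite addye ?leey// gt_eqF// (lt_le_trans _ i2).
have [->|f2] := eqVneq (ereal_inf S2) +oo.
  by rewrite addey ?leey// gt_eqF// (lt_le_trans _ i1).
have g1 : ereal_inf S1 \is a fin_num by rewrite ge0_fin_numE// ltey.
have g2 : ereal_inf S2 \is a fin_num by rewrite ge0_fin_numE// ltey.
apply/lee_addgt0Pr => e e0; have e20 : (0 < e / 2)%R by rewrite divr_gt0.
have [u Su ue] := lb_ereal_inf_adherent e20 g1.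
have [v Sv ve] := lb_ereal_inf_adherent e20 g2.
apply: le_trans (H _ _ Su Sv) _.
rewrite [in leRHS](splitr e) EFinD addeACA; apply: leeD; exact: ltW.
Qed.

Lemma ereal_sup_add_le (c : \bar R) (S1 S2 : set (\bar R)) :
  S1 !=set0 -> S2 !=set0 ->
  (forall u, S1 u -> 0 <= u) -> (forall v, S2 v -> 0 <= v) ->
  (forall u v, S1 u -> S2 v -> u + v <= c) -> ereal_sup S1 + ereal_sup S2 <= c.
Proof.
move=> [u0 Su0] [v0 Sv0] S1_0 S2_0 H.
have [->|cy] := eqVneq c +oo; first exact: leey.
have c0 : 0 <= c.
  by apply: le_trans (H _ _ Su0 Sv0); apply: adde_ge0; [exact: S1_0|exact: S2_0].
have cf : c \is a fin_num by rewrite ge0_fin_numE// ltey.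
have fu u : S1 u -> u \is a fin_num.
  move=> Su; have uc : u <= c.
    by apply: le_trans (H _ _ Su Sv0); rewrite leeDl//; exact: S2_0.
  rewrite ge0_fin_numE; last exact: S1_0.
  by rewrite (le_lt_trans uc)// ltey.
have s2 u : S1 u -> ereal_sup S2 <= c - u.
  move=> Su; apply: ge_ereal_sup => v Sv.
  by rewrite leeBrDr ?fu// addeC H.
have s20 : 0 <= ereal_sup S2.
  by apply: le_trans (S2_0 _ Sv0) _; exact: ereal_sup_ubound.
have f2 : ereal_sup S2 \is a fin_num.
  rewrite ge0_fin_numE//; apply: le_lt_trans (s2 _ Su0) _.
  by rewrite ltey_eq fin_numB cf fu.
rewrite -leeBrDr//; apply: ge_ereal_sup => u Su.
by rewrite leeBrDr// addeC -leeBrDr ?fu ?s2.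
Qed.

End ereal_aux.

Section hausdorff.
Variables (R : realType) (d k : nat).
Notation E := 'rV[R]_d.+1.
Notation KS := (sbody R d).
Implicit Types (A B U : set E) (e delta : R).
Local Open Scope ereal_scope.

(** The empty set contributes 0: its diameter is [-oo], and for [k = 0] the power would be 1. *)
Definition hterm U : \bar R := if U == set0 then 0 else ediam U ^+ k.

Lemma hterm_sum (U : (set E)^nat) :
  \sum_(0 <= i <oo | U i != set0) ediam (U i) ^+ k = \sum_(0 <= i <oo) hterm (U i).
Proof.
rewrite eseries_mkcond; apply: eq_eseriesr => i _.
by rewrite /hterm; case: eqP.
Qed.

Lemma ediam_ge0 U : U !=set0 -> 0 <= ediam U.
Proof.
move=> [x Ux]; apply: le_ereal_sup_tmp; exists (enorm (x - x))%:E.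
  by exists (x, x).
by rewrite lee_fin enorm_ge0.
Qed.

Lemma hterm_ge0 U : 0 <= hterm U.
Proof.
rewrite /hterm; case: eqP => // /eqP/set0P U0.
by rewrite expe_ge0// ediam_ge0.
Qed.

Lemma hterm_sum_ge0 (U : (set E)^nat) : 0 <= \sum_(0 <= i <oo) hterm (U i).
Proof. by apply: nneseries_ge0 => i _ _; exact: hterm_ge0. Qed.

Lemma hterm_set0 : hterm set0 = 0.
Proof. by rewrite /hterm eqxx. Qed.

Lemma ediam_set0 : ediam (set0 : set E) = -oo.
Proof.
rewrite /ediam (_ : image _ _ = set0) ?ereal_sup0//.
by apply/seteqP; split => // _ [? [[]]].
Qed.

Definition hcover delta A (U : (set E)^nat) :=
  A `<=` \bigcup_i U i /\ forall i, ediam (U i) <= delta%:E.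

Lemma hausdorff_contentE delta A : hausdorff_content k delta A =
  ereal_inf [set \sum_(0 <= i <oo) hterm (U i) | U in hcover delta A].
Proof.
congr ereal_inf; apply/seteqP; split=> _ [U HU <-]; exists U => //.
  by rewrite hterm_sum.
by rewrite hterm_sum.
Qed.

Lemma hausdorff_content_ge0 delta A : 0 <= hausdorff_content k delta A.
Proof.
rewrite hausdorff_contentE; apply: le_ereal_inf_tmp => _ [U _ <-].
exact: hterm_sum_ge0.
Qed.

Lemma hausdorff_content_le delta A (U : (set E)^nat) : hcover delta A U ->
  hausdorff_content k delta A <= \sum_(0 <= i <oo) hterm (U i).
Proof.
by move=> HU; rewrite hausdorff_contentE; apply: ereal_inf_lbound; exists U.
Qed.

Lemma le_hausdorff_content delta A B : A `<=` B ->
  hausdorff_content k delta A <= hausdorff_content k delta B.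
Proof.
move=> AB; rewrite [leRHS]hausdorff_contentE.
apply: le_ereal_inf_tmp => _ [U [BU dU] <-].
by apply: hausdorff_content_le; split => //; exact: subset_trans BU.
Qed.

Lemma hausdorff_content_delta delta delta' A : (delta <= delta')%R ->
  hausdorff_content k delta' A <= hausdorff_content k delta A.
Proof.
move=> dd; rewrite [leRHS]hausdorff_contentE.
apply: le_ereal_inf_tmp => _ [U [AU dU] <-].
apply: hausdorff_content_le; split => // i.
by apply: le_trans (dU i) _; rewrite lee_fin.
Qed.

Lemma hausdorff_content_measure delta A : (0 < delta)%R ->
  hausdorff_content k delta A <= hausdorff_measure k A.
Proof. by move=> d0; apply: ereal_sup_ubound; exists delta. Qed.

Lemma hausdorff_measure_ge0 A : 0 <= hausdorff_measure k A.
Proof.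
apply: le_trans (hausdorff_content_ge0 1 A) _.
exact: hausdorff_content_measure.
Qed.

Lemma le_hausdorff_measure A B : A `<=` B ->
  hausdorff_measure k A <= hausdorff_measure k B.
Proof.
move=> AB; apply: ge_ereal_sup => _ [delta /= d0 <-].
apply: le_trans (hausdorff_content_measure B d0).
exact: le_hausdorff_content.
Qed.

Lemma hausdorff_measureU A B :
  hausdorff_measure k (A `|` B) <= hausdorff_measure k A + hausdorff_measure k B.
Proof.
apply: ge_ereal_sup => _ [delta /= d0 <-].
apply: (@le_trans _ _ (hausdorff_content k delta A + hausdorff_content k delta B)).
  rewrite [in leRHS]hausdorff_contentE [X in _ <= _ + X]hausdorff_contentE.
  apply: ereal_inf_add_ge.
  - by move=> _ [U _ <-]; exact: hterm_sum_ge0.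
  - by move=> _ [U _ <-]; exact: hterm_sum_ge0.
  move=> _ _ [U [AU dU] <-] [V [BV dV] <-].
  (* The covers are interleaved, so that the first [2n] terms of the new series are the first [n]
     terms of both. *)
  pose W i := if odd i then V i./2 else U i./2.
  apply: le_trans (hausdorff_content_le (U := W) _) _.
    split=> [x [/AU[i _ Ux]|/BV[i _ Vx]]|i].
    - by exists i.*2 => //; rewrite /W odd_double doubleK.
    - by exists i.*2.+1 => //; rewrite /W /= odd_double uphalf_double.
    - by rewrite /W; case: ifP.
  apply: lime_le.
    by apply: is_cvg_nneseries => i _ _; exact: hterm_ge0.
  apply: nearW => n.
  apply: (@le_trans _ _ (\sum_(0 <= i < n.*2) hterm (W i))).
    rewrite (@big_cat_nat _ _ _ n 0 n.*2)//=; last by rewrite -addnn leq_addr.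
    by rewrite leeDl// sume_ge0// => i _; exact: hterm_ge0.
  have -> : \sum_(0 <= i < n.*2) hterm (W i) =
      \sum_(0 <= i < n) hterm (U i) + \sum_(0 <= i < n) hterm (V i).
    elim: n => [|n IH]; first by rewrite !big_geq// adde0.
    rewrite doubleS !big_nat_recr//= IH /W /= odd_double doubleK uphalf_double.
    by rewrite -!addeA; congr (_ + _); rewrite addeCA.
  by apply: leeD; apply: nneseries_lim_ge => i _ _; exact: hterm_ge0.
by apply: leeD; exact: hausdorff_content_measure.
Qed.

Lemma hausdorff_measureU_separated A B e : (0 < e)%R ->
  (forall x y, A x -> B y -> e <= enorm (x - y))%R ->
  hausdorff_measure k A + hausdorff_measure k B <= hausdorff_measure k (A `|` B).
Proof.
move=> e0 AB; apply: ereal_sup_add_le.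
- by exists (hausdorff_content k 1 A); exists 1%R => //=; exact: ltr01.
- by exists (hausdorff_content k 1 B); exists 1%R => //=; exact: ltr01.
- by move=> _ [delta _ <-]; exact: hausdorff_content_ge0.
- by move=> _ [delta _ <-]; exact: hausdorff_content_ge0.
move=> _ _ [d1 /= d10 <-] [d2 /= d20 <-].
(* A piece of diameter at most [e / 2] cannot meet both [A] and [B], so a cover of the union splits
   into a cover of each. *)
pose delta : R := Num.min (Num.min d1 d2) (e / 2)%R.
have d0 : (0 < delta)%R by rewrite !lt_min d10 d20 divr_gt0.
apply: le_trans (hausdorff_content_measure _ d0).
apply: (@le_trans _ _ (hausdorff_content k delta A + hausdorff_content k delta B)).
  by apply: leeD; apply: hausdorff_content_delta; rewrite /delta !ge_min lexx ?orbT.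
rewrite [leRHS]hausdorff_contentE.
apply: le_ereal_inf_tmp => _ [U [ABU dU] <-].
pose part (C : set E) i := if `[< U i `&` C !=set0 >] then U i else set0.
have dpart C i : ediam (part C i) <= delta%:E.
  rewrite /part; case: asboolP => // _.
  by rewrite ediam_set0 leNye.
have cpart C : C `<=` A `|` B -> hcover delta C (part C).
  move=> CAB; split; last exact: dpart.
  move=> x Cx; have [i _ Ux] := ABU _ (CAB _ Cx).
  exists i => //; rewrite /part; case: asboolP => // H; exfalso.
  by apply: H; exists x.
apply: (@le_trans _ _ (\sum_(0 <= i <oo) hterm (part A i) + \sum_(0 <= i <oo) hterm (part B i))).
  by apply: leeD; apply: hausdorff_content_le; apply: cpart => x; [left|right].
rewrite -nneseriesD; [|by move=> i _ _; exact: hterm_ge0..].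
apply: lee_nneseries => [i _ _|i _].
  by rewrite adde_ge0// hterm_ge0.
rewrite /part; case: asboolP => [[x [Ux Ax]]|_]; case: asboolP => [[y [Uy By]]|_];
  rewrite ?hterm_set0 ?adde0 ?add0e//; last exact: hterm_ge0.
exfalso; have : (enorm (x - y))%:E <= delta%:E.
  apply: le_trans (dU i); apply: ereal_sup_ubound.
  by exists (x, y).
rewrite lee_fin leNgt => /negP; apply; apply: lt_le_trans (AB _ _ Ax By).
by rewrite gt_min ltr_pdivrMr// ltr_pMr// ltr1n orbT.
Qed.

Lemma ediam_orthogonal (M : 'M[R]_d.+1) U : (M *m M^T = 1%:M)%R ->
  ediam [set x *m M | x in U]%R = ediam U.
Proof.
move=> MM; congr ereal_sup; apply/seteqP; split.
  move=> _ [[_ _] [/= [x Ux <-] [y Uy <-]] <-]; exists (x, y) => //=.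
  by rewrite -mulmxBl /enorm dotp_orthogonal.
move=> _ [[x y] [/= Ux Uy] <-]; exists (x *m M, y *m M)%R => /=.
  by split; [exists x|exists y].
by rewrite -mulmxBl /enorm dotp_orthogonal.
Qed.

Let hausdorff_measure_orthogonal_le (M : 'M[R]_d.+1) A : (M *m M^T = 1%:M)%R ->
  hausdorff_measure k [set x *m M | x in A]%R <= hausdorff_measure k A.
Proof.
move=> MM; apply: ge_ereal_sup => _ [delta /= d0 <-].
apply: le_trans (hausdorff_content_measure _ d0).
rewrite [leRHS]hausdorff_contentE.
apply: le_ereal_inf_tmp => _ [U [AU dU] <-].
apply: le_trans (hausdorff_content_le (U := fun i => [set x *m M | x in U i]%R) _) _.
  split=> [_ [x /AU[i _ Ux] <-]|i]; last by rewrite ediam_orthogonal.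
  by exists i => //; exists x.
apply: lee_nneseries => [i _ _|i _]; first exact: hterm_ge0.
have [->|U0] := eqVneq (U i) set0; first by rewrite image_set0.
rewrite /hterm (negbTE U0); case: eqP => _; last by rewrite ediam_orthogonal.
by rewrite expe_ge0// ediam_ge0//; apply/set0P.
Qed.

Lemma hausdorff_measure_orthogonal (M : 'M[R]_d.+1) A : (M *m M^T = 1%:M)%R ->
  hausdorff_measure k [set x *m M | x in A]%R = hausdorff_measure k A.
Proof.
move=> MM; apply/eqP; rewrite eq_le hausdorff_measure_orthogonal_le//=.
have {1}-> : A = [set x *m M^T | x in [set x *m M | x in A]]%R.
  apply/seteqP; split=> [x Ax|_ [_ [x Ax <-] <-]].
    by exists (x *m M)%R; [exists x|rewrite -mulmxA MM mulmx1].
  by rewrite -mulmxA MM mulmx1.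
by apply: hausdorff_measure_orthogonal_le; rewrite trmxK orthogonal_inv.
Qed.

(* Covers may be taken open, and then cover all bodies close to a given one:
   this makes the measure of a body a Borel function of the body. *)
Definition open_content delta A : \bar R :=
  ereal_inf [set \sum_(0 <= i <oo) hterm (U i) | U in
    [set U | hcover delta A U /\ forall i, open (U i)]].

Lemma pow_continuity (x e : R) : (0 <= x)%R -> (0 < e)%R ->
  exists2 eta : R, (0 < eta)%R & ((x + eta) ^+ k <= x ^+ k + e)%R.
Proof.
move=> x0 e0; have /cvgrPdist_lt/(_ _ e0) := @exprn_continuous R k x.
move=> /nbhs_ballP[r /= r0 rP]; exists (r / 2)%R; first by rewrite divr_gt0.
have := rP (x + r / 2)%R; rewrite /ball /= opprD addrA subrr add0r normrN.
rewrite gtr0_norm ?divr_gt0// ltr_pdivrMr// ltr_pMr// ltr1n => /(_ isT).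
rewrite distrC => /ltW/(le_trans (ler_norm _)).
by rewrite lerBlDl.
Qed.

Definition thicken U (eta : R) : set E := [set x | exists2 u, U u & (enorm (x - u) < eta)%R].

Lemma open_thicken U eta : open (thicken U eta).
Proof.
have -> : thicken U eta = \bigcup_(u in U) (fun x => enorm (x - u)) @^-1` [set r | (r < eta)%R].
  by apply/seteqP; split=> [x [u Uu xu]|x [u Uu xu]]; exists u.
apply: bigcup_open => u _; apply: open_comp; last exact: open_lt.
move=> x _; apply: continuous_comp; last exact: enorm_continuous.
exact: (cvgB cvg_id (cvg_cst u)).
Qed.

Lemma ediam_thicken U eta (D : R) : (0 < eta)%R -> ediam U <= D%:E ->
  ediam (thicken U eta) <= (D + (eta + eta))%:E.
Proof.
move=> e0 UD; apply: ge_ereal_sup => _ [[x y] [/= [u Uu xu] [v Uv yv]] <-].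
rewrite lee_fin; have uv : (enorm (u - v) <= D)%R.
  rewrite -lee_fin; apply: le_trans UD; apply: ereal_sup_ubound.
  by exists (u, v).
have := enorm_triangle u x y; have := enorm_triangle v u y.
move: xu yv; rewrite [enorm (y - v)%R]enormB; lra.
Qed.

(** Every piece of a cover is thickened to an open set, at a cost bounded by the terms of a
    geometric series of sum [e]. The mesh [delta / 2] leaves room for the thickening. *)
Lemma open_content_le delta A : (0 < delta)%R ->
  open_content delta A <= hausdorff_content k (delta / 2)%R A.
Proof.
move=> d0; have d20 : (0 < delta / 2)%R by rewrite divr_gt0.
rewrite hausdorff_contentE; apply: le_ereal_inf_tmp => _ [U [AU dU] <-].
apply/lee_addgt0Pr => e e0.
have /choice[V VP] : forall i, exists V, [/\ U i `<=` V, open V,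
    ediam V <= delta%:E & hterm V <= hterm (U i) + (e / (2 ^ i.+1)%:R)%:E].
  move=> i; have ei : (0 < e / (2 ^ i.+1)%:R)%R by rewrite divr_gt0// ltr0n expn_gt0.
  have [U0|/set0P U0] := eqVneq (U i) set0.
    exists set0; split => //; [by rewrite U0|by rewrite ediam_set0 leNye|].
    by rewrite hterm_set0 adde_ge0 ?hterm_ge0// lee_fin ltW.
  have D0 := ediam_ge0 U0.
  have Df : ediam (U i) \is a fin_num.
    by rewrite ge0_fin_numE// (le_lt_trans (dU i)) ?ltry.
  have DE : ediam (U i) = (fine (ediam (U i)))%:E by rewrite fineK.
  set D := fine _ in DE; have D0' : (0 <= D)%R by rewrite fine_ge0.
  have [eta eta0 etaP] := pow_continuity D0' ei.
  (* Thickening by [eta'] adds at most [eta' + eta'] to the diameter, which explains the last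
     division by 2. *)
  pose eta' : R := (Num.min eta (delta / 2) / 2)%R.
  have eta'0 : (0 < eta')%R by rewrite divr_gt0// lt_min eta0 d20.
  have UV : U i `<=` thicken (U i) eta'.
    move=> x Ux; exists x => //; rewrite subrr.
    by rewrite (_ : enorm 0 = 0)%R// /enorm dotp0l sqrtr0.
  have dV : ediam (thicken (U i) eta') <= (D + (eta' + eta'))%:E.
    by apply: ediam_thicken => //; rewrite DE.
  exists (thicken (U i) eta'); split => //; first exact: open_thicken.
    apply: le_trans dV _; have := dU i; rewrite DE !lee_fin => Dd.
    by rewrite -splitr [leRHS](splitr delta) lerD// ge_min lexx orbT.
  have V0 : thicken (U i) eta' !=set0 by have [u Uu] := U0; exists u; exact: UV.
  have /set0P/negbTE Ui0 := U0; have /set0P/negbTE Vi0 := V0.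
  rewrite /hterm Ui0 Vi0.
  have V0' := ediam_ge0 V0.
  have Vf : ediam (thicken (U i) eta') \is a fin_num.
    by rewrite ge0_fin_numE// (le_lt_trans dV) ?ltry.
  rewrite -(fineK Vf) DE -!EFin_expe -EFinD lee_fin; apply: le_trans etaP.
  rewrite lerXn2r ?nnegrE ?fine_ge0 ?addr_ge0 ?(ltW eta0)//.
  rewrite -lee_fin fineK//; apply: le_trans dV _; rewrite lee_fin lerD2l -splitr.
  by rewrite ge_min lexx.
apply: (@le_trans _ _ (\sum_(0 <= i <oo) hterm (V i))).
  apply: ereal_inf_lbound; exists V => //; split; last by move=> i; have [] := VP i.
  split; last by move=> i; have [] := VP i.
  move=> x /AU[i _ Ux]; exists i => //; have [UV _ _ _] := VP i; exact: UV.
apply: (@le_trans _ _ (\sum_(0 <= i <oo) (hterm (U i) + (e / (2 ^ i.+1)%:R)%:E))).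
  apply: lee_nneseries => [i _ _|i _]; first exact: hterm_ge0.
  by have [] := VP i.
by apply: (@epsilon_trick R (fun i => hterm (U i)) e xpredT) => [i|]; [exact: hterm_ge0|exact: ltW].
Qed.

Lemma hausdorff_content_open_content delta A :
  hausdorff_content k delta A <= open_content delta A.
Proof.
rewrite hausdorff_contentE; apply: le_ereal_inf_tmp => _ [U [HU _] <-].
by apply: ereal_inf_lbound; exists U.
Qed.

Lemma hausdorff_measure_leP A (t : \bar R) : hausdorff_measure k A <= t <->
  forall i : nat, open_content i.+1%:R^-1 A <= t.
Proof.
split=> [At i|H].
  apply: le_trans (open_content_le _ (rad_gt0 _ i)) _.
  apply: le_trans At; apply: hausdorff_content_measure.
  by rewrite divr_gt0// rad_gt0.
apply: ge_ereal_sup => _ [delta /= d0 <-].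
have [i id] := rad_small d0; apply: le_trans (H i).
apply: le_trans (hausdorff_content_open_content _ _).
by apply: hausdorff_content_delta; exact: ltW.
Qed.

(** As [A] is closed, so is the set of its points outside an open cover, and missing a closed set is
    an open condition on bodies. Hence the strict sublevel sets of [open_content] are open, and
    [hausdorff_measure_leP] needs only countably many of them. *)
Lemma measurable_hausdorff_closed (A : set E) : closed A ->
  measurable_fun setT (fun K : borelK R d => hausdorff_measure k (A `&` sset K)).
Proof.
move=> cA; apply: (measurability _ (ErealGenOInfty.measurableE R)).
move=> _ [_ [t ->] <-]; rewrite setTI.
rewrite -[X in measurable X]setCK; apply: measurableC.
have -> : ~` ((fun K : borelK R d => hausdorff_measure k (A `&` sset K)) @^-1` `]t%:E, +oo[) =
    \bigcap_(p : nat * nat) [set K : borelK R d |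
      open_content p.1.+1%:R^-1 (A `&` sset K) < (t + p.2.+1%:R^-1)%:E].
  apply/seteqP; split => K.
    move=> /= /negP; rewrite in_itv/= andbT -leNgt.
    move=> /hausdorff_measure_leP H [i j] _ /=; apply: le_lt_trans (H i) _.
    by rewrite lte_fin ltrDl rad_gt0.
  move=> H /=; apply/negP; rewrite in_itv/= andbT -leNgt.
  apply/hausdorff_measure_leP => i; apply/lee_addgt0Pr => e e0.
  have [j je] := rad_small e0; apply: le_trans (ltW (H (i, j) I)) _.
  by rewrite /= lee_fin lerD2l ltW.
apply: bigcap_countType_measurable => -[i j] /=; apply: measurable_hausdorff_open.
move=> K /= /ereal_inf_lt[_ [U [[AU dU] oU] <-] Ut].
have cC : closed (A `&` ~` \bigcup_i U i).
  by apply: closedI => //; apply: open_closedC; apply: bigcup_open => n _.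
have [|r r0 rP] := misses_closed_open cC (K := K).
  apply/seteqP; split => // x [Kx [Ax]]; apply.
  by apply: AU; split.
exists r => // L /rP LC; apply: le_lt_trans Ut; apply: ereal_inf_lbound.
exists U => //; split => //; split => // x [Ax Lx].
apply: contrapT => Ux; suff : (sset L `&` (A `&` ~` \bigcup_i U i)) x.
  by rewrite LC.
by split.
Qed.

End hausdorff.

(** * Measurability of the geometric constructions *)

Section approximation.
Variables (R : realType) (d : nat).
Notation E := 'rV[R]_d.+1.
Notation KS := (sbody R d).
Implicit Types (x y z a : E) (K L : KS) (G C : set E).

Lemma closed_approx (F : set E) y : closed F ->
  (forall i : nat, exists q, `|rpoint R q - y| < i.+1%:R^-1 /\
    F `&` rball (q, i) !=set0) -> F y.
Proof.
move=> cF H; apply: contrapT => Fy.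
have /nbhs_ballP[e /= e0 eF] : nbhs y (~` F).
  by apply: open_nbhs_nbhs; split => //; exact: closed_openC.
have [i ie] := @rad_small R (e / 2) (divr_gt0 e0 (ltr0n _ 2)).
have [q [qy [z [Fz qz]]]] := H i; apply: (eF z _ Fz).
rewrite -ball_normE /= -(subrK (rpoint R q) y) -addrA.
rewrite (le_lt_trans (ler_normD _ _))// distrC (splitr e) ltrD//.
  exact: lt_trans qy ie.
exact: lt_trans qz ie.
Qed.

Lemma hits_le i j q K : (i <= j)%N -> hits (q, j) K -> hits (q, i) K.
Proof.
move=> ij [y [Ky qy]]; exists y; split => //; rewrite /rball /=.
by apply: lt_le_trans qy _; rewrite lef_pV2 ?posrE// ler_nat.
Qed.

(* [N i p q] says that [F p] comes close to the rational point [q], up to an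
   error that vanishes as [i] grows; compactness of [C] turns a sequence of such
   points into a point of [F p `&` C]. *)
Section hits_compact.
Context (disp : measure_display) (X : measurableType disp) (D : set X).
Variables (F : X -> set E) (N : nat -> X -> 'rV[rat]_d.+1 -> Prop) (C : set E).
Hypothesis compactC : compact C.
Hypothesis N_le : forall i j p q, D p -> (i <= j)%N -> N j p q -> N i p q.
Hypothesis F_N : forall i p y q, D p -> F p y -> `|rpoint R q - y| < i.+1%:R^-1 ->
  N i p q.
Hypothesis N_F : forall p y, D p -> C y ->
  (forall i, exists q, `|rpoint R q - y| < i.+1%:R^-1 /\ N i p q) -> F p y.
Hypothesis mN : forall i q, measurable (D `&` [set p | N i p q]).

Lemma measurable_hits_compact : measurable (D `&` [set p | F p `&` C !=set0]).
Proof.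
have -> : D `&` [set p | F p `&` C !=set0] =
    \bigcap_i \bigcup_q (if `[< exists2 y, C y & `|rpoint R q - y| < i.+1%:R^-1 >]
       then D `&` [set p | N i p q] else set0).
  apply/seteqP; split => [p [Dp [y [Fy Cy]]] i _|p H].
    have [q qy] := rpoint_dense y (rad_gt0 R i).
    exists q => //; case: asboolP => [_|[]]; last by exists y.
    by split => //; exact: F_N qy.
  have {}H i : exists qy : 'rV[rat]_d.+1 * E, [/\ D p, C qy.2,
      `|rpoint R qy.1 - qy.2| < i.+1%:R^-1 & N i p qy.1].
    have [q _] := H i I; case: asboolP => // -[y Cy qy] [Dp Np].
    by exists (q, y).
  have /choice[f fP] := H.
  have Dp : D p by have [] := fP 0%N.
  split => //=.
  have PF : ProperFilter ((fun i => (f i).2) @ \oo) by apply: fmap_proper_filter; exact: eventually_filter.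
  have [|y [Cy ycl]] := @compactC _ PF.
    by exists 0%N => // i _ /=; have [] := fP i.
  exists y; split => //; apply: N_F => // i.
  have e0 := rad_gt0 R i.
  have [M Me] := @rad_small R _ (divr_gt0 e0 (ltr0n _ 2)).
  have iM : (i <= M)%N.
    rewrite leqNgt; apply/negP => Mi.
    have : i.+1%:R^-1 <= M.+1%:R^-1 :> R by rewrite lef_pV2 ?posrE// ler_nat ltnW.
    by move: e0 Me; move: (i.+1%:R^-1) (M.+1%:R^-1) => u v; lra.
  have FM : ((fun i => (f i).2) @ \oo) [set z | exists2 j, (M <= j)%N & z = (f j).2].
    by exists M => // j /= Mj; exists j.
  have [z [[j Mj ->]]] := ycl _ _ FM (nbhsx_ballx y _ (rad_gt0 R M)).
  rewrite -ball_normE /= => yj.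
  have [_ _ qj Nj] := fP j; exists (f j).1; split; last first.
    by apply: N_le Nj => //; exact: leq_trans Mj.
  rewrite -(subrK (f j).2 (rpoint R _)) -addrA (le_lt_trans (ler_normD _ _))//.
  rewrite [in ltRHS](splitr i.+1%:R^-1) ltrD//; last by rewrite distrC (lt_trans yj).
  apply: lt_trans Me; apply: lt_le_trans qj _.
  by rewrite lef_pV2 ?posrE// ler_nat.
apply: bigcapT_measurable => i; apply: bigcup_countType_measurable => q.
by case: asboolP => _ //; exact: mN.
Qed.

End hits_compact.

(** The generating balls are open, whereas the compactness argument concerns compact sets; an open
    ball is the union of the concentric closed balls with radius smaller by [1 / (j + 1)]. *)
Lemma measurable_fun_compact_hits (disp : measure_display)
    (X : measurableType disp) (D : set X) (F : X -> set E) (g : X -> borelK R d)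
    (K0 : KS) :
  measurable D -> (forall p, D p -> sset (g p) = F p) ->
  (forall p, ~ D p -> g p = K0) ->
  (forall C, compact C -> measurable (D `&` [set p | F p `&` C !=set0])) ->
  measurable_fun setT g.
Proof.
move=> mD gF gK0 mF; apply: measurable_fun_borelK => b.
pose C j : set E := [set y | `|rpoint R b.1 - y| <= b.2.+1%:R^-1 - j.+1%:R^-1].
have cC j : compact (C j).
  apply: bounded_closed_compact.
    exists (`|rpoint R b.1| + b.2.+1%:R^-1); split => // M ltM y /= Cy.
    rewrite (le_trans _ (ltW ltM))// -[y](subKr (rpoint R b.1)).
    rewrite (le_trans (ler_normB _ _))// lerD2l (le_trans Cy)//.
    by rewrite gerBl ltW// rad_gt0.
  have -> : C j = (fun y => `|rpoint R b.1 - y|) @^-1` [set r | r <= b.2.+1%:R^-1 - j.+1%:R^-1].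
    by [].
  apply: preimage_closed; last exact: closed_le.
  move=> y _; apply: (@continuous_comp _ _ _ (fun y => rpoint R b.1 - y) Num.norm).
    apply: (@cvgB R E E (nbhs y) _ (cst (rpoint R b.1)) id); [exact: cvg_cst|exact: cvg_id].
  exact: norm_continuous.
have -> : g @^-1` hits b = (\bigcup_j (D `&` [set p | F p `&` C j !=set0])) `|`
    (~` D `&` (if `[< hits b K0 >] then setT else set0)).
  apply/seteqP; split => p.
    have [Dp|Dp] := pselect (D p); rewrite /hits /=; last first.
      by rewrite gK0// => H; right; split => //; case: asboolP.
    rewrite gF// => -[y [Fy]]; rewrite /rball /= => by_; left.
    have [j jb] := @rad_small R (b.2.+1%:R^-1 - `|rpoint R b.1 - y|) ltac:(by rewrite subr_gt0).
    by exists j => //; split => //; exists y; split => //; rewrite /C /= lerBrDl -lerBrDr ltW.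
  move=> [[j _ [Dp [y [Fy Cy]]]]|[Dp]]; rewrite /hits /=.
    rewrite gF//; exists y; split => //; rewrite /rball /=.
    by rewrite (le_lt_trans Cy)// ltrBlDr ltrDl rad_gt0.
  by rewrite gK0//; case: asboolP.
apply: measurableU.
  by apply: bigcupT_measurable => j; exact: mF.
apply: measurableI; first exact: measurableC.
by case: asboolP.
Qed.

End approximation.

(** * The side of a hypersphere as a measurable function *)

Section hyperplane_form.
Variables (R : realType) (d : nat).
Notation E := 'rV[R]_d.+1.
Notation KS := (sbody R d).
Implicit Types (x y z a : E) (K L : KS).

Definition lin_dist K x : R := inf [set enorm (x - z) | z in lin (sset K)].

(* If K is the great hypersphere with unit normal a, then [lin_dist K x] is
   |<a, x>|, so polarization gives [side K x y = <a, x> <a, y>]; the sign of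
   this number says whether K separates x and y, without choosing between the
   normals a and -a. *)
Definition side K x y : R :=
  (lin_dist K (x + y) ^+ 2 - lin_dist K (x - y) ^+ 2) / 4.

Lemma lin_dist_lt K x (t : R) :
  lin_dist K x < t <-> exists2 z, lin (sset K) z & enorm (x - z) < t.
Proof.
have ne : [set enorm (x - z) | z in lin (sset K)] !=set0.
  by exists (enorm (x - 0)); exists 0 => //; exact: lin0.
split=> [/inf_lt-/(_ ne)[_ [z Kz <-] zt]|[z Kz zt]]; first by exists z.
apply: le_lt_trans zt; apply: ge_inf; last by exists z.
by exists 0 => _ [y _ <-]; exact: enorm_ge0.
Qed.

Lemma lin_dist_hypersphere K a x : usphere a -> sset K = perp a `&` usphere ->
  lin_dist K x = `|dotp a x|.
Proof.
move=> sa Ka; have /usphereE aa := sa.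
have LK : lin (sset K) = perp a.
  by rewrite Ka; have [V -> _] := perp_vspace a; rewrite lin_sphere.
apply/eqP; rewrite eq_le; apply/andP; split.
  apply/ler_addgt0Pl => e e0; apply/ltW/lin_dist_lt.
  exists (x - dotp a x *: a).
    by rewrite LK /perp /= dotpBr dotpZr aa mulr1 subrr.
  by rewrite subKr enormZ sa mulr1 ltrDr.
rewrite leNgt; apply/negP => /lin_dist_lt[z]; rewrite LK /perp /= => az.
have -> : dotp a x = dotp a (x - z) by rewrite dotpBr az subr0.
by rewrite ltNge (le_trans (cauchy_schwarz _ _))// sa mul1r.
Qed.

Lemma sideE K a x y : usphere a -> sset K = perp a `&` usphere ->
  side K x y = dotp a x * dotp a y.
Proof.
move=> sa Ka; rewrite /side !(lin_dist_hypersphere _ sa Ka) !real_normK ?num_real//.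
by rewrite dotpDr dotpBr; field.
Qed.

Lemma rpoint_dense_enorm x (e : R) : 0 < e -> exists q, enorm (rpoint R q - x) < e.
Proof.
move=> e0; have [|q qx] := @rpoint_dense R d x (e / d.+1%:R).
  by rewrite divr_gt0.
exists q; rewrite (le_lt_trans (enorm_le_norm _))//.
by rewrite mulrC -ltr_pdivlMr.
Qed.

Lemma open_enorm_ball x (r : R) : open [set y | enorm (x - y) < r].
Proof.
have -> : [set y | enorm (x - y) < r] = (fun y => enorm (x - y)) @^-1` [set s | s < r].
  by [].
apply: open_comp; last exact: open_lt.
move=> y _; apply: (@continuous_comp _ _ _ (fun y => x - y) (@enorm R d)).
  by apply: (@cvgB R E E (nbhs y) _ (cst x) id); [exact: cvg_cst|exact: cvg_id].
exact: enorm_continuous.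
Qed.

(** A rational point near [x] separates the variables: each strict sublevel set is a countable union
    of products of an open condition on [K] and an open condition on [x]. *)
Lemma measurable_lin_dist :
  measurable_fun setT (fun p : borelK R d * borelE R d => lin_dist p.1 p.2).
Proof.
apply: (measurability _ (RGenInftyO.measurableE R)) => _ [_ [t ->] <-].
rewrite setTI.
have -> : (fun p : borelK R d * borelE R d => lin_dist p.1 p.2) @^-1` `]-oo, t[ =
  \bigcup_(b : 'rV[rat]_d.+1 * nat)
    ([set K : borelK R d | lin (sset K) `&`
        [set z | enorm (rpoint R b.1 - z) < t - b.2.+1%:R^-1] !=set0] `*`
     ([set x | enorm (rpoint R b.1 - x) < b.2.+1%:R^-1] : set (borelE R d))).
  apply/seteqP; split => [[K x]|[K x] [[q i] _ [/= [z [Kz zt]] qx]]];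
    rewrite /= in_itv/=.
    move=> /lin_dist_lt[z Kz zt].
    have [j jt] := @rad_small R ((t - enorm (x - z)) / 2) ltac:(by rewrite divr_gt0// subr_gt0).
    have [q qx] := rpoint_dense_enorm x (rad_gt0 R j).
    exists (q, j) => //; split => //=; exists z; split => //=.
    have := enorm_triangle x (rpoint R q) z; move: jt qx.
    by move: (j.+1%:R^-1) => u; lra.
  apply/lin_dist_lt; exists z => //.
  rewrite (le_lt_trans (enorm_triangle (rpoint R q) x z))// enormB.
  by rewrite -(subrK i.+1%:R^-1 t) [ltRHS]addrC ltrD.
apply: bigcup_countType_measurable => b; apply: measurableX.
  apply: measurable_hausdorff_open; apply: lin_hits_hausdorff_open.
  exact: open_enorm_ball.
by apply: measurable_openE; exact: open_enorm_ball.
Qed.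

Lemma measurable_side y :
  measurable_fun setT (fun p : borelK R d * borelE R d => side p.1 p.2 y).
Proof.
pose shift (z x : E) : E := x + z.
have ms z : measurable_fun setT (shift z : borelE R d -> borelE R d).
  by apply: measurable_continuousE => x; exact: (cvgD cvg_id (cvg_cst z)).
have mt z : measurable_fun setT (fun p : borelK R d * borelE R d =>
    (p.1, shift z p.2 : borelE R d)).
  apply: measurable_fun_pair; first exact: measurable_fst.
  exact: (measurableT_comp (ms z) measurable_snd).
apply: measurable_funM => //; apply: measurable_funB; apply: measurable_funX.
  exact: (measurableT_comp measurable_lin_dist (mt y)).
exact: (measurableT_comp measurable_lin_dist (mt (- y))).
Qed.

End hyperplane_form.

(** * Cells and intersections of families of hyperspheres *)

Section families.
Variables (R : realType) (d : nat).
Notation E := 'rV[R]_d.+1.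
Notation KS := (sbody R d).
Implicit Types (x y z a : E) (L : KS).

Definition rect n (B : 'I_n -> set KS) : set ('I_n -> KS) :=
  [set K | forall i, B i (K i)].

Definition rects n : set (set ('I_n -> KS)) :=
  [set rect B | B in [set B | forall i, measurable (B i : set (borelK R d))]].

Definition mkbody (X : set E) : KS :=
  if pselect (spherical_convex X) is left H then SBody H else point.

Lemma mkbodyK (X : set E) : spherical_convex X -> sset (mkbody X) = X.
Proof. by rewrite /mkbody; case: pselect. Qed.

Lemma mkbody_out (X : set E) : ~ spherical_convex X -> mkbody X = point.
Proof. by rewrite /mkbody; case: pselect. Qed.

Lemma mkbody_sset L : mkbody (sset L) = L.
Proof. by apply: sset_inj; rewrite mkbodyK//; exact: sbodyP. Qed.

Lemma closed_convex_coneI (J : Type) (C : J -> set E) :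
  (forall i, closed_convex_cone (C i)) -> closed_convex_cone (\bigcap_i C i).
Proof.
move=> CC; split.
- by apply: closed_bigI => i _; have [] := CC i.
- exists 0 => i _; have [_ [x Cx] H] := CC i.
  by have := H 0 0 x x (lexx 0) (lexx 0) Cx Cx; rewrite !scale0r addr0.
- move=> a b x y a0 b0 Cx Cy i _; have [_ _ H] := CC i.
  by apply: H => //; [exact: Cx|exact: Cy].
Qed.

Lemma spherical_convexI (J : Type) (F : J -> set E) : inhabited J ->
  (forall i, spherical_convex (F i)) -> \bigcap_i F i !=set0 ->
  spherical_convex (\bigcap_i F i).
Proof.
move=> [i0] /choice[C CP] [x Fx].
exists (\bigcap_i C i); split.
- by apply: closed_convex_coneI => i; have [] := CP i.
- move=> C0; have [_ _ F0] := CP i0.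
  have : usphere x by have := Fx i0 I; rewrite F0 => -[].
  suff -> : x = 0 by exact: usphere0.
  suff : (\bigcap_i C i) x by rewrite C0.
  by move=> i _; have [_ _ Fi] := CP i; have := Fx i I; rewrite Fi => -[].
- apply/seteqP; split=> [y Fy|y [Cy sy] i _].
    split=> [i _|]; first by have [_ _ Fi] := CP i; have := Fy i I; rewrite Fi => -[].
    by have [_ _ Fi] := CP i0; have := Fy i0 I; rewrite Fi => -[].
  by have [_ _ ->] := CP i; split => //; exact: Cy.
Qed.

Lemma halfspace_cone a : closed_convex_cone [set y | 0 <= dotp a y].
Proof.
split.
- have -> : [set y | 0 <= dotp a y] = dotp a @^-1` [set r | 0 <= r] by [].
  apply: preimage_closed; last exact: closed_ge.
  by move=> y _; exact: dotp_continuous.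
- by exists 0; rewrite /= dotp0r.
- by move=> s t x y s0 t0 /= ax ay; rewrite dotpDr !dotpZr addr_ge0// mulr_ge0.
Qed.

Lemma closed_convex_coneI2 (C D : set E) : closed_convex_cone C ->
  closed_convex_cone D -> closed_convex_cone (C `&` D).
Proof.
move=> CC CD.
have -> : C `&` D = \bigcap_(b : bool) (if b then C else D).
  apply/seteqP; split => [y [Cy Dy] [] //|y H].
  by split; [exact: (H true I)|exact: (H false I)].
by apply: closed_convex_coneI => -[].
Qed.

Definition hyperspheres n (K : 'I_n -> KS) :=
  forall i, great_subsphere d.-1 (sset (K i)).

(* The cell containing [x] in the section by [L] of the tessellation of the
   hyperspheres [K]; [cell] is a junk value unless [x] lies in [L]. *)
Definition cellset n (K : 'I_n -> KS) L x : set E :=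
  sset L `&` [set y | forall j, 0 <= side (K j) x y].

Definition cell n (K : 'I_n -> KS) L x : KS :=
  if `[< hyperspheres K /\ sset L x >] then mkbody (cellset K L x) else point.

Hypothesis d0 : (0 < d)%N.

Lemma hyperspheres_normals n (K : 'I_n -> KS) : hyperspheres K ->
  exists a : 'I_n -> E, forall i, usphere (a i) /\ sset (K i) = perp (a i) `&` usphere.
Proof.
move=> HK; have /choice[a aP] : forall i, exists a, usphere a /\
    sset (K i) = perp a `&` usphere.
  by move=> i; have [a sa Ka] := hypersphere_normal d0 (HK i); exists a.
by exists a.
Qed.

Lemma cellset_convex n (K : 'I_n -> KS) L x : hyperspheres K -> sset L x ->
  spherical_convex (cellset K L x).
Proof.
move=> /hyperspheres_normals[a aP] Lx.
(* With normals, the cell is cut out of [L] by half-spaces with inner normals [dotp (a j) x *: a j];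
   a hypersphere through [x] gives the normal 0 and no condition. *)
have cellE : cellset K L x = sset L `&` \bigcap_j [set y | 0 <= dotp (dotp (a j) x *: a j) y].
  congr (_ `&` _); apply/seteqP; split => y /=.
    by move=> H j _ /=; have [sa Ka] := aP j; rewrite dotpZl -(sideE _ _ sa Ka).
  by move=> H j; have := H j I; have [sa Ka] := aP j; rewrite /= dotpZl -(sideE _ _ sa Ka).
have [C [CC C0 LC]] := sbodyP L.
rewrite cellE; exists (C `&` \bigcap_j [set y | 0 <= dotp (dotp (a j) x *: a j) y]).
split; last by rewrite LC setIAC.
  apply: closed_convex_coneI2 => //; apply: closed_convex_coneI => j.
  exact: halfspace_cone.
move=> H; have : usphere x by exact: sset_sphere Lx.
suff -> : x = 0 by exact: usphere0.
suff : (C `&` \bigcap_j [set y | 0 <= dotp (dotp (a j) x *: a j) y]) x by rewrite H.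
split; first by move: Lx; rewrite LC => -[].
by move=> j _ /=; rewrite dotpZl -expr2 sqr_ge0.
Qed.

Lemma sset_cell n (K : 'I_n -> KS) L x : hyperspheres K -> sset L x ->
  sset (cell K L x) = cellset K L x.
Proof.
move=> HK Lx; rewrite /cell; case: asboolP => [_|[]//].
by rewrite mkbodyK//; exact: cellset_convex.
Qed.

(** The factor [usphere] makes the intersection over the empty set of indices the whole sphere. *)
Definition meetset n (J : {set 'I_n}) (K : 'I_n -> KS) : set E :=
  usphere `&` [set y | forall i, i \in J -> sset (K i) y].

Definition meet n (J : {set 'I_n}) (K : 'I_n -> KS) : KS := mkbody (meetset J K).

Lemma meetset_convex n (J : {set 'I_n}) (K : 'I_n -> KS) :
  spherical_convex (meetset J K) <-> meetset J K !=set0.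
Proof.
split=> [[C [CC C0 ->]]|H]; first exact: cone_neq0_usphere.
pose F (o : option 'I_n) : set E :=
  if o is Some i then (if i \in J then sset (K i) else usphere) else usphere.
have MF : meetset J K = \bigcap_o F o.
  apply/seteqP; split=> [y [sy Ky] [i|] _ //=|y Fy].
    by case: ifPn => // /Ky.
  split; first exact: (Fy None I).
  by move=> i iJ; have := Fy (Some i) I; rewrite /= iJ.
have sphere_convex := sbodyP (point : KS).
rewrite MF; apply: spherical_convexI; [exact: (inhabits None)| |by rewrite -MF].
move=> [i|] //=; case: ifP => // _; exact: sbodyP.
Qed.

Lemma sset_meet n (J : {set 'I_n}) (K : 'I_n -> KS) :
  meetset J K !=set0 -> sset (meet J K) = meetset J K.
Proof. by move=> /meetset_convex; exact: mkbodyK. Qed.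

End families.

Notation hfam R d n := (g_sigma_algebraType (@rects R d n)).

Section measurable_families.
Variables (R : realType) (d : nat).
Notation E := 'rV[R]_d.+1.
Notation KS := (sbody R d).
Implicit Types (x y z a : E) (L : KS).

Lemma measurable_rect n (B : 'I_n -> set KS) :
  (forall i, measurable (B i : set (borelK R d))) ->
  measurable (rect B : set (hfam R d n)).
Proof. by move=> mB; apply: sub_sigma_algebra; exists B. Qed.

Lemma rects_setI n : setI_closed (@rects R d n).
Proof.
move=> _ _ [A mA <-] [B mB <-]; exists (fun i => A i `&` B i).
  by move=> i; exact: measurableI.
apply/seteqP; split => K /=; first by move=> H; split => i; have [] := H i.
by move=> [HA HB] i; split; [exact: HA|exact: HB].
Qed.

Lemma measurable_proj n (i : 'I_n) :
  measurable_fun setT (fun K : hfam R d n => K i : borelK R d).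
Proof.
move=> _ B mB; rewrite setTI.
have -> : (fun K : hfam R d n => K i : borelK R d) @^-1` B =
    rect (fun j => if j == i then B else setT).
  apply/seteqP; split => K /=; first by move=> KB j; case: eqP => [->|].
  by move=> /(_ i); rewrite eqxx.
by apply: measurable_rect => j; case: ifP.
Qed.

Lemma measurable_fun_hfam (disp : measure_display) (X : measurableType disp) n
    (f : X -> hfam R d n) :
  (forall i, measurable_fun setT (fun p => f p i : borelK R d)) ->
  measurable_fun setT f.
Proof.
move=> mf; apply: (@measurability _ _ X (hfam R d n) setT f (@rects R d n)) => //.
move=> _ [_ [B mB <-] <-]; rewrite setTI.
have -> : f @^-1` rect B = \bigcap_i ((fun p => f p i) @^-1` B i).
  by apply/seteqP; split => p /=; [move=> H i _; exact: H|move=> H i; exact: (H i I)].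
apply: bigcap_countType_measurable => i.
by rewrite -[X in measurable X]setTI; apply: mf => //; exact: mB.
Qed.

Lemma measurable_comp_fam n m (f : 'I_m -> 'I_n) :
  measurable_fun setT ((fun K => K \o f) : hfam R d n -> hfam R d m).
Proof. by apply: measurable_fun_hfam => i; exact: measurable_proj. Qed.

Lemma measurable_hyperspheres n :
  measurable [set K : hfam R d n | hyperspheres K].
Proof.
apply: (@measurable_rect _ (fun=> [set L | great_subsphere d.-1 (sset L)])) => i.
exact: measurable_great_subsphere.
Qed.

Lemma measurable_meet n (J : {set 'I_n}) :
  measurable_fun setT (meet J : hfam R d n -> borelK R d).
Proof.
(* All hyperspheres of [J] are hit inside the same ball, so a limit of such balls lies in each of
   them; the first conjunct puts the limit on the sphere, also for empty [J]. *)
pose N i (K : hfam R d n) q := (exists y, usphere y /\ rball (q, i) y) /\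
  forall j, j \in J -> hits (q, i) (K j).
have key (C : set E) : compact C ->
    measurable [set K : hfam R d n | meetset J K `&` C !=set0].
  move=> cC; rewrite -[X in measurable X]setTI.
  apply: (@measurable_hits_compact R d _ (hfam R d n) setT (meetset J) N C) => //.
  - move=> i j K q _ ij [[y [sy qy]] H]; split; last by move=> l /H; exact: hits_le.
    exists y; split => //; move: qy; rewrite /rball /= => /lt_le_trans; apply.
    by rewrite lef_pV2 ?posrE// ler_nat.
  - move=> i K y q _ [sy Ky] qy; split; first by exists y.
    by move=> j /Ky Kjy; exists y.
  - move=> K y _ _ H; split.
      apply: closed_approx; first exact: closed_usphere.
      by move=> i; have [q [qy [[z [sz qz]] _]]] := H i; exists q; split => //; exists z.
    move=> j jJ; apply: closed_approx; first exact: closed_sset.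
    by move=> i; have [q [qy [_ /(_ _ jJ)]]] := H i; exists q.
  - move=> i q; rewrite setTI.
    have [H|H] := pselect (exists y : E, usphere y /\ rball (q, i) y); last first.
      rewrite (_ : mkset _ = set0) ?measurable0//.
      by apply/seteqP; split => // K [].
    have -> : [set K | N i K q] = rect (fun j => if j \in J then hits (q, i) else setT).
      apply/seteqP; split => K /=; first by move=> [_ KH] j; case: ifPn => // /KH.
      by move=> KH; split => // j jJ; have := KH j; rewrite jJ.
    by apply: measurable_rect => j; case: ifP => // _; exact: measurable_hits.
pose D := [set K : hfam R d n | meetset J K !=set0].
have mD : measurable D.
  have -> : D = [set K : hfam R d n | meetset J K `&` usphere !=set0].
    by apply/seteqP; split => K /= [y H]; exists y; [split => //; case: H|case: H].
  by apply: key; exact: compact_usphere.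
apply: (@measurable_fun_compact_hits R d _ (hfam R d n) D (meetset J) _ point) => //.
- by move=> K; exact: sset_meet.
- by move=> K KD; rewrite /meet mkbody_out// => /meetset_convex.
- by move=> C cC; apply: measurableI => //; exact: key.
Qed.

Lemma measurable_cell n : (0 < d)%N -> measurable_fun setT
  (fun p : (hfam R d n * borelK R d) * borelE R d => cell p.1.1 p.1.2 p.2 : borelK R d).
Proof.
move=> d0; set X := ((hfam R d n * borelK R d) * borelE R d)%type.
pose D := [set p : X | hyperspheres p.1.1 /\ sset p.1.2 p.2].
have m11 : measurable_fun setT (fun p : X => p.1.1 : hfam R d n).
  exact: (measurableT_comp measurable_fst measurable_fst).
have m12 : measurable_fun setT (fun p : X => p.1.2 : borelK R d).
  exact: (measurableT_comp measurable_snd measurable_fst).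
have m2 : measurable_fun setT (fun p : X => p.2 : borelE R d).
  exact: measurable_snd.
have mD : measurable D.
  apply: measurableI.
    by rewrite -[X in measurable X]setTI; apply: m11 => //; exact: measurable_hyperspheres.
  rewrite -[X in measurable X]setTI.
  have := measurable_fun_pair m12 m2.
  by move=> /(_ measurableT _ (@measurable_mem R d)).
(* The tolerance at level [i]: [side (p.1.1 j) p.2] is Lipschitz with constant [d + 1] for the sup
   norm, since [dotp (a j) p.2] is at most 1 in absolute value and the Euclidean norm is at most
   [d + 1] times the sup norm. *)
pose b i : R := d.+1%:R * i.+1%:R^-1.
pose N i (p : X) q := hits (q, i) p.1.2 /\
  forall j, - b i < side (p.1.1 j) p.2 (rpoint R q).
pose F (p : X) : set E := cellset p.1.1 p.1.2 p.2.
have bnd (p : X) (j : 'I_n) y z i : D p -> `|z - y| < i.+1%:R^-1 ->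
    `|side (p.1.1 j) p.2 y - side (p.1.1 j) p.2 z| < b i.
  move=> [/(hyperspheres_normals d0)[a aP] px] zy; have [sa Ka] := aP j.
  rewrite !(sideE _ _ sa Ka) -mulrBr -dotpBr normrM.
  have ax : `|dotp (a j) p.2| <= 1.
    by rewrite (le_trans (cauchy_schwarz _ _))// sa (sset_sphere px) mulr1.
  rewrite (le_lt_trans (ler_wpM2r _ ax))// mul1r.
  rewrite (le_lt_trans (cauchy_schwarz _ _))// sa mul1r.
  rewrite (le_lt_trans (enorm_le_norm _))// /b ltr_pM2l// distrC.
  exact: zy.
have bE i : 0 < b i by rewrite mulr_gt0// rad_gt0.
have small (e : R) : 0 < e -> exists i, b i < e.
  move=> e0; have [i ie] := @rad_small R (e / d.+1%:R) ltac:(by rewrite divr_gt0).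
  by exists i; rewrite /b mulrC -ltr_pdivlMr.
have ble i j : (i <= j)%N -> b j <= b i.
  by move=> ij; rewrite /b ler_wpM2l// lef_pV2 ?posrE// ler_nat.
apply: (@measurable_fun_compact_hits R d _ X D F _ point) => //.
- by move=> p [HK Lx]; exact: sset_cell.
- by move=> p Dp; rewrite /cell; case: asboolP.
move=> C cC; apply: (@measurable_hits_compact R d _ X D F N C) => //.
- move=> i j p q _ ij [H1 H2]; split; first exact: hits_le H1.
  by move=> l; rewrite (le_lt_trans _ (H2 l))// lerN2 ble.
- move=> i p y q Dp [Ly cy] qy; split; first by exists y.
  move=> j; have := bnd p j y (rpoint R q) i Dp qy.
  rewrite ltr_norml => /andP[_]; have := cy j => /=; lra.
- move=> p y Dp _ H; split.
    apply: closed_approx; first exact: closed_sset.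
    by move=> i; have [q [qy [[z [sz qz]] _]]] := H i; exists q; split => //; exists z.
  move=> j; rewrite leNgt; apply/negP => neg.
  have [i ie] := small (- side (p.1.1 j) p.2 y / 2) ltac:(by rewrite divr_gt0// oppr_gt0).
  have [q [qy [_ /(_ j) qs]]] := H i.
  have := bnd p j y (rpoint R q) i Dp qy; rewrite ltr_norml => /andP[+ _].
  move: neg ie qs; lra.
- move=> i q; apply: measurableI => //.
  have -> : [set p : X | N i p q] = [set p : X | hits (q, i) p.1.2] `&`
      \bigcap_j [set p : X | - b i < side (p.1.1 j) p.2 (rpoint R q)].
    by apply/seteqP; split => p [H1 H2]; split => // j; [move=> _; exact: H2|exact: (H2 j I)].
  apply: measurableI.
    by rewrite -[X in measurable X]setTI; apply: m12 => //; exact: measurable_hits.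
  apply: bigcap_countType_measurable => j.
  have mj : measurable_fun setT (fun p : X => (p.1.1 j : borelK R d, p.2 : borelE R d)).
    apply: measurable_fun_pair => //.
    exact: (measurableT_comp (measurable_proj j) m11).
  have := measurableT_comp (measurable_side (rpoint R q)) mj.
  move=> /(_ measurableT `]- b i, +oo[%classic (measurable_itv _)).
  rewrite setTI; congr (measurable _); apply/seteqP; split => p /=;
    by rewrite in_itv/= andbT.
Qed.

End measurable_families.

(** * Cells, sections and faces *)

Section geometry.
Variables (R : realType) (d : nat).
Notation E := 'rV[R]_d.+1.
Notation KS := (sbody R d).
Implicit Types (x y z w q : E) (L : KS).
Hypothesis d0 : (0 < d)%N.

Definition off n (K : 'I_n -> KS) : set E := [set q | forall j, ~ sset (K j) q].

Definition cells n (K : 'I_n -> KS) L : set (set E) :=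
  [set cellset K L q | q in sset L `&` off K].

(* The smallest face of the tessellation that contains [x]. *)
Definition facset n (K : 'I_n -> KS) x : set E := usphere `&`
  [set y | forall j, 0 <= side (K j) x y /\ (sset (K j) x -> sset (K j) y)].

(** Supplies the step for perturbing a point without crossing any hypersphere that it avoids. *)
Lemma small_delta n (p q : 'I_n -> R) : exists2 e : R, 0 < e &
  forall j, p j != 0 -> e * `|q j| < `|p j|.
Proof.
pose b := 1 + \sum_j `|q j| / `|p j|.
have b0 : 0 < b by rewrite ltr_pwDl// sumr_ge0// => i _; rewrite divr_ge0.
exists b^-1; first by rewrite invr_gt0.
move=> j pj; rewrite mulrC ltr_pdivrMr// mulrC -ltr_pdivrMr ?normr_gt0//.
by rewrite /b (bigD1 j)//= addrCA ltrDl ltr_pwDl// sumr_ge0// => i _; rewrite divr_ge0.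
Qed.

Lemma pos_mul_sign (p q r : R) : 0 < p * q -> (0 <= p * r) = (0 <= q * r).
Proof.
move=> pq; have [p0|p0|p0] := ltgtP 0 p; last by move: pq; rewrite -p0 mul0r ltxx.
  by rewrite !pmulr_rge0// -(pmulr_rgt0 _ p0).
by rewrite !nmulr_rge0// -(nmulr_rgt0 _ p0).
Qed.

Lemma perturb_sign (p q e : R) : 0 < e -> e * `|q| < `|p| -> 0 < p * (p - e * q).
Proof.
move=> e0 H; have : `|e * q| < `|p| by rewrite normrM gtr0_norm.
have [p0|p0|p0] := ltgtP 0 p.
- by rewrite (gtr0_norm p0) ltr_norml => /andP[? ?]; rewrite mulr_gt0//; lra.
- by rewrite (ltr0_norm p0) ltr_norml => /andP[? ?]; rewrite nmulr_rgt0//; lra.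
- by move=> _; move: H; rewrite -p0 normr0 ltNge mulr_ge0// ltW.
Qed.

Lemma normalize_id x : usphere x -> (enorm x)^-1 *: x = x.
Proof. by move=> sx; rewrite (_ : enorm x = 1)// invr1 scale1r. Qed.

Lemma normalize_continuous x : enorm x != 0 ->
  {for x, continuous (fun y : E => (enorm y)^-1 *: y)}.
Proof.
by move=> x0; exact: (cvgZ (cvgV x0 (@enorm_continuous R d x)) cvg_id).
Qed.

(** The normalization of [x - e *: y] is continuous in [e] at 0, with value [x]. Relative
    interiority is used in this form because moving away from [y] from a point of a hypersphere
    leads to the side opposite to [y]. *)
Lemma rel_interior_move (V : {vspace E}) (P : set E) x y : usphere x ->
  x \in V -> y \in V -> within ([set` V] `&` usphere) (nbhs x) P ->
  exists2 e : R, 0 < e & x - e *: y != 0 /\ P ((enorm (x - e *: y))^-1 *: (x - e *: y)).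
Proof.
move=> sx xV yV VP; have ex : enorm x = 1 := sx.
pose f (e : R) : E := x - e *: y.
have cf : {for 0, continuous f}.
  apply: (@cvgB R E R (nbhs 0) _ (cst x) (fun e => e *: y)); first exact: cvg_cst.
  exact: (cvgZ cvg_id (cvg_cst y)).
have f0 : f 0 = x by rewrite /f scale0r subr0.
pose g (e : R) : E := (enorm (f e))^-1 *: f e.
have cg : {for 0, continuous g}.
  have nz : enorm (f 0) != 0 by rewrite f0 ex oner_eq0.
  exact: (cvg_comp _ _ cf (normalize_continuous nz)).
have cn : {for 0, continuous (fun e => enorm (f e))}.
  exact: (cvg_comp _ _ cf (@enorm_continuous R d (f 0))).
have g0 : g 0 = x by rewrite /g f0 normalize_id.
have VPx : nbhs (g 0) [set z | ([set` V] `&` usphere) z -> P z] by rewrite g0.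
have en0 : nbhs (enorm (f 0)) [set r : R | r != 0].
  apply: open_nbhs_nbhs; split; first exact: open_neq.
  by rewrite /= f0 ex oner_eq0.
have /nbhs_ballP[e1 /= e10 H1] := cg _ VPx.
have /nbhs_ballP[e2 /= e20 H2] := cn _ en0.
pose e := Num.min e1 e2.
have e0 : 0 < e by rewrite lt_min e10 e20.
have le1 : `|0 - e / 2| < e1.
  rewrite sub0r normrN gtr0_norm ?divr_gt0//; have : e <= e1 by rewrite ge_min lexx.
  by lra.
have le2 : `|0 - e / 2| < e2.
  rewrite sub0r normrN gtr0_norm ?divr_gt0//; have : e <= e2 by rewrite ge_min lexx orbT.
  by lra.
have H3 := H1 _ le1; have H4 := H2 _ le2.
have fn0 : f (e / 2) != 0.
  apply: contraNN H4 => /eqP ->.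
  by rewrite /enorm dotp0l sqrtr0.
exists (e / 2); first by rewrite divr_gt0.
split => //; apply: H3; split; last exact: normalize_usphere.
by rewrite /= rpredZ// rpredB// rpredZ.
Qed.

Section with_normals.
Variables (n : nat) (K : 'I_n -> KS) (a : 'I_n -> E).
Hypothesis aK : forall i, usphere (a i) /\ sset (K i) = perp (a i) `&` usphere.

Lemma sideaE i x y : side (K i) x y = dotp (a i) x * dotp (a i) y.
Proof. by have [sa Ka] := aK i; exact: sideE. Qed.

Lemma hyperE i x : usphere x -> sset (K i) x <-> dotp (a i) x = 0.
Proof.
move=> sx; have [_ ->] := aK i; rewrite /perp.
by split=> [[]//|ax]; split.
Qed.

Lemma offE x : usphere x -> off K x <-> forall j, dotp (a j) x != 0.
Proof.
move=> sx; split=> H j; first by apply/eqP => /(hyperE j sx); exact: H.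
by move=> /(hyperE j sx)/eqP; apply/negP/H.
Qed.

Lemma cellsetE L x y : cellset K L x y <->
  sset L y /\ forall j, 0 <= dotp (a j) x * dotp (a j) y.
Proof.
by split=> -[Ly H]; split => // j; have := H j; rewrite /= sideaE.
Qed.

Lemma normalize_sign j x w : w != 0 ->
  (0 <= dotp (a j) x * dotp (a j) ((enorm w)^-1 *: w)) =
  (0 <= dotp (a j) x * dotp (a j) w).
Proof.
by move=> w0; rewrite dotpZr mulrCA pmulr_rge0// invr_gt0 enorm_gt0.
Qed.

Lemma cellset_swap L q x : off K q -> off K x -> usphere q -> usphere x ->
  cellset K L q x -> cellset K L q = cellset K L x.
Proof.
move=> + + sq sx; move=> /(offE sq) q0 /(offE sx) x0 /cellsetE[_ qx].
have H j : 0 < dotp (a j) q * dotp (a j) x.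
  by rewrite lt_neqAle qx andbT eq_sym mulf_neq0.
apply/seteqP; split => y /cellsetE[Ly Hy]; apply/cellsetE; split => // j.
  by rewrite -(pos_mul_sign _ (H j)).
by rewrite (pos_mul_sign _ (H j)).
Qed.

Lemma closed_cellset L x : closed (cellset K L x).
Proof.
have -> : cellset K L x = sset L `&` \bigcap_j [set y | 0 <= dotp (dotp (a j) x *: a j) y].
  apply/seteqP; split => y.
    by move=> /cellsetE[Ly H]; split => // j _ /=; rewrite dotpZl.
  by move=> [Ly H]; apply/cellsetE; split => // j; have := H j I; rewrite /= dotpZl.
apply: closedI; first exact: closed_sset.
by apply: closed_bigI => j _; have [] := halfspace_cone (dotp (a j) x *: a j).
Qed.

Let X : set E := usphere `\` \bigcup_i sset (K i).

Let XE x : X x <-> usphere x /\ off K x.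
Proof.
split=> -[sx Kx]; split => //; first by move=> j Kj; apply: Kx; exists j.
by move=> [j _ Kj]; exact: (Kx j).
Qed.

(** [dotp (a j)] has no zero on the component, so by connectedness it keeps its sign there. *)
Lemma component_subset_cell x : X x ->
  connected_component X x `<=` cellset K (point : KS) x.
Proof.
move=> Xx y Cy; have Xy := connected_component_sub Cy.
have [sx xoff] := (XE x).1 Xx; have [sy yoff] := (XE y).1 Xy.
have x0 := (offE sx).1 xoff; have y0 := (offE sy).1 yoff.
apply/cellsetE; split=> // j; rewrite leNgt; apply/negP => neg.
pose f z := dotp (a j) x * dotp (a j) z.
have : is_interval (f @` connected_component X x).
  apply/connected_intervalP/connected_continuous_connected.
    exact: component_connected.
  apply: continuous_subspaceT => z.
  by apply: (@continuousM R E (cst (dotp (a j) x)) (dotp (a j)) z);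
    [exact: cst_continuous|exact: dotp_continuous].
move=> /(_ (f y) (f x)) H.
have Iy : (f @` connected_component X x) (f y) by exists y.
have Ix : (f @` connected_component X x) (f x).
  by exists x => //; exact: connected_component_refl.
have f0 : f y <= 0 <= f x by rewrite /f ltW//= -expr2 sqr_ge0.
have [z Cz fz] := H Iy Ix 0 f0.
have [sz zoff] := (XE z).1 (connected_component_sub Cz).
move/eqP: fz; rewrite /f mulf_eq0 (negbTE (x0 j)) /=.
by apply/negP/((offE sz).1 zoff).
Qed.

(** The segment from [x] to [y], projected to the sphere, stays off the hyperspheres except possibly
    at [y]. It misses the origin because [y] is not the antipode of [x]. *)
Lemma cell_in_closure x y : X x -> y <> - x -> cellset K (point : KS) x y ->
  closure (connected_component X x) y.
Proof.
move=> Xx yx /cellsetE[sy xy]; have [sx xoff] := (XE x).1 Xx.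
have x0 := (offE sx).1 xoff.
pose w (t : R) : E := (1 - t) *: x + t *: y.
have w0 t : 0 <= t <= 1 -> w t != 0.
  move=> /andP[t0 t1]; apply/eqP => /eqP; rewrite addr_eq0 => /eqP H.
  have H1 : 1 - t = t.
    have := congr1 (@enorm R d) H; rewrite enormN !enormZ.
    by rewrite (_ : enorm x = 1)// (_ : enorm y = 1)// !mulr1 !ger0_norm// subr_ge0.
  have tn0 : t != 0 by apply/eqP => te; move: H1; rewrite te; lra.
  move: H; rewrite H1 -scalerN => /(scalerI tn0) xE; apply: yx.
  by rewrite xE opprK.
have cw : continuous w.
  move=> t; apply: cvgD.
    apply: (@cvgZ _ _ _ (nbhs t) _ (fun t => 1 - t) (cst x)); last exact: cvg_cst.
    by apply: (@cvgB R R R (nbhs t) _ (cst 1) id); [exact: cvg_cst|exact: cvg_id].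
  by apply: (@cvgZ _ _ _ (nbhs t) _ id (cst y)); [exact: cvg_id|exact: cvg_cst].
pose f (t : R) : E := (enorm (w t))^-1 *: w t.
have cf t : 0 <= t <= 1 -> {for t, continuous f}.
  move=> t01; have nz : enorm (w t) != 0 by rewrite gt_eqF// enorm_gt0// w0.
  exact: (cvg_comp _ _ (cw t) (normalize_continuous nz)).
have f1 : f 1 = y by rewrite /f /w subrr scale0r add0r scale1r normalize_id.
have f0 : f 0 = x by rewrite /f /w subr0 scale0r addr0 scale1r normalize_id.
have Xf t : 0 <= t < 1 -> X (f t).
  move=> /andP[t0 t1]; have wt : w t != 0 by apply: w0; rewrite t0 ltW.
  apply/XE; split; first exact: normalize_usphere.
  apply/offE; first exact: normalize_usphere.
  move=> j; rewrite dotpZr mulf_neq0//.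
    by rewrite invr_neq0// gt_eqF// enorm_gt0.
  have : 0 < dotp (a j) x * dotp (a j) (w t).
    rewrite dotpDr !dotpZr mulrDr ltr_pwDl//.
      by rewrite mulrCA mulr_gt0 ?subr_gt0// lt_neqAle eq_sym mulf_neq0//= -expr2 sqr_ge0.
    by rewrite mulrCA mulr_ge0.
  by apply: contraTneq => ->; rewrite mulr0 ltxx.
move=> B; rewrite -{1}f1 => /(cf 1 _)-/(_ _)[|e /= e0 eB]; first by rewrite ler01 lexx.
(* A parameter in [[0, 1)] within [e] of 1: its point is in the given neighbourhood of [y], and the
   arc over [[0, s]] joins it to [x] off the hyperspheres. *)
pose s : R := 1 - Num.min (e / 2) (1 / 2).
have [s0 s1] : 0 <= s /\ s < 1.
  rewrite /s; split; first by rewrite subr_ge0 ge_min; apply/orP; right; lra.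
  by rewrite ltrBlDr ltrDl lt_min !divr_gt0.
exists (f s); split; last first.
  apply: eB => /=; rewrite /s subKr gtr0_norm ?lt_min ?divr_gt0//.
  by rewrite gt_min; apply/orP; left; lra.
suff : f @` `[0, s]%classic `<=` connected_component X x.
  by apply; exists s => //; rewrite /= in_itv/= lexx s0.
apply: connected_component_max.
- by exists 0 => //; rewrite /= in_itv/= lexx s0.
- move=> _ [t /= + <-]; rewrite in_itv/= => /andP[t0 ts]; apply: Xf.
  by rewrite t0 (le_lt_trans ts).
- apply: connected_continuous_connected; first exact: segment_connected.
  apply: continuous_in_subspaceT => t; rewrite inE/= in_itv/= => /andP[t0 ts].
  by apply: cf; rewrite t0 (le_trans ts)// ltW.
Qed.

End with_normals.

Lemma third_point x : exists2 z, usphere z & z <> x /\ z <> - x.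
Proof.
pose e (i : 'I_d.+1) : E := delta_mx 0 i.
have es i : usphere (e i).
  apply/usphereE; rewrite /dotp (bigD1 i)//= !mxE !eqxx mulr1 big1 ?addr0//.
  by move=> j ji; rewrite !mxE (negbTE ji) andbF mulr0.
have ne : (ord0 : 'I_d.+1) != ord_max by rewrite -val_eqE /= eq_sym -lt0n.
have key (s : R) : e ord0 <> s *: e ord_max.
  move=> /rowP/(_ ord0); rewrite !mxE eqxx (negbTE ne) mulr0 => /eqP.
  by rewrite oner_eq0.
have [H|H] := pselect (e ord0 <> x /\ e ord0 <> - x); first by exists (e ord0).
exists (e ord_max) => //; split=> xe; apply: H; rewrite -?xe.
  by split; [rewrite -[e ord_max]scale1r|rewrite -scaleN1r]; exact: key.
have -> : x = - e ord_max by rewrite xe opprK.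
by split; [rewrite -scaleN1r|rewrite -[e ord_max]scale1r]; exact: key.
Qed.

(** The arc argument does not reach the antipode of [x]. The antipode is in the cell only if
    [n = 0], when the cell is the whole sphere; it is then reached by two arcs through a third
    point, which exists because [d >= 1]. *)
Lemma closure_component n (K : 'I_n -> KS) x : hyperspheres K ->
  usphere x -> off K x ->
  closure (connected_component (usphere `\` \bigcup_i sset (K i)) x) =
  cellset K (point : KS) x.
Proof.
move=> /(hyperspheres_normals d0)[a aK] sx xoff.
set X := _ `\` _; have Xx : X x by split => // -[j _]; exact: xoff.
apply/seteqP; split.
  apply: (@subset_trans _ (closure (cellset K (point : KS) x))).
    by apply: closure_subset; exact: component_subset_cell.
  by have /closure_id <- := @closed_cellset _ _ _ aK (point : KS) x.
move=> y xy; have [yE|yx] := pselect (y = - x); last exact: cell_in_closure xy.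
rewrite yE in xy *.
have [sy _] := xy.
case: n K a aK xoff @X Xx xy => [|n] K a aK xoff X Xx xy; last first.
  move: xy => /(cellsetE aK)[_ /(_ ord0)].
  have /(offE aK sx)/(_ ord0) ax := xoff.
  rewrite dotpNr mulrN -expr2 oppr_ge0 leNgt => /negP[].
  by rewrite lt_neqAle eq_sym sqrf_eq0 ax sqr_ge0.
have XS : X = usphere by apply/seteqP; split => [z []//|z sz]; split => // -[[]].
have [z sz [zx zNx]] := third_point x.
have cl t : closed (connected_component X t).
  by apply: component_closed; rewrite XS; exact: closed_usphere.
have xz : connected_component X x z.
  have /closure_id -> := cl x.
  by apply: (cell_in_closure aK) => //; apply/(cellsetE aK); split => // -[].
rewrite (same_connected_component xz).
apply: (cell_in_closure aK); first by rewrite -/X XS.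
  by move=> /oppr_inj/esym.
by apply/(cellsetE aK); split => // -[].
Qed.

Lemma tessellationE n (K : 'I_n -> KS) : hyperspheres K ->
  tessellation (fun i => sset (K i)) = cells K (point : KS).
Proof.
move=> HK; apply/seteqP; split=> [_ [x [sx Kx] <-]|_ [x [sx Kx] <-]].
  have xoff : off K x by move=> j Kj; apply: Kx; exists j.
  by exists x => //; rewrite closure_component.
exists x; last by rewrite closure_component.
by split => // -[j _]; exact: Kx.
Qed.

Lemma nbhs_cellset n (K : 'I_n -> KS) a q :
  (forall i, usphere (a i) /\ sset (K i) = perp (a i) `&` usphere) ->
  usphere q -> off K q ->
  within usphere (nbhs q) (cellset K (point : KS) q).
Proof.
move=> aK sq /(offE aK sq) q0; have : \forall y \near q, forall j, 0 < dotp (a j) q * dotp (a j) y.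
  apply: (@filter_forall _ _ _ (nbhs q)) => j; have H : 0 < dotp (a j) q * dotp (a j) q.
    by rewrite lt_neqAle eq_sym mulf_neq0//= -expr2 sqr_ge0.
  have cf : {for q, continuous (fun y : E => dotp (a j) q * dotp (a j) y)}.
    by apply: (@continuousM R E (cst (dotp (a j) q)) (dotp (a j)) q);
      [exact: cst_continuous|exact: dotp_continuous].
  have N : nbhs (dotp (a j) q * dotp (a j) q) [set r : R | 0 < r].
    by apply: open_nbhs_nbhs; split => //; exact: open_gt.
  exact: (cf _ N).
by apply: filterS => y H sy; apply/(cellsetE aK); split => // j; exact: ltW.
Qed.

(** If [y] were on the hypersphere [j], moving it away from [q] inside [V] would lead strictly to
    the side opposite to [q], hence out of the cell. *)
Lemma relint_off n (K : 'I_n -> KS) L a q (V : {vspace E}) y :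
  (forall i, usphere (a i) /\ sset (K i) = perp (a i) `&` usphere) ->
  sset L q -> off K q -> usphere y -> y \in V -> q \in V ->
  within ([set` V] `&` usphere) (nbhs y) (cellset K L q) -> off K y.
Proof.
move=> aK Lq qoff sy yV qV H; have sq := sset_sphere Lq.
have q0 := (offE aK sq).1 qoff.
apply/(offE aK sy) => j; apply/eqP => ay.
have [e e0 [z0 /(cellsetE aK)[_ /(_ j)]]] := rel_interior_move sy yV qV H.
rewrite (normalize_sign a)// dotpBr ay dotpZr sub0r mulrN oppr_ge0 mulrCA.
rewrite pmulr_rle0// leNgt => /negP; apply.
by rewrite lt_neqAle eq_sym mulf_neq0//= -expr2 sqr_ge0.
Qed.

Lemma cellset_point n (K : 'I_n -> KS) L q :
  cellset K (point : KS) q `&` sset L = cellset K L q.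
Proof.
apply/seteqP; split => [y [[_ H] Ly] //|y [Ly H]].
by split => //; split => //; exact: sset_sphere Ly.
Qed.

(** An interior point [y] of a cell is off all hyperspheres, so the cell is the cell of [y]. If [y]
    is in [L], the trace of the cell on [L] is generated by a point of [L]. *)
Lemma sectionE n (K : 'I_n -> KS) L : hyperspheres K ->
  section (tessellation (fun i => sset (K i))) (sset L) = cells K L.
Proof.
move=> HK; have [a aK] := hyperspheres_normals d0 HK.
rewrite /section tessellationE//; apply/seteqP; split.
  move=> _ [_ [[q [sq qoff] <-] [y [[sy yin] Ly]]] <-].
  rewrite cellset_point.
  have yoff : off K y.
    apply: (relint_off aK (L := point) (V := fullv) sq qoff sy);
      rewrite ?memvf//.
    apply: (@filterS _ (nbhs y) _
      [set z | usphere z -> cellset K (point : KS) q z]) yin.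
    by move=> z H [_ sz]; exact: H.
  have yq : cellset K (point : KS) q y by exact: (nbhs_singleton yin).
  exists y => //; rewrite -!(cellset_point _ L).
  by rewrite (cellset_swap aK qoff yoff sq sy yq).
move=> _ [q [Lq qoff] <-]; have sq := sset_sphere Lq.
exists (cellset K (point : KS) q); last exact: cellset_point.
split; first by exists q.
by exists q; split => //; split => //; exact: (nbhs_cellset aK).
Qed.

Lemma cells_finite n (K : 'I_n -> KS) L : hyperspheres K ->
  finite_set (cells K L).
Proof.
move=> /(hyperspheres_normals d0)[a aK].
pose F (s : {ffun 'I_n -> bool}) : set E := sset L `&`
  [set y | forall j, if s j then 0 <= dotp (a j) y else dotp (a j) y <= 0].
apply: (@sub_finite_set _ _ (range F)); last exact: finite_image.
move=> _ [q [Lq qoff] <-]; have q0 := (offE aK (sset_sphere Lq)).1 qoff.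
exists [ffun j => 0 < dotp (a j) q] => //.
apply/seteqP; split => y.
  move=> [Ly H]; apply/(cellsetE aK); split => // j; have := H j; rewrite ffunE.
  have [p|p] := ltP 0 (dotp (a j) q); first by rewrite pmulr_rge0.
  by move=> yj; rewrite nmulr_rge0// lt_neqAle q0.
move=> /(cellsetE aK)[Ly H]; split => // j; have := H j; rewrite ffunE.
have [p|p] := ltP 0 (dotp (a j) q); first by rewrite pmulr_rge0.
by rewrite nmulr_rge0// lt_neqAle q0.
Qed.

Lemma bigcap_cells n (K : 'I_n -> KS) L x : hyperspheres K -> sset L x ->
  off K x -> \bigcap_(P in [set P | cells K L P /\ P x]) P = cellset K L x.
Proof.
move=> /(hyperspheres_normals d0)[a aK] Lx xoff; have sx := sset_sphere Lx.
apply/seteqP; split.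
  apply: bigcap_inf; split; first by exists x.
  by apply/(cellsetE aK); split => // j; rewrite -expr2 sqr_ge0.
move=> y yx _ [[q [Lq qoff] <-] qx].
by rewrite (cellset_swap aK qoff xoff (sset_sphere Lq) sx qx).
Qed.

Lemma facsetE n (K : 'I_n -> KS) a x y :
  (forall i, usphere (a i) /\ sset (K i) = perp (a i) `&` usphere) ->
  usphere x -> facset K x y <-> usphere y /\ forall j,
    0 <= dotp (a j) x * dotp (a j) y /\ (dotp (a j) x = 0 -> dotp (a j) y = 0).
Proof.
move=> aK sx; split=> -[sy H]; split => // j; have [H1 H2] := H j.
  by move: H1; rewrite (sideaE aK) => H1; split => // /(hyperE aK j sx)/H2/(hyperE aK j sy).
by rewrite (sideaE aK); split => // /(hyperE aK j sx)/H2/(hyperE aK j sy).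
Qed.

(** [x] is pushed slightly towards [z]. The result is on the side of [x] for the hyperspheres that
    avoid [x], and on the side of [z] for those through [x]. *)
Lemma adjacent_cell n (K : 'I_n -> KS) a x z :
  (forall i, usphere (a i) /\ sset (K i) = perp (a i) `&` usphere) ->
  usphere x -> (forall j, dotp (a j) z != 0) ->
  exists q, [/\ usphere q, off K q, cellset K (point : KS) q x &
    forall j, (dotp (a j) x = 0 -> 0 < dotp (a j) q * dotp (a j) z) /\
              (dotp (a j) x != 0 -> 0 < dotp (a j) x * dotp (a j) q)].
Proof.
move=> aK sx z0.
have [e e0 eP] := small_delta (fun j => dotp (a j) x) (fun j => - dotp (a j) z).
pose w := x - e *: - z.
have aw j : dotp (a j) w = dotp (a j) x - e * - dotp (a j) z.
  by rewrite dotpBr dotpZr dotpNr.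
have sgn j : (dotp (a j) x = 0 -> 0 < dotp (a j) w * dotp (a j) z) /\
             (dotp (a j) x != 0 -> 0 < dotp (a j) x * dotp (a j) w).
  rewrite aw; split=> [->|xj]; last by apply: perturb_sign => //; exact: eP.
  rewrite sub0r mulrN opprK -mulrA mulr_gt0//.
  by rewrite lt_neqAle eq_sym mulf_neq0//= -expr2 sqr_ge0.
have aw0 j : dotp (a j) w != 0.
  have [xj|xj] := eqVneq (dotp (a j) x) 0.
    by have := (sgn j).1 xj; apply: contraTneq => ->; rewrite mul0r ltxx.
  by have := (sgn j).2 xj; apply: contraTneq => ->; rewrite mulr0 ltxx.
(* [w = 0] can occur only for [n = 0], where [x] itself serves. *)
have [wz|wn0] := eqVneq w 0.
  exists x; case: n K a aK z0 eP aw sgn aw0 => [|n] K a aK z0 eP aw sgn aw0; last first.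
    by have := aw0 ord0; rewrite wz dotp0r eqxx.
  split => //; [by case|by apply/(cellsetE aK); split => // -[]|by case].
have ew : 0 < (enorm w)^-1 by rewrite invr_gt0 enorm_gt0.
have sq := normalize_usphere wn0.
exists ((enorm w)^-1 *: w); split => //.
- by apply/(offE aK sq) => j; rewrite dotpZr mulf_neq0// gt_eqF.
- apply/(cellsetE aK); split => // j; rewrite dotpZr -mulrA pmulr_rge0//.
  have [->|xj] := eqVneq (dotp (a j) x) 0; first by rewrite mulr0.
  by rewrite mulrC ltW//; exact: (sgn j).2.
- move=> j; rewrite dotpZr; split => xj.
    by rewrite -mulrA pmulr_rgt0//; exact: (sgn j).1.
  by rewrite mulrCA pmulr_rgt0//; exact: (sgn j).2.
Qed.

(** The cells reached from [x] towards [z] and towards [- z] are on opposite sides of every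
    hypersphere through [x], so their common points lie on all these hyperspheres. *)
Lemma bigcap_tessellation n (K : 'I_n -> KS) x z : hyperspheres K ->
  usphere x -> usphere z -> off K z ->
  \bigcap_(P in [set P | cells K (point : KS) P /\ P x]) P = facset K x.
Proof.
move=> /(hyperspheres_normals d0)[a aK] sx sz /(offE aK sz) z0.
have Nz0 j : dotp (a j) (- z) != 0 by rewrite dotpNr oppr_eq0.
have [q [sq qoff qx qs]] := adjacent_cell aK sx z0.
have [q' [sq' qoff' qx' qs']] := adjacent_cell aK sx Nz0.
apply/seteqP; split => y.
  move=> H; apply/(facsetE _ aK sx).
  have /(cellsetE aK)[sy qy] : cellset K (point : KS) q y.
    by apply: H; split => //; exists q.
  have /(cellsetE aK)[_ qy'] : cellset K (point : KS) q' y.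
    by apply: H; split => //; exists q'.
  split => // j; split.
    have [->|xj] := eqVneq (dotp (a j) x) 0; first by rewrite mul0r.
    by rewrite (pos_mul_sign _ ((qs j).2 xj)); exact: qy.
  move=> xj; have h1 := (qs j).1 xj; have := (qs' j).1 xj => h2.
  move: (qy j) (qy' j); rewrite (pos_mul_sign _ h1) (pos_mul_sign _ h2) dotpNr.
  rewrite mulNr oppr_ge0 => y1 y2.
  have /eqP : dotp (a j) z * dotp (a j) y = 0 by apply/eqP; rewrite eq_le y1 y2.
  by rewrite mulf_eq0 (negbTE (z0 j)) => /eqP.
move=> /(facsetE _ aK sx)[sy H] _ [[p [sp poff] <-] /(cellsetE aK)[_ px]].
apply/(cellsetE aK); split => // j; have [H1 H2] := H j.
have [/H2 ->|xj] := eqVneq (dotp (a j) x) 0; first by rewrite mulr0.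
have p0 := (offE aK sp).1 poff j.
rewrite (@pos_mul_sign _ (dotp (a j) x))// lt_neqAle px andbT eq_sym.
by rewrite mulf_neq0.
Qed.

End geometry.

(** * Faces of a cell *)

Section faces.
Variables (R : realType) (d : nat).
Notation E := 'rV[R]_d.+1.
Notation KS := (sbody R d).
Implicit Types (x y z w q : E) (L : KS).

Lemma subset_of_card (T : finType) (A : {set T}) m : (m <= #|A|)%N ->
  exists2 B : {set T}, B \subset A & #|B| = m.
Proof.
move=> mA; exists [set x in take m (enum A)]%SET.
  by apply/fintype.subsetP => x; rewrite inE => /mem_take; rewrite mem_enum.
rewrite cardsE (card_uniqP _) ?take_uniq ?enum_uniq//.
by rewrite size_takel// -cardE.
Qed.

Section with_normals.
Variables (n : nat) (K : 'I_n -> KS) (a : 'I_n -> E).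
Hypothesis aK : forall i, usphere (a i) /\ sset (K i) = perp (a i) `&` usphere.

Lemma relint_move (P : set E) x y : relint P x -> usphere x -> lin P y ->
  exists2 e : R, 0 < e & x - e *: y != 0 /\ P ((enorm (x - e *: y))^-1 *: (x - e *: y)).
Proof.
have [X [_ _ PX]] := lin_free P.
rewrite /relint /rel_interior PX => -[[xV _] Px] sx yV.
exact: (rel_interior_move sx xV yV Px).
Qed.

Lemma cell_cone_le q x w (C : set E) (b : E) :
  (forall y, C y -> 0 <= dotp b y) ->
  cellset K (point : KS) q = C `&` usphere ->
  (forall j, 0 <= dotp (a j) q * dotp (a j) w) -> 0 <= dotp b w.
Proof.
move=> Cb KC qw; have [->|w0] := eqVneq w 0; first by rewrite dotp0r.
suff /Cb : C ((enorm w)^-1 *: w).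
  by rewrite dotpZr pmulr_rge0// invr_gt0 enorm_gt0.
have : cellset K (point : KS) q ((enorm w)^-1 *: w).
  apply/(cellsetE aK); split; first exact: normalize_usphere.
  by move=> j; rewrite (normalize_sign a).
by rewrite KC => -[].
Qed.

Lemma perturb_cell q x y (e : R) : 0 < e ->
  (forall j, 0 <= dotp (a j) q * dotp (a j) x) ->
  (forall j, dotp (a j) x = 0 -> dotp (a j) y = 0) ->
  (forall j, dotp (a j) x != 0 -> e * `|dotp (a j) y| < `|dotp (a j) x|) ->
  forall j, 0 <= dotp (a j) q * dotp (a j) (x - e *: y).
Proof.
move=> e0 qx xy ey j; rewrite dotpBr dotpZr.
have [xj|xj] := eqVneq (dotp (a j) x) 0.
  by rewrite xj xy// mulr0 subr0 mulr0.
rewrite mulrC -(pos_mul_sign _ (perturb_sign e0 (ey j xj))) mulrC.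
exact: qx.
Qed.

(** Both inclusions move [x] away from [y]. If [y] is in the face, the moved point stays in the
    cell, which forces [y] onto the hyperspheres through [x]. If [y] is in [facset K x], the moved
    point stays in the cone, so the supporting functional [b] is at most 0 at [y], hence equal to
    0. *)
Lemma face_facset k q (F : set E) x :
  usphere q -> off K q -> spherical_face k (cellset K (point : KS) q) F ->
  relint F x -> F = facset K x.
Proof.
move=> sq qoff [C [G [[pC C0 PC] [[b Cb GE] _ FE]]]] xF.
have q0 := (offE aK sq).1 qoff.
have Fx : F x by have [Lx /nbhs_singleton Fx] := xF; exact: Fx.
have [Cx bx sx] : [/\ C x, dotp b x = 0 & usphere x].
  by move: Fx; rewrite FE GE => -[[Cx bx] sx].
have /(cellsetE aK)[_ qx] : cellset K (point : KS) q x by rewrite PC.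
apply/seteqP; split => y.
  move=> Fy; have [Cy by_ sy] : [/\ C y, dotp b y = 0 & usphere y].
    by move: Fy; rewrite FE GE => -[[]].
  have /(cellsetE aK)[_ qy] : cellset K (point : KS) q y by rewrite PC.
  have [e e0 [w0]] := relint_move xF sx (sub_lin Fy).
  rewrite FE GE => -[[Cw _] sw].
  have /(cellsetE aK)[_ qw] : cellset K (point : KS) q
      ((enorm (x - e *: y))^-1 *: (x - e *: y)) by rewrite PC.
  apply/(facsetE _ aK sx); split => // j; split.
    have [->|xj] := eqVneq (dotp (a j) x) 0; first by rewrite mul0r.
    rewrite -(@pos_mul_sign _ (dotp (a j) q))//.
    by rewrite lt_neqAle qx andbT eq_sym mulf_neq0.
  move=> xj; have := qw j; rewrite (normalize_sign a)// dotpBr dotpZr xj sub0r.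
  rewrite mulrN oppr_ge0 mulrCA pmulr_rle0// => qy'.
  have /eqP : dotp (a j) q * dotp (a j) y = 0 by apply/eqP; rewrite eq_le qy' qy.
  by rewrite mulf_eq0 (negbTE (q0 j)) => /eqP.
move=> /(facsetE _ aK sx)[sy xy].
have qy j : 0 <= dotp (a j) q * dotp (a j) y.
  have [xj|xj] := eqVneq (dotp (a j) x) 0.
    by rewrite (xy j).2 ?mulr0.
  rewrite (@pos_mul_sign _ _ (dotp (a j) x)); first exact: (xy j).1.
  by rewrite lt_neqAle qx andbT eq_sym mulf_neq0.
have [Cy _] : (C `&` usphere) y by rewrite -PC; apply/(cellsetE aK); split.
have [e e0 eP] := small_delta (fun j => dotp (a j) x) (fun j => dotp (a j) y).
have := cell_cone_le x Cb PC (perturb_cell e0 qx (fun j => (xy j).2) eP).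
rewrite dotpBr dotpZr bx sub0r oppr_ge0 pmulr_rle0// => by_.
rewrite FE GE; split => //; split => //; apply/eqP.
by rewrite /perp /= eq_le by_ Cb.
Qed.

(** Each normal vector lowers the dimension by at most one. *)
Lemma perp_family (J : {set 'I_n}) : exists2 V : {vspace E},
  [set` V] = [set w | forall j, j \in J -> dotp (a j) w = 0] &
  (d.+1 <= \dim V + #|J|)%N.
Proof.
have [m] := ubnP #|J|; elim: m J => // m IH J' Jm.
have [->|[j jJ']] := set_0Vmem J'.
  exists fullv; last by rewrite cards0 addn0 dimvf /dim /= mul1n.
  by apply/seteqP; split => w //= _; [move=> j; rewrite inE|rewrite memvf].
move: Jm; rewrite (cardsD1 j) jJ' -{2}(finset.setD1K jJ').
set J := (J' :\ j)%SET => Jm.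
have jJ : j \notin J by rewrite !inE eqxx.
have [V VE Vd] := IH J Jm.
have [W WE WU] := perp_vspace (a j); exists (V :&: W)%VS.
  apply/seteqP; split => w /=.
    rewrite memv_cap => /andP[wV wW] i; rewrite in_setU1 => /orP[/eqP ->|].
      by have : perp (a j) w by rewrite WE.
    by move: i; change ([set w | forall j, j \in J -> dotp (a j) w = 0] w); rewrite -VE.
  move=> H; rewrite memv_cap; apply/andP; split.
    suff : [set` V] w by [].
    by rewrite VE /= => i iJ; apply: H; rewrite in_setU1 iJ orbT.
  suff : [set` W] w by [].
  by rewrite -WE; apply: H; rewrite setU11.
have [+ _] := WU V; rewrite add1n.
by move: Vd; move: (\dim V) (\dim (V :&: W)) #|J| => p r s; lia.
Qed.

Lemma meetsetE (J : {set 'I_n}) : meetset J K =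
  [set w | forall j, j \in J -> dotp (a j) w = 0] `&` usphere.
Proof.
apply/seteqP; split => w.
  by move=> [sw H]; split => // j jJ; apply/(hyperE aK j sw)/H.
by move=> [H sw]; split => // j jJ; apply/(hyperE aK j sw); exact: H.
Qed.

Lemma lin_meetset (J : {set 'I_n}) :
  lin (meetset J K) = [set w | forall j, j \in J -> dotp (a j) w = 0].
Proof. by have [V VE _] := perp_family J; rewrite meetsetE -VE lin_sphere. Qed.

(** Let [J] index the hyperspheres that contain [F]. A sum [x] of points of [F], one off each
    remaining hypersphere, is off all of those, since the signs agree on the cell. So [x] can be
    moved both ways along the intersection [W] of the hyperplanes of [J] without leaving the cone;
    thus [b] vanishes on [W], and [W] lies in the span of the face. Comparing dimensions shows that
    [J] has at least [d - k] elements. *)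
Lemma face_sub_meetset k q (F : set E) : (k < d)%N ->
  usphere q -> off K q -> spherical_face k (cellset K (point : KS) q) F ->
  exists2 J : {set 'I_n}, #|J| = (d - k)%N & F `<=` meetset J K.
Proof.
move=> kd sq qoff [C [G [[pC C0 PC] [[b Cb GE] [V GV Vk] FE]]]].
have q0 := (offE aK sq).1 qoff.
have CD y z : C y -> C z -> C (y + z).
  by move: pC => [m [c ->]] /= cy cz i; rewrite dotpDr addr_ge0.
have CO : C 0 by move: pC => [m [c ->]] /= i; rewrite dotp0r.
have CN y : y != 0 -> C ((enorm y)^-1 *: y) -> C y.
  move: pC => [m [c ->]] /= y0 H i; have := H i.
  by rewrite dotpZr pmulr_rge0// invr_gt0 enorm_gt0.
have inC w : (forall j, 0 <= dotp (a j) q * dotp (a j) w) -> C w.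
  move=> qw; have [->//|w0] := eqVneq w 0; apply: CN => //.
  have : cellset K (point : KS) q ((enorm w)^-1 *: w).
    apply/(cellsetE aK); split; first exact: normalize_usphere.
    by move=> j; rewrite (normalize_sign a).
  by rewrite PC => -[].
have Fq y : F y -> forall j, 0 <= dotp (a j) q * dotp (a j) y.
  rewrite FE GE => -[[Cy _] sy]; have : (C `&` usphere) y by [].
  by rewrite -PC => /(cellsetE aK)[].
have FP y : F y -> C y /\ dotp b y = 0 by rewrite FE GE => -[[]].
pose J : {set 'I_n} := [set j | `[< forall y, F y -> dotp (a j) y = 0 >]]%SET.
have JP j : reflect (forall y, F y -> dotp (a j) y = 0) (j \in J).
  by rewrite /J inE; exact: asboolP.
clearbody J.
have /choice[z zP] : forall j, exists z, F z /\ (j \notin J -> dotp (a j) z != 0) \/ j \in J.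
  move=> j; have [jJ|jJ] := boolP (j \in J); first by exists 0; right.
  have /existsNP[z /not_implyP[Fz az]] : ~ forall y, F y -> dotp (a j) y = 0.
    by move/JP; exact/negP.
  by exists z; left; split => // _; apply/eqP.
have zF j : j \notin J -> F (z j) /\ dotp (a j) (z j) != 0.
  by move=> jJ; have [[Fz /(_ jJ)]|] := zP j; last by rewrite (negbTE jJ).
pose x := \sum_(j | j \notin J) z j.
have ax i : dotp (a i) x = \sum_(j | j \notin J) dotp (a i) (z j).
  by rewrite /x; apply: (big_morph (dotp (a i))); [exact: dotpDr|exact: dotp0r].
have [Cx bx] : C x /\ dotp b x = 0.
  rewrite /x; elim/big_ind : _ => [||j /zF[/FP]]//; first by rewrite dotp0r.
  by move=> y t [Cy by_] [Ct bt]; split; [exact: CD|rewrite dotpDr by_ bt addr0].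
have xJ j : j \in J -> dotp (a j) x = 0.
  move=> jJ; rewrite ax big1// => i /zF[Fz _].
  by move/JP : jJ; exact.
have qx j : 0 <= dotp (a j) q * dotp (a j) x.
  by rewrite ax mulr_sumr sumr_ge0// => i /zF[Fz _]; exact: Fq.
have xnJ j : j \notin J -> dotp (a j) x != 0.
  move=> jJ; have [Fz az] := zF j jJ.
  have : 0 < dotp (a j) q * dotp (a j) x.
    rewrite ax mulr_sumr (bigD1 j)//= ltr_pwDl//.
      by rewrite lt_neqAle Fq// andbT eq_sym mulf_neq0.
    by rewrite sumr_ge0// => i /andP[/zF[Fzi _] _]; exact: Fq.
  by apply: contraTneq => ->; rewrite mulr0 ltxx.
have Gx : lin G x by apply: sub_lin; rewrite GE.
have [W WE Wd] := perp_family J.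
have WV : (W <= V)%VS.
  apply/subvP => w wW.
  have wJ j : j \in J -> dotp (a j) w = 0.
    move: j; change ([set w | forall j, j \in J -> dotp (a j) w = 0] w).
    by rewrite -WE.
  have xw j : dotp (a j) x = 0 -> dotp (a j) w = 0.
    move=> xj; apply: wJ; apply: contraLR (_ : dotp (a j) x == 0); last exact/eqP.
    exact: xnJ.
  have [e e0 eP] := small_delta (fun j => dotp (a j) x) (fun j => dotp (a j) w).
  have p1 := perturb_cell e0 qx xw eP.
  have p2 : forall j, 0 <= dotp (a j) q * dotp (a j) (x - e *: - w).
    apply: (perturb_cell e0 qx) => j; first by move=> /xw wj; rewrite dotpNr wj oppr0.
    by rewrite dotpNr normrN; exact: eP.
  have b1 := Cb _ (inC _ p1); have b2 := Cb _ (inC _ p2).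
  move: b1 b2; rewrite !dotpBr !dotpZr dotpNr bx !sub0r mulrN opprK => b1 b2.
  have bw : e * dotp b w = 0 by apply/eqP; rewrite eq_le b2 -oppr_ge0 b1.
  have Gxw : lin G (x - e *: w).
    apply: sub_lin; rewrite GE; split; first exact: inC.
    by rewrite /perp /= dotpBr dotpZr bx bw subr0.
  suff : [set` V] w by [].
  rewrite -GV -(@scale1r _ _ w) -(@mulVf _ e) ?gt_eqF// -scalerA; apply: linZ.
  by have := linB Gx Gxw; rewrite opprB addrC subrK.
have Jd : (d - k <= #|J|)%N.
  by have := dimvS WV; rewrite Vk; move: Wd; move: (\dim W) #|J| => p s; lia.
have [I IJ Id] := subset_of_card Jd.
exists I => // y Fy; rewrite meetsetE; split; last by move: Fy; rewrite FE => -[].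
by move=> j /(fintype.subsetP IJ)/JP; exact.
Qed.

End with_normals.
End faces.

(** * The skeleton as a union of subspheres *)

Section skeleton.
Variables (R : realType) (d n : nat).
Notation E := 'rV[R]_d.+1.
Notation KS := (sbody R d).
Implicit Types (x y z w q : E) (L : KS) (K : 'I_n -> KS) (J : {set 'I_n}).
Hypothesis d0 : (0 < d)%N.

Lemma relint_sub (P : set E) x : relint P x -> P x /\ usphere x.
Proof. by move=> [[Lx sx] /nbhs_singleton Px]; split => //; exact: Px. Qed.

Lemma cellset_self K L x : hyperspheres K -> sset L x -> cellset K L x x.
Proof.
move=> /(hyperspheres_normals d0)[a aK] Lx; apply/(cellsetE aK).
by split => // j; rewrite -expr2 sqr_ge0.
Qed.

Lemma relint_cell K L (Z : set E) x : hyperspheres K -> cells K L Z ->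
  relint Z x -> [/\ sset L x, off K x & Z = cellset K L x].
Proof.
move=> HK [q [Lq qoff] <-] xZ; have [a aK] := hyperspheres_normals d0 HK.
have [[Lx qx] sx] := relint_sub xZ.
have [X [_ _ ZX]] := lin_free (cellset K L q).
have xX : x \in <<X>>%VS.
  have : lin (cellset K L q) x by apply: sub_lin.
  by rewrite ZX.
have qX : q \in <<X>>%VS.
  have : lin (cellset K L q) q by apply: sub_lin; exact: cellset_self.
  by rewrite ZX.
have xoff : off K x.
  apply: (relint_off aK Lq qoff sx xX qX).
  by move: xZ; rewrite /relint /rel_interior ZX => -[].
by split => //; rewrite (cellset_swap aK qoff xoff (sset_sphere Lq) sx).
Qed.

Lemma relint_face k K (F : set E) x : hyperspheres K ->
  faces k (cells K (point : KS)) F -> relint F x -> F = facset K x /\ usphere x.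
Proof.
move=> HK [P [q [sq qoff] <-] PF] xF; have [a aK] := hyperspheres_normals d0 HK.
have [_ sx] := relint_sub xF; split => //.
exact: (face_facset aK sq qoff PF xF).
Qed.

Lemma skel_sub_meetset k K : (k < d)%N -> hyperspheres K ->
  skel k (cells K (point : KS)) `<=`
  \bigcup_(J in [set J : {set 'I_n} | #|J| = (d - k)%N]) meetset J K.
Proof.
move=> kd HK x [F [P [q [sq qoff] <-] PF] Fx].
have [a aK] := hyperspheres_normals d0 HK.
have [J Jk FJ] := face_sub_meetset aK kd sq qoff PF.
by exists J => //; exact: FJ.
Qed.

(** A cell next to [x], with generating point [q], has the face exposed by [b], the sum of its inner
    normals along [J]. This face spans the whole intersection of the hyperplanes of [J], because [x]
    is off the other hyperspheres and can be moved in every direction of the intersection. *)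
Lemma meetset_sub_skel k K J x z : hyperspheres K ->
  great_subsphere k (meetset J K) -> meetset J K x ->
  (forall j, j \notin J -> ~ sset (K j) x) -> usphere z -> off K z ->
  skel k (cells K (point : KS)) x.
Proof.
move=> HK [V0 V0k MV0] Jx xJ sz zoff; have [a aK] := hyperspheres_normals d0 HK.
have sx : usphere x by case: Jx.
have [q [sq qoff qx qs]] := adjacent_cell aK sx ((offE aK sz).1 zoff).
pose C : set E := [set w | forall j, 0 <= dotp (dotp (a j) q *: a j) w].
have CE w : C w <-> forall j, 0 <= dotp (a j) q * dotp (a j) w.
  by rewrite /C /mkset; split => H j; have := H j; rewrite dotpZl.
pose b : E := \sum_(i in J) dotp (a i) q *: a i.
have bE w : dotp b w = \sum_(i in J) dotp (a i) q * dotp (a i) w.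
  rewrite dotpC /b (big_morph (dotp w) (dotpDr w) (dotp0r w)).
  by apply: eq_bigr => i _; rewrite dotpZr (dotpC w).
have q0 := (offE aK sq).1 qoff.
have qx' : forall j, 0 <= dotp (a j) q * dotp (a j) x by case/(cellsetE aK) : qx.
have xJ0 j : j \in J -> dotp (a j) x = 0.
  by move=> jJ; apply/(hyperE aK j sx); case: Jx => _; exact.
have xJn j : j \notin J -> dotp (a j) x != 0.
  by move=> jJ; apply/eqP => /(hyperE aK j sx); exact: xJ.
have Cx : C x by apply/CE.
have bx : dotp b x = 0 by rewrite bE big1// => i iJ; rewrite xJ0// mulr0.
exists (C `&` perp b `&` usphere) => //.
exists (cellset K (point : KS) q); first by exists q.
exists C, (C `&` perp b); split; split => //.
- by exists n, (fun j => dotp (a j) q *: a j).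
- by move=> C0; move: Cx; rewrite C0 => x0; move: sx; rewrite x0; exact: usphere0.
- apply/seteqP; split => y; first by move=> /(cellsetE aK)[sy /CE].
  by move=> [/CE Cy sy]; apply/(cellsetE aK).
- exists b => // w /CE Cw; rewrite bE sumr_ge0//.
exists V0 => //; rewrite -[RHS]lin_sphere -MV0 (lin_meetset aK).
have [V VE _] := perp_family a J; rewrite -VE.
apply/seteqP; split.
  apply: lin_sub_vspace => w [/CE Cw]; rewrite /perp /= bE => /eqP.
  rewrite psumr_eq0// => /allP H; suff : [set` V] w by [].
  rewrite VE /= => j jJ; have := H j (mem_index_enum _).
  by rewrite jJ /= mulf_eq0 (negbTE (q0 j)) => /eqP.
move=> w; rewrite VE => wJ.
have xw j : dotp (a j) x = 0 -> dotp (a j) w = 0.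
  move=> aj; apply: wJ; apply: contraLR (_ : dotp (a j) x == 0); last exact/eqP.
  exact: xJn.
have [e e0 eP] := small_delta (fun j => dotp (a j) x) (fun j => dotp (a j) w).
have p1 := perturb_cell e0 qx' xw eP.
have Gx : lin (C `&` perp b) x by apply: sub_lin.
have Gxw : lin (C `&` perp b) (x - e *: w).
  apply: sub_lin; split; first exact/CE.
  rewrite /perp /= dotpBr dotpZr bx bE big1 ?mulr0 ?subrr// => i iJ.
  by rewrite wJ// mulr0.
rewrite -(@scale1r _ _ w) -(@mulVf _ e) ?gt_eqF// -scalerA; apply: linZ.
by have := linB Gx Gxw; rewrite opprB addrC subrK.
Qed.

(** The sign conditions of the hyperspheres of [J] are void at [x]; those of the remaining ones,
    enumerated by [g], define the cell in the section. *)
Lemma facset_cellset m (g : 'I_m -> 'I_n) K J x : hyperspheres K ->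
  (forall j, reflect (exists i, g i = j) (j \notin J)) -> meetset J K x ->
  (forall j, j \notin J -> ~ sset (K j) x) ->
  facset K x = cellset (K \o g) (meet J K) x.
Proof.
move=> HK gJ Jx xJ; have [a aK] := hyperspheres_normals d0 HK.
have sx : usphere x by case: Jx.
have agK : forall i, usphere ((a \o g) i) /\
    sset ((K \o g) i) = perp ((a \o g) i) `&` usphere.
  by move=> i; exact: aK.
have MJ : sset (meet J K) = meetset J K by apply: sset_meet; exists x.
apply/seteqP; split => y.
  move=> [sy H]; split.
    by rewrite MJ; split => // j jJ; apply: (H j).2; case: Jx => _; exact.
  by move=> i; have [] := H (g i).
move=> [+ H]; rewrite MJ => -[sy yJ]; split => // j.
have [jJ|jJ] := boolP (j \in J); last first.
  have /gJ[i <-] := jJ; split; first exact: H.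
  by move=> Kx; exfalso; apply: (xJ (g i)) => //; apply/gJ; exists i.
split; last by move=> _; exact: yJ.
have /(hyperE aK j sx) ax : sset (K j) x by case: Jx => _; exact.
by rewrite (sideaE aK) ax mul0r.
Qed.

(** Being off the hyperspheres outside [J], the point [x] can be moved within its face in every
    direction of the intersection over [J]. *)
Lemma lin_facset K J x : hyperspheres K -> meetset J K x ->
  (forall j, j \notin J -> ~ sset (K j) x) ->
  lin (facset K x) `&` usphere = meetset J K.
Proof.
move=> HK Jx xJ; have [a aK] := hyperspheres_normals d0 HK.
have sx : usphere x by case: Jx.
have xJ0 j : j \in J -> dotp (a j) x = 0.
  by move=> jJ; apply/(hyperE aK j sx); case: Jx => _; exact.
have xJn j : j \notin J -> dotp (a j) x != 0.
  by move=> jJ; apply/eqP => /(hyperE aK j sx); exact: xJ.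
have [V VE _] := perp_family a J.
rewrite (meetsetE aK) -VE; congr (_ `&` _); apply/seteqP; split.
  apply: lin_sub_vspace => w /(facsetE _ aK sx)[_ H]; suff : [set` V] w by [].
  by rewrite VE /= => j jJ; apply: (H j).2; exact: xJ0.
move=> w; rewrite VE => wJ.
have xw j : dotp (a j) x = 0 -> dotp (a j) w = 0.
  move=> aj; apply: wJ; apply: contraLR (_ : dotp (a j) x == 0); last exact/eqP.
  exact: xJn.
have [e e0 eP] := small_delta (fun j => dotp (a j) x) (fun j => dotp (a j) w).
have qx j : 0 <= dotp (a j) x * dotp (a j) x by rewrite -expr2 sqr_ge0.
have p1 := perturb_cell e0 qx xw eP.
have Fx : lin (facset K x) x.
  by apply: sub_lin; apply/(facsetE _ aK sx); split.
have Fxw : lin (facset K x) (x - e *: w).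
  have [->|w0] := eqVneq (x - e *: w) 0; first exact: lin0.
  rewrite -[_ - _](@scale1r _ _) -(@divff _ (enorm (x - e *: w))) ?gt_eqF ?enorm_gt0//.
  rewrite -scalerA; apply: linZ; apply: sub_lin; apply/(facsetE _ aK sx).
  split; first exact: normalize_usphere.
  move=> j; rewrite (normalize_sign a)//; split => // aj.
  by rewrite dotpZr dotpBr dotpZr aj xw// mulr0 subrr mulr0.
rewrite -(@scale1r _ _ w) -(@mulVf _ e) ?gt_eqF// -scalerA; apply: linZ.
by have := linB Fx Fxw; rewrite opprB addrC subrK.
Qed.

Lemma meetset_cut k K J j x : hyperspheres K ->
  great_subsphere k.+1 (meetset J K) -> meetset J K x -> ~ sset (K j) x ->
  great_subsphere k (meetset (j |: J) K).
Proof.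
move=> HK Jk Jx xj; have [a aK] := hyperspheres_normals d0 HK.
have sx : usphere x by case: Jx.
have -> : meetset (j |: J) K = meetset J K `&` perp (a j).
  apply/seteqP; split => y.
    move=> [sy H]; split.
      by split => // i iJ; apply: H; rewrite in_setU1 iJ orbT.
    by apply/(hyperE aK j sy); apply: H; rewrite setU11.
  move=> [[sy H] ay]; split => // i; rewrite in_setU1 => /orP[/eqP ->|]; last exact: H.
  exact/(hyperE aK j sy).
apply: (great_subsphere_cut Jk Jx).
by apply/eqP => /(hyperE aK j sx).
Qed.

Lemma facset_convex K x : hyperspheres K -> usphere x ->
  spherical_convex (facset K x).
Proof.
move=> HK sx; have [a aK] := hyperspheres_normals d0 HK.
pose J : {set 'I_n} := [set j | `[< sset (K j) x >]]%SET.
have -> : facset K x = sset (meet J K) `&` cellset K (point : KS) x.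
  rewrite sset_meet; last first.
    by exists x; split => // j; rewrite inE => /asboolP.
  apply/seteqP; split => y.
    move=> [sy H]; split; last by split => // j; have [] := H j.
    by split => // j; rewrite inE => /asboolP; exact: (H j).2.
  move=> [[sy yJ] [_ H]]; split => // j; split; first exact: H.
  by move=> Kx; apply: yJ; rewrite inE; exact/asboolP.
rewrite -(sset_cell d0 HK (sx : sset point x)).
pose F (b : bool) : set E := if b then sset (meet J K) else sset (cell K point x).
have -> : sset (meet J K) `&` sset (cell K point x) = \bigcap_b F b.
  apply/seteqP; split => [y [? ?] []//|y H].
  by split; [exact: (H true I)|exact: (H false I)].
apply: spherical_convexI; [exact: (inhabits true)|by case; exact: sbodyP|].
exists x => -[] _ /=.
  rewrite sset_meet; first by split => // j; rewrite inE => /asboolP.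
  by exists x; split => // j; rewrite inE => /asboolP.
by rewrite (sset_cell d0 HK (sx : sset point x)); exact: cellset_self.
Qed.

End skeleton.

(** * Uniform points of subspheres *)

Section uniform.
Variables (R : realType) (d k : nat).
Notation E := 'rV[R]_d.+1.
Notation KS := (sbody R d).
(* Finiteness and positivity of the k-dimensional measure of k-subspheres, and
   its additivity, are inherited through orthogonal maps from one subsphere
   carrying a uniform point; without any such subsphere the theorem is vacuous. *)
Variables (Sref : set E) (mu_ref : probability (borelE R d) R).
Hypothesis great_ref : great_subsphere k Sref.
Hypothesis mu_refE : forall A : set E, measurable (A : set (borelE R d)) ->
  mu_ref A = normalized_hausdorff k Sref A.
Implicit Types (L : KS) (A : set E).
Local Open Scope ereal_scope.

(** An orthogonal map from the reference subsphere onto [L]. The default identity makes [unif] a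
    probability kernel on all bodies, with value [mu_ref] where no such map exists. *)
Definition transport L : 'M[R]_d.+1 :=
  xget 1%:M%R [set M | M *m M^T = 1%:M /\ sset L = [set x *m M | x in Sref]]%R.

Lemma transport_orthogonal L : (transport L *m (transport L)^T = 1%:M)%R.
Proof.
rewrite /transport; case: xgetP => [M _ []//|_].
by rewrite trmx1 mulmx1.
Qed.

Lemma transport_image L : great_subsphere k (sset L) ->
  sset L = [set x *m transport L | x in Sref]%R.
Proof.
move=> Lk; rewrite /transport; case: xgetP => [M _ []//|H]; exfalso.
move: Lk great_ref => [V Vk LV] [V0 V0k SV0].
have [M MM MV] := orthogonal_transport (etrans V0k (esym Vk)).
apply: (H M); split => //; rewrite LV SV0; apply/seteqP; split.
  move=> x [/= xV sx]; have xM : x = (x *m M^T *m M)%R.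
    by rewrite -mulmxA (orthogonal_inv MM) mulmx1.
  exists (x *m M^T)%R => //; split; first by apply/MV; rewrite -xM.
  by apply/usphereE; rewrite dotp_orthogonal ?trmxK ?orthogonal_inv//; exact/usphereE.
move=> _ [x [/= xV sx] <-]; split; first exact/MV.
by apply/usphereE; rewrite dotp_orthogonal//; exact/usphereE.
Qed.

Lemma continuous_orthogonal (M : 'M[R]_d.+1) : (M *m M^T = 1%:M)%R ->
  continuous (fun x : E => x *m M)%R.
Proof.
move=> MM x B /nbhs_ballP[e /= e0 eB].
apply/nbhs_ballP; exists (e / d.+1%:R)%R => /=; first by rewrite divr_gt0.
move=> y; rewrite -ball_normE /= => xy; apply: eB; rewrite -ball_normE /=.
rewrite -mulmxBl (le_lt_trans (norm_le_enorm _))//.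
rewrite /enorm dotp_orthogonal// -/(enorm _) (le_lt_trans (enorm_le_norm _))//.
by rewrite mulrC -ltr_pdivlMr.
Qed.

Definition rotate L : borelE R d -> borelE R d := fun x => (x *m transport L)%R.

Lemma measurable_rotate L : measurable_fun setT (rotate L).
Proof.
apply: measurable_continuousE; apply: continuous_orthogonal.
exact: transport_orthogonal.
Qed.

HB.instance Definition _ L :=
  isMeasurableFun.Build _ _ _ _ (rotate L) (measurable_rotate L).

Definition unif (L : borelK R d) : {measure set (borelE R d) -> \bar R} :=
  distribution mu_ref (rotate L).

Lemma unif_val L A : unif L A = mu_ref (rotate L @^-1` A).
Proof. by []. Qed.

Lemma unif_setT L : unif L setT = 1.
Proof. exact: probability_setT. Qed.

Definition mass : R := fine (hausdorff_measure k Sref).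

(** [mu_ref] has total mass 1, whereas 0 or [+oo] divided by itself is 0 in the extended reals. *)
Lemma massE : hausdorff_measure k Sref = mass%:E /\ (0 < mass)%R.
Proof.
have := mu_refE measurableT; rewrite probability_setT /normalized_hausdorff setTI.
have := hausdorff_measure_ge0 k Sref; rewrite /mass.
case: (hausdorff_measure k Sref) => [r||] //=.
- rewrite lee_fin le_eqVlt => /orP[/eqP <-|//].
  by rewrite mul0e => /eqP; rewrite eqe oner_eq0.
- by rewrite invey mule0 => _ /eqP; rewrite eqe oner_eq0.
Qed.

Lemma hausdorff_great A L : great_subsphere k (sset L) ->
  measurable (A : set (borelE R d)) ->
  hausdorff_measure k (A `&` sset L) = mass%:E * unif L A.
Proof.
move=> Lk mA; have [mE m0] := massE.
rewrite unif_val mu_refE; last first.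
  rewrite -[X in measurable X]setTI.
  by apply: (@measurable_rotate L).
rewrite /normalized_hausdorff mE.
have -> : hausdorff_measure k (A `&` sset L) =
    hausdorff_measure k (rotate L @^-1` A `&` Sref).
  rewrite -[RHS](hausdorff_measure_orthogonal _ _ (transport_orthogonal L)).
  congr (hausdorff_measure _ _); rewrite {1}transport_image//; apply/seteqP; split.
    move=> y [Ay [x Sx xy]]; exists x => //; split => //.
    by rewrite /preimage /= /rotate xy.
  by move=> _ [x [Ax Sx] <-]; split => //; exists x.
by rewrite inver gt_eqF// muleCA -EFinM divff ?gt_eqF// mule1.
Qed.

Lemma unifE A L : great_subsphere k (sset L) ->
  measurable (A : set (borelE R d)) ->
  unif L A = normalized_hausdorff k (sset L) A.
Proof.
move=> Lk mA; have [mE m0] := massE.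
rewrite /normalized_hausdorff hausdorff_great//.
have -> : hausdorff_measure k (sset L) = mass%:E.
  have := hausdorff_great Lk measurableT.
  by rewrite setTI unif_setT mule1.
by rewrite inver gt_eqF// muleAC -EFinM divff ?gt_eqF// mul1e.
Qed.

Lemma unif_self L : great_subsphere k (sset L) -> unif L (sset L) = 1.
Proof.
move=> Lk; have mL : measurable (sset L : set (borelE R d)).
  by apply: measurable_closedE; exact: closed_sset.
rewrite -(unif_setT L) !unifE//.
by rewrite /normalized_hausdorff setTI setIid.
Qed.

Lemma unif_out L : ~ great_subsphere k (sset L) -> unif L = mu_ref :> (set _ -> _).
Proof.
move=> Lk; apply/funext => A; rewrite unif_val.
congr (mu_ref _); rewrite /rotate /transport; case: xgetP => [M _ [MM LM]|_]; last first.
  by apply/seteqP; split => x /=; rewrite mulmx1.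
exfalso; apply: Lk; move: great_ref => [V Vk SV].
have lM : linear (fun x : E => x *m M)%R by move=> c x y; rewrite mulmxDl scalemxAl.
pose f : {linear E -> E} := HB.pack (fun x : E => x *m M)%R (GRing.isLinear.Build _ _ _ _ _ lM).
have fE x : linfun f x = (x *m M)%R by rewrite lfunE.
exists (linfun f @: V)%VS.
  rewrite limg_dim_eq//; apply/eqP; rewrite -subv0; apply/subvP => x.
  rewrite memv_cap memv_ker fE => /andP[_ /eqP xM].
  by rewrite memv0 -[x]mulmx1 -MM mulmxA xM mul0mx.
rewrite LM SV; apply/seteqP; split.
  move=> _ [x [/= xV sx] <-]; split; first by rewrite /= -fE memv_img.
  by apply/usphereE; rewrite dotp_orthogonal//; exact/usphereE.
move=> _ [/= /memv_imgP[x xV ->]]; rewrite fE => sx; exists x => //; split => //.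
by apply/usphereE; rewrite -(dotp_orthogonal _ _ MM); exact/usphereE.
Qed.

(** Closed sets form a generating pi-system. For closed [B], the value at a great subsphere [L] is a
    constant times the Hausdorff measure of the part of [L] in [B], to which
    [measurable_hausdorff_closed] applies. *)
Lemma measurable_unif A : measurable (A : set (borelE R d)) ->
  measurable_fun setT (unif ^~ A).
Proof.
move=> mA; pose G := [set L : borelK R d | great_subsphere k (sset L)].
have mG : measurable G by exact: measurable_great_subsphere.
have [mE m0] := massE.
pose C : set (set (borelE R d)) := @closed E.
have genC : @measurable _ (borelE R d) = <<s C >>.
  apply/seteqP; split.
    apply: smallest_sub; first exact: smallest_sigma_algebra.
    move=> B oB; rewrite -[B]setCK.
    have mB : measurable (~` B : set (g_sigma_algebraType C)).
      by apply: sub_sigma_algebra; exact: open_closedC.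
    exact: (measurableC mB).
  apply: smallest_sub; first exact: smallest_sigma_algebra.
  by move=> B cB; apply: measurable_closedE.
apply: (@dynkin_induction _ (borelE R d) C
  (fun A => measurable_fun setT (unif ^~ A : borelK R d -> \bar R))) => //.
- by move=> B D; exact: closedI.
- by under eq_fun do rewrite unif_setT; exact: measurable_cst.
- move=> B cB.
  rewrite (_ : unif ^~ B = fun L => if L \in G then
     (mass^-1)%:E * hausdorff_measure k (B `&` sset L) else mu_ref B).
    apply: measurable_fun_if => //.
    - apply: (measurable_fun_bool true).
      by rewrite setTI (_ : _ @^-1` _ = G)//; apply/seteqP; split => L;
        [move=> /set_mem|exact: mem_set].
    - apply: measurable_funTS; apply: measurable_funeM.
      exact: measurable_hausdorff_closed.
  apply/funext => L; case: ifPn => [/set_mem GL|/negP GL].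
    rewrite hausdorff_great//; last exact: measurable_closedE.
    by rewrite muleA -EFinM mulVf ?gt_eqF// mul1e.
  by rewrite unif_out// => /mem_set.
- move=> B mB fB.
  rewrite (_ : unif ^~ (~` B) = fun L => 1 - unif L B).
    by apply: emeasurable_funB.
  apply/funext => L; rewrite !unif_val preimage_setC probability_setC//.
  by rewrite -[X in measurable X]setTI; exact: (@measurable_rotate L).
- move=> F mF tF fF.
  rewrite (_ : unif ^~ (\bigcup_k F k) = fun L => \sum_(0 <= i <oo) unif L (F i)).
    exact: ge0_emeasurable_sum.
  apply/funext => L; rewrite measure_bigcup//.
  by apply: eq_eseriesl => i; rewrite in_setT.
by move: mA; rewrite genC.
Qed.

HB.instance Definition _ :=
  isKernel.Build _ _ (borelK R d) (borelE R d) R unif measurable_unif.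

HB.instance Definition _ :=
  Kernel_isProbability.Build _ _ (borelK R d) (borelE R d) R unif unif_setT.

Definition uniform_kernel : R.-pker (borelK R d) ~> (borelE R d) := unif.

End uniform.

(** * Hausdorff measure of the skeleton *)

Section skeleton_measure.
Variables (R : realType) (d k : nat).
Notation E := 'rV[R]_d.+1.
Notation KS := (sbody R d).
Local Open Scope ereal_scope.

Lemma hausdorff_measure_set0 : hausdorff_measure k (set0 : set E) = 0.
Proof.
apply/eqP; rewrite eq_le hausdorff_measure_ge0 andbT.
apply: ge_ereal_sup => _ [delta /= d0 <-].
apply: (@le_trans _ _ (\sum_(0 <= i <oo) hterm k (set0 : set E))).
  by apply: hausdorff_content_le; split => // i; rewrite ediam_set0 leNye.
by rewrite eseries0// => i _ _; rewrite hterm_set0.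
Qed.

Lemma hausdorff_measure_bigU_le (I : Type) (s : seq I) (F : I -> set E) :
  hausdorff_measure k (\big[setU/set0]_(i <- s) F i) <=
  \sum_(i <- s) hausdorff_measure k (F i).
Proof.
elim: s => [|i s IH]; first by rewrite !big_nil hausdorff_measure_set0.
by rewrite !big_cons (le_trans (hausdorff_measureU _ _ _))// leeD.
Qed.

Lemma hausdorff_measure_bigU_ge (I : choiceType) (s : seq I) (F : I -> set E) (e : R) :
  (0 < e)%R -> uniq s ->
  (forall i j x y, i \in s -> j \in s -> i != j -> F i x -> F j y ->
    e <= enorm (x - y))%R ->
  \sum_(i <- s) hausdorff_measure k (F i) <=
  hausdorff_measure k (\big[setU/set0]_(i <- s) F i).
Proof.
move=> e0; elim: s => [|i s IH] /=; first by rewrite !big_nil hausdorff_measure_ge0.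
move=> /andP[is_ us] H; rewrite !big_cons.
apply: (@le_trans _ _ (hausdorff_measure k (F i) +
    hausdorff_measure k (\big[setU/set0]_(j <- s) F j))).
  apply: leeD => //; apply: IH => // j l x y js ls; apply: H; rewrite inE ?js ?ls orbT//.
apply: (hausdorff_measureU_separated _ e0) => x y Fx.
rewrite -bigcup_seq => -[j /= js Fy].
apply: (H i j) => //; rewrite ?inE ?eqxx ?js ?orbT//.
by apply: contraNneq is_ => ->.
Qed.

Variables (Sref : set E) (mu_ref : probability (borelE R d) R).
Hypothesis great_ref : great_subsphere k Sref.
Hypothesis mu_refE : forall A : set E, measurable (A : set (borelE R d)) ->
  mu_ref A = normalized_hausdorff k Sref A.
Hypothesis kd : (k < d)%N.
Variables (n : nat) (K : 'I_n -> KS) (z : E).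
Hypothesis HK : hyperspheres K.
Hypotheses (sz : usphere z) (zoff : off K z).

Notation mu J := (unif Sref mu_ref (meet J K)).

Definition subsets_of_size (m : nat) : {set {set 'I_n}} :=
  [set J : {set 'I_n} | #|J| == m]%SET.

Notation faceidx := (subsets_of_size (d - k)).

Hypothesis great_meet : forall J : {set 'I_n}, J \in faceidx ->
  great_subsphere k (meetset J K).
Hypothesis null_meet : forall (J : {set 'I_n}) j, J \in faceidx -> j \notin J ->
  mu J (sset (K j)) = 0.

Let d0 : (0 < d)%N := leq_ltn_trans (leq0n k) kd.

Let sset_meetJ J : J \in faceidx -> sset (meet J K) = meetset J K.
Proof.
by move=> /great_meet /great_subsphere_nonempty; exact: sset_meet.
Qed.

Let great_meetJ J : J \in faceidx -> great_subsphere k (sset (meet J K)).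
Proof. by move=> Jd; rewrite sset_meetJ//; exact: great_meet. Qed.

(** The upper bound is subadditivity. For the lower bound each subsphere is cut down to the part in
    [B i J], which keeps away from the hyperspheres outside [J]. These parts lie in the skeleton,
    are at pairwise distance at least [1 / (i + 1)], and exhaust the subspheres up to null sets as
    [i] grows. *)
Lemma hausdorff_skel (A : set E) : measurable (A : set (borelE R d)) ->
  hausdorff_measure k (A `&` skel k (cells K (point : KS))) =
  (mass k Sref)%:E * \sum_(J in faceidx) mu J A.
Proof.
move=> mA; have [mE m0] := massE mu_refE.
have [a aK] := hyperspheres_normals d0 HK.
have sum_enum (F : {set 'I_n} -> \bar R) :
    \sum_(J in faceidx) F J = \sum_(J <- enum faceidx) F J by rewrite big_enum.
rewrite ge0_sume_distrr; last by move=> J _; exact: measure_ge0.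
have -> : \sum_(J in faceidx) (mass k Sref)%:E * mu J A =
    \sum_(J in faceidx) hausdorff_measure k (A `&` meetset J K).
  apply: eq_bigr => J Jd; rewrite -sset_meetJ//.
  by rewrite (hausdorff_great great_ref mu_refE)//; exact: great_meetJ.
apply/eqP; rewrite eq_le; apply/andP; split.
  rewrite sum_enum; apply: le_trans (hausdorff_measure_bigU_le _ _).
  apply: le_hausdorff_measure => x [Ax /(skel_sub_meetset d0 kd HK)[J /= Jd Jx]].
  rewrite -bigcup_seq; exists J => //=.
  by rewrite mem_enum inE Jd.
pose B (i : nat) (J : {set 'I_n}) : set E := A `&`
  [set x | forall j, j \notin J -> (i.+1%:R^-1 <= `|dotp (a j) x|)%R].
have mB i J : measurable (B i J : set (borelE R d)).
  apply: measurableI => //; apply: measurable_closedE.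
  have -> : [set x | forall j, j \notin J -> (i.+1%:R^-1 <= `|dotp (a j) x|)%R] =
      \bigcap_(j in [set j | j \notin J]) [set x | (i.+1%:R^-1 <= `|dotp (a j) x|)%R].
    by apply/seteqP; split => x /= H j; exact: H.
  apply: closed_bigI => j _.
  have -> : [set x | (i.+1%:R^-1 <= `|dotp (a j) x|)%R] =
    (fun x => `|dotp (a j) x|)%R @^-1` [set r | (i.+1%:R^-1 <= r)%R] by [].
  apply: preimage_closed; last exact: closed_ge.
  move=> x _; apply: (@continuous_comp E R R (dotp (a j)) Num.norm).
    exact: dotp_continuous.
  exact: norm_continuous.
have lim J : J \in faceidx -> (mu J \o (B ^~ J)) @ \oo --> mu J A.
  move=> Jd.
  have ndB : nondecreasing_seq (B ^~ J).
    move=> i i' ii'; rewrite subsetEset => x [Ax H]; split => // j jJ.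
    apply: le_trans (H j jJ); by rewrite lef_pV2 ?posrE// ler_nat.
  have mbig : measurable (\bigcup_i B i J : set (borelE R d)).
    exact: bigcupT_measurable.
  suff -> : mu J A = mu J (\bigcup_i B i J).
    exact: nondecreasing_cvg_mu.
  pose N : set E := \big[setU/set0]_(j | j \notin J) sset (K j).
  have mK j : measurable (sset (K j) : set (borelE R d)).
    by apply: measurable_closedE; exact: closed_sset.
  have [mN N0] : measurable (N : set (borelE R d)) /\ mu J N = 0.
    rewrite /N; elim/big_ind : _ => [|X Y [mX X0] [mY Y0]|j jJ].
    - by split => //; exact: measure0.
    - by split; [exact: measurableU|rewrite measureU0].
    - by split => //; exact: null_meet.
  have mM : measurable (meetset J K : set (borelE R d)).
    by rewrite -sset_meetJ//; apply: measurable_closedE; exact: closed_sset.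
  have AE : mu J A = mu J (A `&` meetset J K).
    have mAM : measurable (A `&` meetset J K : set (borelE R d)) by exact: measurableI.
    rewrite !(unifE great_ref mu_refE)//; [|exact: great_meetJ..].
    by rewrite /normalized_hausdorff sset_meetJ// -setIA setIid.
  apply/eqP; rewrite eq_le; apply/andP; split.
    rewrite AE -(measureU0 mbig mN N0); apply: le_measure; rewrite ?inE.
    - exact: measurableI.
    - exact: measurableU.
    - move=> x [Ax [sx xJ]]; have [Nx|Nx] := pselect (N x); first by right.
      left; have [e e0 eP] := small_delta (fun j => dotp (a j) x) (fun=> 1%R).
      have [i ie] := rad_small e0; exists i => //; split => // j jJ.
      have xj : dotp (a j) x != 0%R.
        apply/eqP => /(hyperE aK j sx) Kx; apply: Nx.
        by rewrite /N -bigcup_seq_cond; exists j => //=; rewrite mem_index_enum.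
      apply/ltW; apply: lt_trans ie _; have := eP j xj; by rewrite normr1 mulr1.
  by apply: le_measure; rewrite ?inE// => x [i _ []].
have step i : \sum_(J in faceidx) (mass k Sref)%:E * mu J (B i J) <=
    hausdorff_measure k (A `&` skel k (cells K (point : KS))).
  have -> : \sum_(J in faceidx) (mass k Sref)%:E * mu J (B i J) =
      \sum_(J <- enum faceidx) hausdorff_measure k (B i J `&` meetset J K).
    rewrite sum_enum; apply: eq_big_seq => J; rewrite mem_enum => Jd.
    rewrite -sset_meetJ// (hausdorff_great great_ref mu_refE)//.
    exact: great_meetJ.
  apply: le_trans (hausdorff_measure_bigU_ge (rad_gt0 R i) (enum_uniq _) _) _.
    move=> I J x y; rewrite !mem_enum !inE => /eqP Id /eqP Jd IJ [[_ Hx] [sx _]] [_ [sy yJ]].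
    (* Distinct sets of equal size are not nested. The hypersphere [j] passes through [y] but keeps
       away from [x]. *)
    have [j jJ jI] : exists2 j, j \in J & j \notin I.
      apply/fintype.subsetPn; apply: contraNN IJ => JI.
      by rewrite eq_sym eqEcard JI Id Jd /=.
    have ay : dotp (a j) y = 0%R by apply/(hyperE aK j sy)/yJ.
    apply: le_trans (Hx j jI) _; rewrite -[dotp (a j) x]subr0 -ay -dotpBr.
    by rewrite (le_trans (cauchy_schwarz _ _))// (_ : enorm (a j) = 1%R) ?mul1r//; have [] := aK j.
  apply: le_hausdorff_measure => x; rewrite -bigcup_seq => -[J /= Jd [[Ax Hx] Jx]].
  split => //; move: Jd; rewrite mem_enum => Jd.
  apply: (meetset_sub_skel d0 HK (great_meet Jd) Jx _ sz zoff) => j jJ Kx.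
  have sx : usphere x by case: Jx.
  have /(hyperE aK j sx) ax := Kx; have := Hx j jJ; rewrite ax normr0.
  by rewrite leNgt rad_gt0.
have cvgs : (fun i => \sum_(J in faceidx) (mass k Sref)%:E * mu J (B i J)) @ \oo -->
    \sum_(J in faceidx) (mass k Sref)%:E * mu J A.
  apply: cvg_nnesum => J Jd; last by apply: cvgeZl => //; exact: lim.
  by apply: nearW => i; rewrite mule_ge0// lee_fin ltW.
have <- : \sum_(J in faceidx) (mass k Sref)%:E * mu J A =
    \sum_(J in faceidx) hausdorff_measure k (A `&` meetset J K).
  apply: eq_bigr => J Jd; rewrite -sset_meetJ//.
  by rewrite (hausdorff_great great_ref mu_refE)//; exact: great_meetJ.
rewrite -(cvg_lim _ cvgs)//; apply: lime_le; last exact: nearW.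
by apply/cvg_ex; eexists; exact: cvgs.
Qed.

Lemma card_subsets_of_size : (d - k <= n)%N -> (0 < #|faceidx|)%N.
Proof.
move=> dkn; have [|I _ Id] := @subset_of_card 'I_n [set: 'I_n]%SET (d - k).
  by rewrite cardsT card_ord.
by apply/card_gt0P; exists I; rewrite inE Id.
Qed.

Lemma normalized_hausdorff_skel (A : set E) : (d - k <= n)%N ->
  measurable (A : set (borelE R d)) ->
  normalized_hausdorff k (skel k (cells K (point : KS))) A =
  \sum_(J in faceidx) (#|faceidx|%:R^-1)%:E * mu J A.
Proof.
move=> dkn mA; have [mE m0] := massE mu_refE.
have c0 : (0 < #|faceidx|%:R :> R)%R by rewrite ltr0n card_subsets_of_size.
rewrite /normalized_hausdorff hausdorff_skel//.
rewrite -[X in _ / hausdorff_measure k X]setTI hausdorff_skel; last exact: measurableT.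
have -> : \sum_(J in faceidx) mu J setT = (#|faceidx|%:R)%:E.
  under eq_bigr do rewrite unif_setT.
  by rewrite sumEFin sumr_const.
rewrite -EFinM inver mulf_eq0 !gt_eqF//= muleAC -EFinM invfM mulrA divff ?gt_eqF// mul1r.
by rewrite ge0_sume_distrr// => J _; exact: measure_ge0.
Qed.

End skeleton_measure.

(** * The sigma-algebra of a random tessellation *)

Section collections.
Variables (R : realType) (d : nat).
Notation E := 'rV[R]_d.+1.
Notation KS := (sbody R d).
Implicit Types (x y : E) (L : KS).

Section face_of_point.
Variables (Omega : pointedType) (T : Omega -> set (set E)).
Hypothesis finT : forall w, finite_set (T w).
Hypothesis bodyT : forall w X, T w X -> exists K : KS, X = sset K.

Definition collection_events : set (set Omega) :=
  [set [set w | exists2 K, B K & T w (sset K)]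
    | B in (measurable : set (set (borelK R d)))].

(* For [T w] a tessellation, this is the smallest face containing [x]. *)
Definition face_of_point w x : KS :=
  mkbody (\bigcap_(X in [set X | T w X /\ X x]) X).

Let ST := g_sigma_algebraType collection_events.

(** Membership of the point is approximated by hits of small balls around it. The converse rests on
    finiteness: if no member in [B] contains the point, one radius separates it from all of them. *)
Lemma measurable_collection_mem (B : set (borelK R d)) : measurable B ->
  measurable [set p : ST * borelE R d |
    exists2 K, B K & T p.1 (sset K) /\ sset K p.2].
Proof.
move=> mB.
have -> : [set p : ST * borelE R d | exists2 K, B K & T p.1 (sset K) /\ sset K p.2] =
    \bigcap_i \bigcup_q ([set w | exists2 K, (B `&` hits (q, i)) K & T w (sset K)]
      `*` rball (q, i)).
  apply/seteqP; split => [[w x] [K BK [TK Kx]] i _|[w x] H].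
    have [q qx] := rpoint_dense x (rad_gt0 R i).
    by exists q => //; split => //; exists K => //; split => //; exists x.
  apply: contrapT => nK.
  have [s sT] := (finite_seqP _).1 (finT w).
  have /choice[f fP] : forall X, exists i : nat, forall j, (i <= j)%N ->
      X \in s -> (exists2 K, B K & X = sset K) ->
      forall (q : 'rV[rat]_d.+1) y, X y -> rball (q, j) x -> rball (q, j) y -> False.
    move=> X; have [|nX] := pselect (exists K, [/\ X \in s, B K & X = sset K]); last first.
      by exists 0%N => j _ Xs [K BK XK]; exfalso; apply: nX; exists K.
    move=> [K [Xs BK XK]].
    have Kx : ~ sset K x.
      by move=> Kx; apply: nK; exists K => //; split => //; rewrite -XK sT.
    have /nbhs_ballP[e /= e0 eK] : nbhs x (~` sset K).
      apply: open_nbhs_nbhs; split => //; apply: closed_openC.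
      exact: closed_sset.
    have [i ie] := @rad_small R (e / 2) (divr_gt0 e0 (ltr0n _ 2)).
    exists i => j ij _ _ q y Xy qx qy.
    have je : j.+1%:R^-1 < e / 2.
      by apply: le_lt_trans ie; rewrite lef_pV2 ?posrE// ler_nat.
    apply: (eK y); last by rewrite -XK.
    rewrite -ball_normE /= -(subrK (rpoint R q) x) -addrA.
    rewrite (le_lt_trans (ler_normD _ _))// distrC (splitr e) ltrD//.
      exact: lt_trans qx je.
    exact: lt_trans qy je.
  pose i := (\max_(X <- s) f X)%N.
  have [q _ [/= [K [BK [y [Ky qy]]] TK] qx]] := H i I.
  have Ks : sset K \in s by have : [set` s] (sset K) by rewrite -sT.
  by apply: (fP (sset K) i) Ky qx qy => //; [exact: leq_bigmax_seq|exists K].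
apply: bigcapT_measurable => i; apply: bigcup_countType_measurable => q.
apply: measurableX; last exact: measurable_rball.
apply: sub_sigma_algebra; exists (B `&` hits (q, i)) => //.
by apply: measurableI => //; exact: measurable_hits.
Qed.

Let covered : set (ST * borelE R d) := [set p | exists2 X, T p.1 X & X p.2].

Lemma sset_face_of_point w x : (exists2 X, T w X & X x) ->
  sset (face_of_point w x) = \bigcap_(X in [set X | T w X /\ X x]) X.
Proof.
move=> [X0 TX0 X0x]; apply: mkbodyK.
pose J := {K : KS | T w (sset K) /\ sset K x}.
have -> : \bigcap_(X in [set X | T w X /\ X x]) X = \bigcap_(j : J) sset (sval j).
  apply/seteqP; split => y.
    by move=> H [K [TK Kx]] _ /=; exact: H.
  move=> H X [TX Xx]; have [K XK] := bodyT TX.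
  have KP : T w (sset K) /\ sset K x by rewrite -XK.
  by rewrite XK; exact: (H (exist _ K KP) I).
have [K0 XK0] := bodyT TX0.
have K0P : T w (sset K0) /\ sset K0 x by rewrite -XK0.
apply: spherical_convexI; first exact: (inhabits (exist _ K0 K0P)).
  by move=> j; exact: sbodyP.
by exists x => -[K [TK Kx]] _.
Qed.

Lemma face_of_point_out w x : ~ (exists2 X, T w X & X x) ->
  face_of_point w x = point.
Proof.
move=> H; apply: mkbody_out => -[C [_ _ HC]].
have : [set: E] 0 by [].
have <- : \bigcap_(X in [set X | T w X /\ X x]) X = setT.
  by apply/seteqP; split => // y _ X [TX Xx]; exfalso; apply: H; exists X.
by rewrite HC => -[_]; exact: usphere0.
Qed.

(** [N i p q] asks every member containing the point to hit the ball. It fails iff some member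
    containing the point misses the ball, and this is an event of [measurable_collection_mem]. *)
Lemma measurable_face_of_point :
  measurable_fun setT (fun p : ST * borelE R d => face_of_point p.1 p.2 : borelK R d).
Proof.
have mD : measurable covered.
  have := measurable_collection_mem (@measurableT _ (borelK R d)).
  congr (measurable _); apply/seteqP; split => p.
    by move=> [K _ [TK Kp]]; exists (sset K).
  by move=> [X TX Xp]; have [K XK] := bodyT TX; exists K => //; rewrite -XK.
pose F (p : ST * borelE R d) : set E := \bigcap_(X in [set X | T p.1 X /\ X p.2]) X.
pose N i (p : ST * borelE R d) q := forall X, T p.1 X -> X p.2 ->
  X `&` rball (q, i) !=set0.
apply: (@measurable_fun_compact_hits R d _ (ST * borelE R d)%type covered F _ point) => //.
- by move=> p; exact: sset_face_of_point.
- by move=> p; exact: face_of_point_out.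
move=> C cC.
apply: (@measurable_hits_compact R d _ (ST * borelE R d)%type covered F N C) => //.
- move=> i j p q _ ij H X TX Xp; have [y [Xy qy]] := H X TX Xp.
  exists y; split => //; move: qy; rewrite /rball /= => /lt_le_trans; apply.
  by rewrite lef_pV2 ?posrE// ler_nat.
- by move=> i p y q _ Fy qy X TX Xp; exists y; split => //; exact: Fy.
- move=> p y _ _ H X [TX Xp]; have [K XK] := bodyT TX.
  rewrite XK; apply: closed_approx; first exact: closed_sset.
  move=> i; have [q [qy Nq]] := H i; exists q; split => //.
  by rewrite -XK; exact: Nq.
- move=> i q.
  have -> : covered `&` [set p | N i p q] = covered `\`
      [set p | exists2 K, (~` hits (q, i)) K & T p.1 (sset K) /\ sset K p.2].
    apply/seteqP; split => p [Dp H]; split => //.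
      by move=> [K Kq [TK Kp]]; apply: Kq; exact: H.
    move=> X TX Xp; apply: contrapT => Xq; have [K XK] := bodyT TX.
    by apply: H; exists K; rewrite -?XK// /hits /= -XK.
  apply: measurableD => //; apply: measurable_collection_mem.
  by apply: measurableC; exact: measurable_hits.
Qed.

End face_of_point.

Section cell_collections.
Context (disp : measure_display) (Omega : measurableType disp).
Variables (n : nat) (S : Omega -> hfam R d n) (L : KS).
Hypothesis d0 : (0 < d)%N.
Hypothesis mS : measurable_fun setT S.
Hypothesis HS : forall w, hyperspheres (S w).

Lemma cells_body w X : cells (S w) L X -> exists K : KS, X = sset K.
Proof.
move=> [q [Lq qoff] <-]; exists (cell (S w) L q).
by rewrite (sset_cell d0 (HS w) Lq).
Qed.

Lemma measurable_off (q : E) : measurable [set K : hfam R d n | off K q].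
Proof.
have -> : [set K : hfam R d n | off K q] =
    \bigcap_j [set K : hfam R d n | ~ sset (K j) q].
  by apply/seteqP; split => K H j; [move=> _; exact: H|exact: (H j I)].
apply: bigcap_countType_measurable => j.
have mj : measurable_fun setT (fun K : hfam R d n => (K j : borelK R d, q : borelE R d)).
  apply: measurable_fun_pair; first exact: measurable_proj.
  exact: measurable_cst.
have := mj measurableT _ (measurableC (@measurable_mem R d)).
by rewrite setTI.
Qed.

(** Every cell contains a neighbourhood in [L] of its generating point, hence one of the countably
    many points [pt b]; the cell of a fixed point depends measurably on the hyperspheres. *)
Lemma measurable_cells_event (B : set (borelK R d)) : measurable B ->
  measurable [set w | exists2 K, B K & cells (S w) L (sset K)].
Proof.
(* [pt b] is 0 when the ball misses [L]; the test [sset L (pt b)] discards this case, since 0 is not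
   on the sphere. *)
move=> mB; pose pt b := xget (0 : E) (sset L `&` rball b).
have -> : [set w | exists2 K, B K & cells (S w) L (sset K)] =
    \bigcup_b (if `[< sset L (pt b) >] then
       S @^-1` [set K | off K (pt b) /\ B (cell K L (pt b))] else set0).
  apply/seteqP; split => w.
    move=> [K BK [q [Lq qoff] qK]]; have [a aK] := hyperspheres_normals d0 (HS w).
    have sq := sset_sphere Lq; have q0 := (offE aK sq).1 qoff.
    pose O : set E := [set y | forall j, 0 < dotp (a j) q * dotp (a j) y].
    have oO : open O.
      have -> : O = ~` \bigcup_j [set y | 0 <= dotp (- dotp (a j) q *: a j) y].
        apply/seteqP; split => y.
          by move=> H [j _]; rewrite /= dotpZl mulNr oppr_ge0 leNgt H.
        move=> H j; rewrite ltNge; apply/negP => Hj; apply: H; exists j => //=.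
        by rewrite dotpZl mulNr oppr_ge0.
      apply: closed_openC.
      have -> : \bigcup_j [set y | 0 <= dotp (- dotp (a j) q *: a j) y] =
          \big[setU/set0]_(j <- enum 'I_n) [set y | 0 <= dotp (- dotp (a j) q *: a j) y].
        rewrite -bigcup_seq; apply/seteqP; split => y [j _ jy]; exists j => //.
        by rewrite /= mem_enum.
      apply: closed_bigsetU => j _.
      by have [] := halfspace_cone (- dotp (a j) q *: a j).
    have Oq : O q by move=> j; rewrite lt_neqAle eq_sym mulf_neq0//= -expr2 sqr_ge0.
    have [b [bq bO]] := open_rball_sub oO Oq.
    have [Lp bp] : (sset L `&` rball b) (pt b).
      by rewrite /pt; case: xgetP => [//|/(_ q)[]]; split.
    have poff : off (S w) (pt b).
      apply/(offE aK (sset_sphere Lp)) => j.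
      by have := bO _ bp j; apply: contraTneq => ->; rewrite mulr0 ltxx.
    exists b => //; case: asboolP => // _; split => //.
    suff -> : cell (S w) L (pt b) = K by [].
    apply: sset_inj; rewrite (sset_cell d0 (HS w) Lp) -qK; apply/esym.
    apply: (cellset_swap aK qoff poff sq (sset_sphere Lp)).
    by apply/(cellsetE aK); split => // j; apply/ltW/bO.
  move=> [b _]; case: asboolP => // Lp [poff BK].
  exists (cell (S w) L (pt b)) => //; exists (pt b) => //.
  by rewrite (sset_cell d0 (HS w) Lp).
apply: bigcup_countType_measurable => b; case: asboolP => // Lp.
rewrite -[X in measurable X]setTI; apply: mS => //.
have mc : measurable_fun setT (fun K : hfam R d n => cell K L (pt b) : borelK R d).
  have mp : measurable_fun setT (fun K : hfam R d n =>
      ((K, L : borelK R d), pt b : borelE R d)).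
    apply: measurable_fun_pair; last exact: measurable_cst.
    by apply: measurable_fun_pair; [exact: measurable_id|exact: measurable_cst].
  exact: (measurableT_comp (@measurable_cell R d n d0) mp).
apply: measurableI; first exact: measurable_off.
by have := mc measurableT _ mB; rewrite setTI.
Qed.

End cell_collections.

End collections.

(** * Integration off null sets and disintegration *)

Section null_sets.
Context (disp : measure_display) (T : measurableType disp) (R : realType)
  (mu : {measure set T -> \bar R}).
Local Open Scope ereal_scope.
Import HBNNSimple.

(** Both integrals are suprema over simple functions. A simple function below [f], set to 0 on [N],
    lies below [g] and has the same integral. *)
Let ge0_le_integral_off (N : set T) (f g : T -> \bar R) : measurable N ->
  mu N = 0 -> (forall x, 0 <= f x) -> (forall x, 0 <= g x) ->
  (forall x, ~ N x -> f x = g x) -> \int[mu]_x f x <= \int[mu]_x g x.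
Proof.
move=> mN N0 f0 g0 fg; rewrite ge0_integralTE// [leRHS]ge0_integralTE//.
apply: ge_ereal_sup => _ [h hf <-].
pose h' := proj_nnsfun h (measurableC mN).
have h'E x : h' x = (h x * \1_(~` N) x)%R by [].
have -> : sintegral mu h = sintegral mu h'.
  rewrite -!integralT_nnsfun; apply: ae_eq_integral => //.
  - exact/measurable_EFinP/measurable_funP.
  - exact/measurable_EFinP/measurable_funP.
  exists N; split => // x /= H; apply: contrapT => Nx; apply: H => _.
  have hx : h x = h' x by rewrite h'E indicE mem_set// mulr1.
  exact: (congr1 EFin hx).
apply: ereal_sup_ubound; exists h' => // x; rewrite h'E indicE.
have [Nx|Nx] := pselect (N x).
  by rewrite memNset ?mulr0//; apply.
by rewrite mem_set// mulr1 -fg.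
Qed.

(* The library's [ae_eq_integral] needs both functions to be measurable. *)
Lemma ge0_eq_integral_off (N : set T) (f g : T -> \bar R) : measurable N ->
  mu N = 0 -> (forall x, 0 <= f x) -> (forall x, 0 <= g x) ->
  (forall x, ~ N x -> f x = g x) -> \int[mu]_x f x = \int[mu]_x g x.
Proof.
move=> mN N0 f0 g0 fg; apply/eqP; rewrite eq_le.
rewrite (ge0_le_integral_off mN)// (ge0_le_integral_off mN)//.
by move=> x /fg.
Qed.

End null_sets.

Section kernel_pullback.
Context d1 d2 d3 (X' : measurableType d1) (X : measurableType d2)
  (Y : measurableType d3) (R : realType).
Variables (k : R.-pker X ~> Y) (f : X' -> X).

(** The proof of measurability is an argument so that the kernel structures below can be attached to
    [kpull mf]. *)
Definition kpull (mf : measurable_fun setT f) (x : X') : {measure set Y -> \bar R} :=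
  k (f x).

Variable mf : measurable_fun setT f.

Let measurable_kpull U : measurable U -> measurable_fun setT (kpull mf ^~ U).
Proof.
by move=> mU; exact: (measurableT_comp (measurable_kernel k U mU) mf).
Qed.

HB.instance Definition _ :=
  isKernel.Build _ _ X' Y R (kpull mf) measurable_kpull.

Let kpull_setT x : kpull mf x setT = 1%E.
Proof. exact: prob_kernel. Qed.

HB.instance Definition _ :=
  Kernel_isProbability.Build _ _ X' Y R (kpull mf) kpull_setT.

End kernel_pullback.

Section disintegration.
Context d1 d2 (Omega : measurableType d1) (Y : measurableType d2) (R : realType).
Variables (P : probability Omega R) (X : {mfun Omega >-> Y}).
Variables (G : set (set Omega)) (I : Type) (s : seq I) (c : R).
Variable (k : I -> R.-pker Omega ~> Y).
Local Open Scope ereal_scope.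
Hypothesis c0 : (0 <= c)%R.
Hypothesis GM : <<s G >> `<=` measurable.
Hypothesis HX : forall H A, <<s G >> H -> measurable A ->
  P (H `&` X @^-1` A) = \sum_(i <- s) c%:E * \int[P]_(w in H) k i w A.

Let ST := g_sigma_algebraType G.

Let kM (i : I) (M : set (Omega * Y)) w := k i w [set y | M (w, y)].

Let kMx i M w : kM i M w = k i w (xsection M w).
Proof. by rewrite /kM xsectionE. Qed.

Let mkM i (M : set (Omega * Y)) : measurable M -> measurable_fun setT (kM i M).
Proof.
move=> mM; rewrite (_ : kM i M = fun w => k i w (xsection M w)).
  by apply: measurable_fun_xsection_finite_kernel; rewrite inE.
by apply/funext => w; exact: kMx.
Qed.

Let kM0 i M w : 0 <= kM i M w.
Proof. by rewrite kMx measure_ge0. Qed.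

Let slice (M : set (Omega * Y)) w : set Y := [set y | M (w, y)].

Let mslice M w : measurable M -> measurable (slice M w).
Proof.
move=> mM; have -> : slice M w = xsection M w by rewrite xsectionE.
exact: measurable_xsection.
Qed.

Let mXM (M : set (Omega * Y)) : measurable M -> measurable [set w | M (w, X w)].
Proof.
move=> mM; have mp : measurable_fun setT (fun w => (w, X w)).
  by apply: measurable_fun_pair.
by have := mp measurableT _ mM; rewrite setTI.
Qed.

(** Dynkin's argument, starting from rectangles. The hypothesis [HX] covers only events generated by
    [G], so [M] is taken in the product with [ST], although the kernels are measurable on [Omega]
    only. A finite mixture of kernels is allowed because a point of the skeleton is a mixture of
    points of subspheres. *)
Lemma disintegration (M : set (ST * Y)) : measurable M ->
  measurable (M : set (Omega * Y)) /\
  P [set w | M (w, X w)] =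
  \sum_(i <- s) c%:E * \int[P]_w k i w [set y | M (w, y)].
Proof.
pose Q (M : set (Omega * Y)) := measurable M /\
  P [set w | M (w, X w)] = \sum_(i <- s) c%:E * \int[P]_w kM i M w.
have QT : Q setT.
  split => //; have := HX (@measurableT _ ST) measurableT.
  by rewrite preimage_setT setTI.
have mT : @measurable _ (ST * Y)%type =
    <<s [set A `*` B | A in @measurable _ ST & B in @measurable _ Y] >>.
  exact: measurable_prod_measurableType.
move=> mM; change (Q M); move: mM; rewrite mT; move: M.
apply: (@dynkin_induction _ (ST * Y)%type _ Q mT) => //.
- move=> _ _ [A mA [B mB <-]] [A' mA' [B' mB' <-]].
  exists (A `&` A'); first exact: measurableI.
  exists (B `&` B'); first exact: measurableI.
  by rewrite setXI.
- move=> _ [A mA [B mB <-]]; split; first by apply: measurableX => //; exact: GM.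
  rewrite (_ : [set w | _] = A `&` X @^-1` B)// HX//.
  apply: eq_bigr => i _; congr (_ * _).
  rewrite integral_mkcond; apply: eq_integral => w _.
  rewrite /kM /patch; case: ifPn => [/set_mem Aw|/negP Aw].
    by congr (k i w _); apply/seteqP; split => y /= => [?|[]].
  rewrite (_ : [set y | _] = set0) ?measure0//.
  by apply/seteqP; split => y //= -[/mem_set].
- move=> M _ [mM PM]; split; first exact: measurableC.
  have sum1 : (\sum_(i <- s) c%:E * \int[P]_w kM i (~` M) w) +
     (\sum_(i <- s) c%:E * \int[P]_w kM i M w) = 1.
    rewrite -(probability_setT P) [RHS]QT.2 -big_split.
    apply: eq_bigr => i _ /=.
    rewrite -ge0_muleDr; [|exact: integral_ge0..]; congr (_ * _).
    rewrite -ge0_integralD//; [|by apply: mkM; exact: measurableC|exact: mkM].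
    apply: eq_integral => w _; have mw := mslice w mM.
    rewrite (_ : kM i (~` M) w = k i w (~` slice M w))//.
    rewrite (_ : kM i M w = k i w (slice M w))//.
    rewrite -measureU//; [|exact: measurableC|by rewrite setICl].
    by congr (k i w _); rewrite setUC setUv.
  have PC : P [set w | (~` M) (w, X w)] = 1 - P [set w | M (w, X w)].
    by rewrite -probability_setC//; exact: mXM.
  rewrite PC -sum1 -PM addeK// fin_num_measure//; exact: mXM.
- move=> F mF tF QF; have mF' n : measurable (F n : set (Omega * Y)) by have [] := QF n.
  split; first exact: bigcupT_measurable.
  rewrite (_ : [set w | _] = \bigcup_n [set w | F n (w, X w)])//.
  rewrite measure_bigcup//; last 2 first.
  + by move=> n _; exact: mXM.
  + move=> i j _ _ [w [Fi Fj]]; apply: (tF i j) => //; by exists (w, X w).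
  have -> : \sum_(0 <= n <oo | n \in setT) P [set w | F n (w, X w)] =
      \sum_(0 <= n <oo) \sum_(i <- s) c%:E * \int[P]_w kM i (F n) w.
    rewrite (eq_eseriesl (Q := xpredT)); last by move=> n; rewrite in_setT.
    by apply: eq_eseriesr => n _; have [] := QF n.
  rewrite nneseries_sum; last first.
    by move=> i n _; rewrite mule_ge0// integral_ge0.
  apply: eq_bigr => i _; rewrite nneseriesZl; last by move=> n _; exact: integral_ge0.
  congr (_ * _); rewrite -integral_nneseries//; last by move=> n; exact: mkM.
  apply: eq_integral => w _.
  rewrite (_ : kM i (\bigcup_n F n) w = k i w (\bigcup_n slice (F n) w))//.
  rewrite measure_bigcup//.
  + by apply: eq_eseriesl => n; rewrite in_setT.
  + by move=> n _; exact: mslice.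
  + by move=> n m _ _ [y [Fn Fm]]; apply: (tF n m) => //; exists (w, y).
Qed.

End disintegration.
Section probability_of_measure.
Context (disp : measure_display) (T : measurableType disp) (R : realType).
Variables (m : {measure set T -> \bar R}) (m1 : m setT = 1%E).

Definition probability_of of m setT = 1%E : set T -> \bar R := m.
Notation p := (probability_of m1).

Let p0 : p set0 = 0%E. Proof. exact: measure0. Qed.
Let p_ge0 A : (0 <= p A)%E. Proof. exact: measure_ge0. Qed.
Let p_sigma : semi_sigma_additive p. Proof. exact: measure_semi_sigma_additive. Qed.
HB.instance Definition _ := isMeasure.Build _ _ _ p p0 p_ge0 p_sigma.
HB.instance Definition _ := Measure_isProbability.Build _ _ _ p m1.

Lemma measure_probability : exists P : probability T R, forall A, P A = m A.
Proof. by exists p. Qed.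
End probability_of_measure.

Section almost_everywhere_equal.
Context (disp : measure_display) (T : measurableType disp) (R : realType)
  (mu : {measure set T -> \bar R}).

Let le_measure_ae (A B : set T) : measurable A -> measurable B ->
  {ae mu, forall x, A x <-> B x} -> (mu A <= mu B)%E.
Proof.
move=> mA mB [N [mN N0 NP]].
have -> : mu B = (mu B + mu N)%E by rewrite N0 adde0.
apply: (le_trans _ (measureU2 mu mB mN)).
apply: le_measure; rewrite ?inE//; first exact: measurableU.
move=> x Ax; have [AB|AB] := pselect (A x <-> B x); first by left; exact/AB.
by right; exact: NP.
Qed.

Lemma ae_eq_measure (A B : set T) : measurable A -> measurable B ->
  {ae mu, forall x, A x <-> B x} -> mu A = mu B.
Proof.
move=> mA mB AB; apply/eqP; rewrite eq_le !le_measure_ae//.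
by case: AB => N [mN N0 NP]; exists N; split => // x H; apply: NP => /= -[AB BA]; apply: H; split.
Qed.

End almost_everywhere_equal.

(** * Independent hyperspheres *)

Lemma pushforward_law (R : realType) (d1 d2 : measure_display)
    (X : measurableType d1) (Y : measurableType d2) (P : probability X R)
    (f : X -> Y) : measurable_fun setT f -> exists la : probability Y R,
  (forall M, la M = P (f @^-1` M)) /\
  forall g : Y -> \bar R, measurable_fun setT g -> (forall y, 0 <= g y)%E ->
    (\int[la]_y g y = \int[P]_x g (f x))%E.
Proof.
move=> mf; pose F : {mfun X >-> Y} := HB.pack f (isMeasurableFun.Build _ _ _ _ f mf).
exists (distribution P F); split => // g mg g0.
by rewrite (ge0_integral_distribution F mg g0).
Qed.

Section iid_laws.
Variables (R : realType) (d : nat).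
Notation KS := (sbody R d).
Variable kappa : probability (borelK R d) R.
Local Open Scope ereal_scope.

Definition iid_law n (la : set (hfam R d n) -> \bar R) :=
  forall B : 'I_n -> set (borelK R d), (forall i, measurable (B i)) ->
    la (rect B) = \prod_(i < n) kappa (B i).

Lemma iid_law_unique n (la la' : {measure set (hfam R d n) -> \bar R}) :
  iid_law la -> iid_law la' -> forall M, measurable M -> la M = la' M.
Proof.
move=> Hla Hla'.
apply: (@measure_unique _ R (hfam R d n) (@rects R d n) (fun=> setT)) => //.
- exact: rects_setI.
- by move=> _; exists (fun=> setT) => //; apply/seteqP; split.
- by apply/seteqP; split => // K _; exists 0%N.
- by move=> _ [B mB <-]; rewrite Hla// Hla'.
move=> _; have -> : [set: hfam R d n] = rect (fun=> [set: KS]) by apply/seteqP; split.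
rewrite Hla// big1 ?ltry// => i _; exact: probability_setT.
Qed.

Lemma iid_law_proj n (la : set (hfam R d n) -> \bar R) (j : 'I_n)
    (B : set (borelK R d)) :
  iid_law la -> measurable B -> la [set K : hfam R d n | B (K j)] = kappa B.
Proof.
move=> Hla mB.
have -> : [set K : hfam R d n | B (K j)] = rect (fun i => if i == j then B else setT).
  apply/seteqP; split => K /=; first by move=> KB i; case: eqP => [->|].
  by move=> /(_ j); rewrite eqxx.
rewrite Hla; last by move=> i; case: ifP.
rewrite (bigD1 j)//= eqxx big1 ?mule1// => i /negbTE ->.
exact: probability_setT.
Qed.

Lemma iid_law_comp n m (f : 'I_m -> 'I_n) (la : set (hfam R d n) -> \bar R) :
  injective f -> iid_law la -> iid_law (fun M => la [set K : hfam R d n | M (K \o f)]).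
Proof.
move=> fI Hla B mB.
pose B' j := if [pick i | f i == j] is Some i then B i else setT.
have B'f i : B' (f i) = B i.
  rewrite /B'; case: pickP => [i' /eqP/fI ->//|/(_ i)].
  by rewrite eqxx.
have -> : [set K : hfam R d n | rect B (K \o f)] = rect B'.
  apply/seteqP; split => K /= KB j; last by rewrite -B'f; exact: KB.
  by rewrite /B'; case: pickP => // i /eqP <-; exact: KB.
rewrite Hla; last by move=> j; rewrite /B'; case: pickP.
rewrite (bigID (mem (f @: 'I_m)%SET))/= big_imset/=; last by move=> i i' _ _ /fI.
rewrite [X in _ * X]big1 ?mule1.
  by apply: eq_bigr => i _; rewrite B'f.
move=> j jf; rewrite /B'; case: pickP => [i /eqP ij|_]; last exact: probability_setT.
by exfalso; move/negP: jf; apply; apply/imsetP; exists i.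
Qed.

Definition merge n (J : {set 'I_n}) (K K' : 'I_n -> KS) : 'I_n -> KS :=
  fun i => if i \in J then K i else K' i.

Lemma measurable_merge n (J : {set 'I_n}) : measurable_fun setT
  (fun p : hfam R d n * hfam R d n => merge J p.1 p.2 : hfam R d n).
Proof.
apply: measurable_fun_hfam => i; rewrite /merge; case: (i \in J).
  exact: (measurableT_comp (measurable_proj i) measurable_fst).
exact: (measurableT_comp (measurable_proj i) measurable_snd).
Qed.

(* Resampling the coordinates outside [J] does not change the law. *)
Lemma iid_law_merge n (J : {set 'I_n}) (la : probability (hfam R d n) R)
    (f : hfam R d n -> \bar R) : iid_law la -> measurable_fun setT f ->
  (forall K, 0 <= f K) ->
  \int[la]_K f K = \int[la]_K \int[la]_K' f (merge J K K').
Proof.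
move=> Hla mf f0.
have [la' [la'E la'I]] := pushforward_law (la \x la) (measurable_merge J).
have fm0 p : 0 <= f (merge J p.1 p.2) by [].
have mfm : measurable_fun setT (fun p : hfam R d n * hfam R d n => f (merge J p.1 p.2)).
  exact: (measurableT_comp mf (measurable_merge J)).
transitivity (\int[la \x la]_p f (merge J p.1 p.2)); last first.
  exact: (fubini_tonelli1 _ mfm).
rewrite -la'I//; apply: eq_measure_integral => M mM _.
apply: (iid_law_unique Hla) => // B mB; apply: (eq_trans (la'E _)).
pose BJ i := if i \in J then B i else setT.
pose BC i := if i \in J then setT else B i.
have -> : (fun p => merge J p.1 p.2) @^-1` rect B = rect BJ `*` rect BC.
  apply/seteqP; split => -[K K'] /=.
    move=> H; split => i; have := H i; rewrite /merge /BJ /BC; case: ifP => //.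
  by move=> [H H'] i; have := H i; have := H' i; rewrite /merge /BJ /BC; case: ifP.
have mBJ i : measurable (BJ i : set (borelK R d)) by rewrite /BJ; case: ifP.
have mBC i : measurable (BC i : set (borelK R d)) by rewrite /BC; case: ifP.
apply: (eq_trans (@product_measure1E _ _ _ _ _ la la _ _ (measurable_rect mBJ) (measurable_rect mBC))).
transitivity ((\prod_(i < n) kappa (BJ i)) * \prod_(i < n) kappa (BC i)).
  by congr (_ * _); exact: Hla.
rewrite -big_split/=; apply: eq_bigr => i _; rewrite /BJ /BC.
by case: ifP => _; rewrite probability_setT ?mule1 ?mul1e.
Qed.

(* If every section of [N] is [kappa]-null then, for [j] outside [J], so is the
   event that [meet J K] and [K j] are related by [N]. *)
Lemma meet_independent_null n (J : {set 'I_n}) (j : 'I_n)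
    (la : probability (hfam R d n) R) (N : set (borelK R d * borelK R d)) :
  iid_law la -> j \notin J -> measurable N ->
  (forall L, kappa [set K | N (L, K)] = 0) ->
  la [set K : hfam R d n | N (meet J K, K j)] = 0.
Proof.
move=> Hla jJ mN N0.
have mM : measurable [set K : hfam R d n | N (meet J K, K j)].
  have mp : measurable_fun setT (fun K : hfam R d n => (meet J K : borelK R d, K j : borelK R d)).
    by apply: measurable_fun_pair; [exact: measurable_meet|exact: measurable_proj].
  by have := mp measurableT _ mN; rewrite setTI.
rewrite -[LHS]mul1e -integral_cst// integral_mkcond.
have patchE (K : hfam R d n) : (cst 1 \_ [set K | N (meet J K, K j)]) K =
    (\1_[set K | N (meet J K, K j)] K : R)%:E.
  by rewrite patchE indicE; case: ifP.
under eq_integral do rewrite patchE.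
rewrite (iid_law_merge J)//; first last.
  by apply/measurable_EFinP; exact: measurable_indic.
apply: integral0_eq => K _.
rewrite (_ : (fun K' => _) = EFin \o \1_[set K' | N (meet J K, K' j)]).
  rewrite integral_indic// ?setIT.
    have mNK : measurable [set L | N (meet J K, L)].
      have -> : [set L | N (meet J K, L)] = xsection N (meet J K) by rewrite xsectionE.
      exact: measurable_xsection.
    by rewrite (@iid_law_proj _ _ j [set L | N (meet J K, L)]).
  have mNK : measurable [set L | N (meet J K, L)].
    have -> : [set L | N (meet J K, L)] = xsection N (meet J K) by rewrite xsectionE.
    exact: measurable_xsection.
  by have := measurable_proj j measurableT mNK; rewrite setTI.
have mergeE K' : meet J (merge J K K') = meet J K.
  congr mkbody; apply/seteqP; split => y [sy H]; split => // i iJ;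
    by have := H i iJ; rewrite /merge iJ.
have NE K' : N (meet J (merge J K K'), merge J K K' j) = N (meet J K, K' j).
  by rewrite mergeE /merge (negbTE jJ).
apply/funext => K' /=; rewrite !indicE.
by have [H|H] := pselect (N (meet J K, K' j));
  [rewrite !mem_set//= NE|rewrite !memNset//= NE].
Qed.

End iid_laws.

Lemma negligible_bigcup_countType (disp : measure_display) (T : measurableType disp)
    (R : realType) (mu : {measure set T -> \bar R}) (I : countType) (F : I -> set T) :
  (forall i, mu.-negligible (F i)) -> mu.-negligible (\bigcup_i F i).
Proof.
move=> F0; have -> : \bigcup_i F i = \bigcup_n (oapp F set0 (unpickle n)).
  apply/seteqP; split => x [].
    by move=> i _ Fix; exists (pickle i) => //; rewrite pickleK.
  by move=> n _; case: (unpickle n) => //= i Fix; exists i.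
apply: negligible_bigcup => n; case: (unpickle n) => //=.
exact: negligible_set0.
Qed.

(** * General position *)

Section general_position.
Variables (R : realType) (d : nat).
Notation E := 'rV[R]_d.+1.
Notation KS := (sbody R d).
Variable kappa : probability (borelK R d) R.
Hypothesis d0 : (0 < d)%N.
Hypothesis Hkappa : nondegenerate_directional_distribution kappa.
Local Open Scope ereal_scope.

Lemma measurable_through (x : E) : measurable [set K : borelK R d | sset K x].
Proof.
have -> : [set K : borelK R d | sset K x] =
    ysection [set p : borelK R d * borelE R d | sset p.1 p.2] x.
  by rewrite ysectionE.
by apply: measurable_ysection; exact: measurable_mem.
Qed.

(** By duality, the great hyperspheres through [x] have their normals on the great hypersphere
    orthogonal to [x], which is [kappa0]-null. *)
Lemma kappa_through (x : E) : usphere x -> kappa [set K | sset K x] = 0.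
Proof.
have [kappa0 [_ _ k0 kE]] := Hkappa => sx.
rewrite kE; last exact: measurable_through.
rewrite (_ : [set u | _] = perp x `&` usphere).
  by apply: k0; apply: perp_great_subsphere => //; exact: usphere_neq0.
apply/seteqP; split => u.
  move=> [su [K Kx KE]]; split => //.
  by have : sset K x := Kx; rewrite KE /perp /= dotpC => -[].
move=> [ux su]; split => //.
have gu : great_subsphere d.-1 (perp u `&` usphere).
  by apply: perp_great_subsphere => //; exact: usphere_neq0.
exists (mkbody (perp u `&` usphere)); rewrite /= mkbodyK//.
- by split; rewrite // /perp /= dotpC.
- exact: great_subsphere_convex gu.
- exact: great_subsphere_convex gu.
Qed.

Lemma kappa_great : kappa [set K | great_subsphere d.-1 (sset K)] = 1.
Proof.
have [kappa0 [k1 _ k0 kE]] := Hkappa.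
rewrite kE; last exact: measurable_great_subsphere.
rewrite -[RHS]k1; congr (kappa0 _); apply/seteqP; split => [u []//|u su].
have gu : great_subsphere d.-1 (perp u `&` usphere).
  by apply: perp_great_subsphere => //; exact: usphere_neq0.
split => //; exists (mkbody (perp u `&` usphere)).
  by rewrite /= mkbodyK//; exact: great_subsphere_convex gu.
by rewrite mkbodyK//; exact: great_subsphere_convex gu.
Qed.

Lemma kappa_incl (L : KS) : kappa [set K | sset L `<=` sset K] = 0.
Proof.
have [x Lx] := sset_nonempty L.
apply/eqP; rewrite eq_le measure_ge0 andbT.
rewrite -(kappa_through (sset_sphere Lx)); apply: le_measure; rewrite ?inE.
- have -> : [set K : borelK R d | sset L `<=` sset K] =
    xsection [set p : borelK R d * borelK R d | sset p.1 `<=` sset p.2] L.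
    by rewrite xsectionE.
  by apply: measurable_xsection; exact: measurable_incl.
- exact: measurable_through.
- by move=> K; exact.
Qed.

Variable n : nat.
Variable la : probability (hfam R d n) R.
Hypothesis Hla : iid_law kappa la.

Lemma ae_hyperspheres : {ae la, forall K : hfam R d n, hyperspheres K}.
Proof.
apply/negligibleP; first by apply: measurableC; exact: measurable_hyperspheres.
apply: (eq_trans (probability_setC la (@measurable_hyperspheres R d n))).
have -> : [set K : hfam R d n | hyperspheres K] =
  rect (fun=> [set L | great_subsphere d.-1 (sset L)]) by [].
rewrite Hla; last by move=> i; exact: measurable_great_subsphere.
by rewrite big1 ?subee// => i _; exact: kappa_great.
Qed.

Lemma ae_off x : usphere x -> {ae la, forall K : hfam R d n, off K x}.
Proof.
move=> sx; apply/negligibleP; first by apply: measurableC; exact: measurable_off.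
apply: measure_negligible; first by apply: measurableC; exact: measurable_off.
apply: (@negligibleS _ _ _ _ (\bigcup_j [set K : hfam R d n | sset (K j) x])).
  move=> K /= H; apply: contrapT => H'; apply: H => j Kjx; apply: H'.
  by exists j.
apply: negligible_bigcup_countType => j; apply/negligibleP.
  by have := measurable_proj j measurableT (measurable_through x); rewrite setTI.
exact: (eq_trans (iid_law_proj j Hla (measurable_through x)) (kappa_through sx)).
Qed.

Lemma great_subsphere_usphere : great_subsphere d (@usphere R d).
Proof.
exists fullv; first by rewrite dimvf /dim /= mul1n.
by apply/seteqP; split => x //=; [move=> sx; split => //; rewrite memvf|case].
Qed.

(** Induction on the size of [J]: a further hypersphere is independent of the intersection so far,
    contains it with probability 0, and therefore lowers its dimension by exactly one. *)
Lemma ae_general_position (J : {set 'I_n}) : (#|J| <= d)%N ->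
  {ae la, forall K : hfam R d n, great_subsphere (d - #|J|) (meetset J K)}.
Proof.
have [m] := ubnP #|J|; elim: m J => // m IH J' Jm Jd.
have [J0|[j jJ']] := set_0Vmem J'.
  apply: aeW => K; rewrite J0 cards0 subn0.
  have -> : meetset finset.set0 K = usphere.
    by apply/seteqP; split => [x []//|x sx]; split => // i; rewrite inE.
  exact: great_subsphere_usphere.
have [J [jJ J'E]] : exists J : {set 'I_n}, j \notin J /\ J' = (j |: J)%SET.
  by exists (J' :\ j)%SET; rewrite finset.setD1K// !inE eqxx.
move: Jm Jd; rewrite {}J'E cardsU1 jJ {jJ'} => Jm Jd.
have jN : {ae la, forall K : hfam R d n, ~ sset (meet J K) `<=` sset (K j)}.
  have mN := @measurable_incl R d.
  have N0 := meet_independent_null Hla jJ mN kappa_incl.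
  exists [set K : hfam R d n | sset (meet J K) `<=` sset (K j)]; split => //.
    have mp : measurable_fun setT (fun K : hfam R d n => (meet J K : borelK R d, K j : borelK R d)).
      by apply: measurable_fun_pair; [exact: measurable_meet|exact: measurable_proj].
    by have := mp measurableT _ mN; rewrite setTI.
  by move=> K /= /contrapT.
have IHJ := IH J Jm (ltnW Jd).
have dE : (d - #|J| = (d - (1 + #|J|)).+1)%N by move: Jd; lia.
rewrite dE in IHJ.
apply: (filterS3 (F := almost_everywhere la)) ae_hyperspheres IHJ jN => K HK gK NK.
have mE : sset (meet J K) = meetset J K.
  by apply: sset_meet; exact: great_subsphere_nonempty gK.
have [x xJ xj] : exists2 x, meetset J K x & ~ sset (K j) x.
  apply: contrapT => H; apply: NK; rewrite mE => x xJ.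
  by apply: contrapT => xj; apply: H; exists x.
exact: (meetset_cut d0 HK gK xJ xj).
Qed.

End general_position.

(** * Uniform points and their cells *)

Section uniform_points.
Variables (R : realType) (d k : nat).
Notation E := 'rV[R]_d.+1.
Notation KS := (sbody R d).
Variable kappa : probability (borelK R d) R.
Hypothesis d0 : (0 < d)%N.
Hypothesis Hkappa : nondegenerate_directional_distribution kappa.
Variable mu : R.-pker (borelK R d) ~> (borelE R d).
Hypothesis mu_self : forall L : KS, great_subsphere k (sset L) ->
  mu L (sset L) = 1%E.
Local Open Scope ereal_scope.

Lemma measurable_kernel_section (disp : measure_display) (X : measurableType disp)
    (f : X -> borelK R d) (M : set (X * borelE R d)) :
  measurable_fun setT f -> measurable M ->
  measurable_fun setT (fun p => mu (f p) [set x | M (p, x)]).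
Proof.
move=> mf mM; rewrite (_ : (fun p => _) = fun p => kpull mu mf p (xsection M p)).
  by apply: measurable_fun_xsection_finite_kernel; rewrite inE.
by apply/funext => p; rewrite xsectionE.
Qed.

Lemma measurable_kernel_sset :
  measurable_fun setT (fun p : borelK R d * borelK R d => mu p.1 (sset p.2)).
Proof.
pose M := [set q : (borelK R d * borelK R d) * borelE R d | sset q.1.2 q.2].
have mM : measurable M.
  have mp : measurable_fun setT (fun q : (borelK R d * borelK R d) * borelE R d =>
      (q.1.2 : borelK R d, q.2 : borelE R d)).
    apply: measurable_fun_pair; last exact: measurable_snd.
    exact: (measurableT_comp measurable_snd measurable_fst).
  by have := mp measurableT _ (@measurable_mem R d); rewrite setTI.
exact: (measurable_kernel_section (measurable_fst : measurable_fun setT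
  (fst : borelK R d * borelK R d -> borelK R d)) mM).
Qed.

(** By Fubini's theorem, the [kappa]-integral of [mu L (sset K)] is the integral, over points [x] of
    [L], of the probability that a hypersphere passes through [x], which is 0. *)
Lemma kappa_kernel_sset0 (L : KS) : great_subsphere k (sset L) ->
  kappa [set K | mu L (sset K) != 0] = 0.
Proof.
move=> gL; have mmem := @measurable_mem R d.
have mf : measurable_fun setT (fun K : borelK R d => mu L (sset K)).
  have mp : measurable_fun setT (fun K : borelK R d => (L : borelK R d, K)).
    by apply: measurable_fun_pair => //; exact: measurable_id.
  exact: (measurableT_comp measurable_kernel_sset mp).
have mset : measurable [set K : borelK R d | mu L (sset K) != 0].
  have -> : [set K : borelK R d | mu L (sset K) != 0] =
      (fun K : borelK R d => mu L (sset K)) @^-1` (~` [set 0]).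
    by apply/seteqP; split => K /= /eqP.
  rewrite -[X in measurable X]setTI; apply: mf => //.
  by apply: measurableC; exact: emeasurable_set1.
pose M := [set p : borelK R d * borelE R d | sset p.1 p.2].
have muT : mu L setT = 1 by exact: prob_kernel.
have [muL muLE] := measure_probability muT.
have I0 : \int[kappa]_K `|mu L (sset K)| = 0.
  transitivity (\int[kappa]_K \int[muL]_x (\1_M (K, x) : R)%:E).
    apply: eq_integral => K _; rewrite gee0_abs//.
    rewrite (_ : (fun x => _) = EFin \o \1_(sset K : set (borelE R d))).
      rewrite integral_indic// ?setIT; first exact: esym (muLE _).
      by apply: measurable_closedE; exact: closed_sset.
    by apply/funext => x /=; rewrite !indicE.
  have mM : measurable_fun setT (fun p : borelK R d * borelE R d => (\1_M p : R)%:E).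
    by apply: measurableT_comp => //; exact: measurable_indic.
  rewrite [LHS](fubini_tonelli (m1 := kappa) (m2 := muL) _ mM)//.
  have -> : \int[muL]_x \int[kappa]_K (\1_M (K, x) : R)%:E =
      \int[muL]_x kappa [set K | sset K x].
    apply: eq_integral => x _.
    rewrite (_ : (fun K => _) = EFin \o \1_([set K | sset K x] : set (borelK R d))).
      by rewrite integral_indic// ?setIT//; exact: measurable_through.
    by apply/funext => K /=; rewrite !indicE.
  have mL : measurable (sset L : set (borelE R d)).
    by apply: measurable_closedE; exact: closed_sset.
  rewrite (@ge0_eq_integral_off _ _ _ muL (~` sset L) _ (cst 0)) ?integral0//.
  - exact: measurableC.
  - apply: (eq_trans (probability_setC muL mL)).
    by rewrite [X in _ - X]muLE mu_self// subee.
  - by move=> x /contrapT Lx; apply: kappa_through => //; exact: sset_sphere Lx.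
have [N [mN N0 NP]] := (ae_eq_integral_abs kappa measurableT mf).1 I0.
apply: measure_negligible => //; exists N; split => // K /eqP K0.
by apply: NP => /=; apply/not_implyP; split.
Qed.

Variable n : nat.
Variable la : probability (hfam R d n) R.
Hypothesis Hla : iid_law kappa la.

Lemma ae_kernel_meet0 (J : {set 'I_n}) (j : 'I_n) : j \notin J ->
  {ae la, forall K : hfam R d n, great_subsphere k (sset (meet J K)) ->
    mu (meet J K) (sset (K j)) = 0}.
Proof.
move=> jJ; pose N := [set p : borelK R d * borelK R d |
  great_subsphere k (sset p.1) /\ mu p.1 (sset p.2) != 0].
have mN : measurable N.
  have -> : N = fst @^-1` [set L : borelK R d | great_subsphere k (sset L)] `&`
      (fun p : borelK R d * borelK R d => mu p.1 (sset p.2)) @^-1` (~` [set 0]).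
    by apply/seteqP; split => p /= [gp /eqP].
  apply: measurableI; rewrite -[X in measurable X]setTI.
    by apply: measurable_fst => //; exact: measurable_great_subsphere.
  apply: measurable_kernel_sset => //.
  by apply: measurableC; exact: emeasurable_set1.
exists [set K : hfam R d n | N (meet J K, K j)]; split.
- have mp : measurable_fun setT (fun K : hfam R d n => (meet J K : borelK R d, K j : borelK R d)).
    by apply: measurable_fun_pair; [exact: measurable_meet|exact: measurable_proj].
  by have := mp measurableT _ mN; rewrite setTI.
- apply: (meet_independent_null Hla jJ mN) => L.
  have [gL|gL] := pselect (great_subsphere k (sset L)); last first.
    by rewrite (_ : [set K | _] = set0) ?measure0//; apply/seteqP; split => // K [].
  rewrite -(kappa_kernel_sset0 gL); congr (kappa _).
  by apply/seteqP; split => [K []//|K HK]; split.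
- by move=> K /= /not_implyP[gK /eqP K0]; split.
Qed.

(* The law of the cell, in the section of a tessellation with law [la] by [L],
   that contains a uniform point of [L]. *)
Definition zero_cell_law (L : borelK R d) (A : set (borelK R d)) : \bar R :=
  \int[la]_K mu L [set x | A (cell K L x)].

Lemma measurable_cell_event (A : set (borelK R d)) : measurable A ->
  measurable_fun setT (fun p : borelK R d * hfam R d n =>
    mu p.1 [set x | A (cell p.2 p.1 x)]).
Proof.
move=> mA; pose X := (borelK R d * hfam R d n)%type.
pose M := [set q : X * borelE R d | A (cell q.1.2 q.1.1 q.2)].
have mM : measurable M.
  have mp : measurable_fun setT (fun q : X * borelE R d =>
      ((q.1.2 : hfam R d n, q.1.1 : borelK R d), q.2 : borelE R d)).
    apply: measurable_fun_pair; last exact: measurable_snd.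
    apply: measurable_fun_pair.
      exact: (measurableT_comp measurable_snd measurable_fst).
    exact: (measurableT_comp measurable_fst measurable_fst).
  have := measurableT_comp (@measurable_cell R d n d0) mp.
  by move=> /(_ measurableT _ mA); rewrite setTI.
exact: (measurable_kernel_section (measurable_fst : measurable_fun setT (fst : X -> borelK R d)) mM).
Qed.

Lemma measurable_zero_cell_law (A : set (borelK R d)) : measurable A ->
  measurable_fun setT (zero_cell_law ^~ A).
Proof.
move=> mA; have mf := measurable_cell_event mA.
by apply: (measurable_fun_fubini_tonelli_F _ mf) => p; exact: measure_ge0.
Qed.

Lemma zero_cell_law_setT L : zero_cell_law L setT = 1.
Proof.
rewrite /zero_cell_law; under eq_integral do rewrite prob_kernel.
by rewrite integral_cst// mul1e; exact: probability_setT.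
Qed.

Lemma measurable_zero_cell_section (L : borelK R d) (A : set (borelK R d)) :
  measurable A -> measurable_fun setT (fun K : hfam R d n => mu L [set x | A (cell K L x)]).
Proof.
move=> mA; have mp : measurable_fun setT (fun K : hfam R d n => (L : borelK R d, K)).
  by apply: measurable_fun_pair => //; exact: measurable_id.
exact: (measurableT_comp (measurable_cell_event mA) mp).
Qed.

End uniform_points.

(** * The two laws *)

Section laws_of_families.
Variables (R : realType) (d : nat).
Variable kappa : probability (borelK R d) R.
Context (n : nat) (disp : measure_display) (Omega : measurableType disp)
  (P : probability Omega R) (S : 'I_n -> {RV P >-> borelK R d}).

Definition sample (w : Omega) : hfam R d n := fun i => S i w.

Lemma measurable_sample : measurable_fun setT sample.
Proof. exact: measurable_fun_hfam. Qed.

Lemma iid_hyperspheres_law : iid_hyperspheres kappa S ->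
  exists la : probability (hfam R d n) R, [/\ iid_law kappa la,
    forall M, la M = P (sample @^-1` M) &
    forall g : hfam R d n -> \bar R, measurable_fun setT g ->
      (forall y, 0 <= g y)%E -> (\int[la]_y g y = \int[P]_x g (sample x))%E].
Proof.
move=> [_ SE Sind]; have [la [laE laI]] := pushforward_law P measurable_sample.
exists la; split => // B mB; rewrite laE.
have -> : sample @^-1` rect B = \bigcap_i (S i @^-1` B i).
  by apply/seteqP; split => w H i; [move=> _; exact: H|exact: (H i I)].
by rewrite Sind//; apply: eq_bigr => i _; exact: SE.
Qed.

Lemma ae_sample (la : probability (hfam R d n) R) (Q : hfam R d n -> Prop) :
  (forall M, la M = P (sample @^-1` M)) ->
  {ae la, forall K, Q K} -> {ae P, forall w, Q (sample w)}.
Proof.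
move=> laE [N [mN N0 NP]]; exists (sample @^-1` N); split.
- by rewrite -[X in measurable X]setTI; exact: measurable_sample.
- by have := N0; rewrite laE.
- by move=> w /= /NP.
Qed.

End laws_of_families.

(** * The cell of a uniform point in a section *)

Section section_cell.
Variables (R : realType) (d k : nat).
Notation E := 'rV[R]_d.+1.
Notation KS := (sbody R d).
Variable kappa : probability (borelK R d) R.
Hypothesis d0 : (0 < d)%N.
Hypothesis Hkappa : nondegenerate_directional_distribution kappa.
Variable mu : R.-pker (borelK R d) ~> (borelE R d).
Hypothesis mu_self : forall L : KS, great_subsphere k (sset L) ->
  mu L (sset L) = 1%E.
Hypothesis muE : forall (L : KS) (A : set E), great_subsphere k (sset L) ->
  measurable (A : set (borelE R d)) -> mu L A = normalized_hausdorff k (sset L) A.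
Local Open Scope ereal_scope.

Lemma zero_cell_law_unique n (la la' : probability (hfam R d n) R) L A :
  iid_law kappa la -> iid_law kappa la' ->
  zero_cell_law mu la L A = zero_cell_law mu la' L A.
Proof.
move=> Hla Hla'; apply: eq_measure_integral => M mM _.
exact: (iid_law_unique Hla Hla').
Qed.

Lemma kernel_null_outside n (L : KS) (K : 'I_n -> KS) (J : {set 'I_n}) :
  great_subsphere k (sset L) -> (forall j, j \notin J -> mu L (sset (K j)) = 0) ->
  exists N : set (borelE R d), [/\ measurable N, mu L N = 0 &
    forall x, ~ N x -> sset L x /\ forall j, j \notin J -> ~ sset (K j) x].
Proof.
move=> gL H.
have ms (B : KS) : measurable (sset B : set (borelE R d)).
  by apply: measurable_closedE; exact: closed_sset.
have L0 : (mu L).-negligible (~` sset L : set (borelE R d)).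
  exists (~` sset L); split => //; first exact: measurableC.
  have muT : mu L setT = 1 by exact: prob_kernel.
  have [muL muLE] := measure_probability muT.
  rewrite -muLE; apply: (eq_trans (probability_setC muL (ms L))).
  by rewrite [X in _ - X]muLE mu_self// subee.
have K0 (j : 'I_n) : (mu L).-negligible (if j \in J then set0 else sset (K j) : set (borelE R d)).
  case: ifPn => [_|jJ]; first exact: negligible_set0.
  by apply/negligibleP => //; exact: H.
have [N [mN N0 NP]] := negligibleU L0 (negligible_bigcup_countType K0).
exists N; split => // x Nx; split.
  by apply: contrapT => Lx; apply: Nx; apply: NP; left.
move=> j jJ Kx; apply: Nx; apply: NP; right; exists j => //.
by rewrite (negbTE jJ).
Qed.

Lemma ae_kernel_sset0 n (la : probability (hfam R d n) R) (L : KS) :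
  iid_law kappa la -> great_subsphere k (sset L) ->
  {ae la, forall K : hfam R d n, forall j, mu L (sset (K j)) = 0}.
Proof.
move=> Hla gL; have mf : measurable_fun setT (fun K : borelK R d => mu L (sset K)).
  have mp : measurable_fun setT (fun K : borelK R d => (L : borelK R d, K)).
    by apply: measurable_fun_pair => //; exact: measurable_id.
  exact: (measurableT_comp (measurable_kernel_sset mu) mp).
have mset : measurable [set K : borelK R d | mu L (sset K) != 0].
  have -> : [set K : borelK R d | mu L (sset K) != 0] =
      (fun K : borelK R d => mu L (sset K)) @^-1` (~` [set 0]).
    by apply/seteqP; split => K /= /eqP.
  rewrite -[X in measurable X]setTI; apply: mf => //.
  by apply: measurableC; exact: emeasurable_set1.
have N0 (j : 'I_n) : la.-negligible [set K : hfam R d n | mu L (sset (K j)) != 0].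
  exists [set K : hfam R d n | mu L (sset (K j)) != 0]; split => //.
    by have := measurable_proj j measurableT mset; rewrite setTI.
  exact: (eq_trans (iid_law_proj j Hla mset) (kappa_kernel_sset0 d0 Hkappa mu_self gL)).
apply: negligibleS (negligible_bigcup_countType N0) => K /= H.
by apply: contrapT => H'; apply: H => j; apply: contrapT => /eqP Hj; apply: H'; exists j.
Qed.

Context (m : nat) (disp : measure_display) (Omega : measurableType disp)
  (P : probability Omega R) (S : 'I_m -> {RV P >-> borelK R d})
  (U : {RV P >-> borelE R d}) (Z : {RV P >-> borelK R d}) (L : borelK R d).
Let T w := section (tessellation (fun i => sset (S i w))) (sset L).
Hypothesis HS : iid_hyperspheres kappa S.
Hypothesis gL : great_subsphere k (sset L).
Hypothesis HU : uniform_on k (sset L) U.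
Hypothesis TU : independent_of T U.
Hypothesis HZ : cell_containing T U Z.

Let HSw w : hyperspheres (sample S w).
Proof. by have [H _ _] := HS => i; exact: H. Qed.

Let TE : T = fun w => cells (sample S w) L.
Proof. by apply/funext => w; exact: (sectionE d0 L (HSw w)). Qed.

Let Tbody w X : T w X -> exists K : KS, X = sset K.
Proof. by rewrite TE; exact: (cells_body d0 HSw). Qed.

Let Tfin w : finite_set (T w).
Proof. by rewrite TE; exact: cells_finite. Qed.

(** Almost surely [Z] is a function of the section and of [U], measurable for the sigma-algebra of
    the section. [disintegration] can therefore integrate [U] out, and what remains depends only on
    the law of the hyperspheres. *)
Lemma section_cell_law (la : probability (hfam R d m) R) (A : set (borelK R d)) :
  iid_law kappa la -> measurable A -> P (Z @^-1` A) = zero_cell_law mu la L A.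
Proof.
move=> Hla mA.
have [la' [Hla' la'E la'I]] := iid_hyperspheres_law HS.
rewrite (zero_cell_law_unique _ _ Hla Hla').
have TM : <<s collection_events T >> `<=` measurable.
  apply: smallest_sub; first exact: sigma_algebra_measurable.
  move=> _ [B mB <-]; rewrite TE.
  exact: (measurable_cells_event L d0 (measurable_sample S) HSw mB).
(* By independence the conditional law of [U] is constant, a mixture with a single term. *)
pose ker := kpull mu (@measurable_cst _ _ Omega (borelK R d) setT L).
have HX H B : <<s collection_events T >> H -> measurable B ->
    P (H `&` U @^-1` B) = \sum_(i <- [:: tt]) (1%R)%:E * \int[P]_(w in H) ker w B.
  move=> HH mB; rewrite big_seq1 mul1e TU// (_ : (fun w => ker w B) = cst (mu L B))//.
  rewrite integral_cst; last exact: TM.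
  by rewrite muleC; congr (_ * _); rewrite muE//; exact: HU.
pose M := [set p : g_sigma_algebraType (collection_events T) * borelE R d |
  A (face_of_point T p.1 p.2)].
have mM : measurable M.
  have := measurable_face_of_point Tfin Tbody.
  by move=> /(_ measurableT _ mA); rewrite setTI.
have [mM' PM] := disintegration ler01 TM HX mM.
have fopE w x : sset L x -> off (sample S w) x ->
    face_of_point T w x = cell (sample S w) L x.
  move=> Lx xoff; rewrite /face_of_point TE (bigcap_cells d0 (HSw w) Lx xoff).
  by rewrite /cell; case: asboolP => // -[].
have mXM : measurable [set w | M (w, U w)].
  have mp : measurable_fun setT (fun w => (w, U w)) by apply: measurable_fun_pair.
  by have := mp measurableT _ mM'; rewrite setTI.
have -> : P (Z @^-1` A) = P [set w | M (w, U w)].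
  apply: ae_eq_measure => //; first exact: measurable_funPTI.
  apply: (filterS (F := almost_everywhere P) _ HZ) => w [TZ rZ].
  rewrite /M /= /preimage /=; suff -> : Z w = face_of_point T w (U w) by [].
  have {}TZ : cells (sample S w) L (sset (Z w)) by move: TZ; rewrite TE.
  have [LU Uoff ZE] := relint_cell d0 (HSw w) TZ rZ.
  by rewrite fopE//; apply: sset_inj; rewrite sset_cell.
rewrite PM big_seq1 mul1e /zero_cell_law la'I; last 2 first.
- exact: measurable_zero_cell_section.
- by move=> K; exact: measure_ge0.
have [N [mN N0 NP]] := ae_sample la'E (ae_kernel_sset0 Hla' gL).
apply: (ge0_eq_integral_off mN N0) => [w|w|w Nw]; [exact: measure_ge0..|].
have {}Nw : forall j, mu L (sset (S j w)) = 0 by apply: contrapT => /NP.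
(* With the empty set of indices no hypersphere is exempt: almost every point of [L] is off all of
   them. *)
have [N' [mN' N'0 N'P]] := @kernel_null_outside _ L (sample S w) finset.set0 gL (fun j _ => Nw j).
apply: ae_eq_measure.
- rewrite (_ : [set y | _] = xsection M w); first exact: measurable_xsection.
  by rewrite xsectionE.
- have mp : measurable_fun setT (fun x : borelE R d => ((sample S w, L), x)).
    by apply: measurable_fun_pair => //; exact: measurable_id.
  have := measurableT_comp (@measurable_cell R d m d0) mp.
  by move=> /(_ measurableT _ mA); rewrite setTI.
exists N'; split => // x /= H; apply: contrapT => Nx; apply: H.
have [Lx xoff] := N'P x Nx; rewrite /M /= fopE//.
by move=> j; apply: xoff; rewrite inE.
Qed.

End section_cell.

(** * The law of an intersection of hyperspheres *)

Section meets.
Variables (R : realType) (d k : nat).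
Notation E := 'rV[R]_d.+1.
Notation KS := (sbody R d).
Variable kappa : probability (borelK R d) R.
Hypothesis d0 : (0 < d)%N.
Hypothesis kd : (k < d)%N.
Local Open Scope ereal_scope.

Lemma enum_injection n m (A : {set 'I_n}) : #|A| = m ->
  exists2 g : 'I_m -> 'I_n, injective g &
    forall j, j \in A <-> exists i, g i = j.
Proof.
move=> Am; exists (fun i => enum_val (cast_ord (esym Am) i)).
  by move=> i i' /enum_val_inj/cast_ord_inj.
move=> j; split => [jA|[i <-]]; last exact: enum_valP.
exists (cast_ord Am (enum_rank_in jA j)).
by rewrite cast_ordK enum_rankK_in.
Qed.

Lemma meet_comp n m (g : 'I_m -> 'I_n) (J : {set 'I_n}) (K : 'I_n -> KS) :
  (forall j, j \in J <-> exists i, g i = j) ->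
  meet J K = meet [set: 'I_m]%SET (K \o g).
Proof.
move=> gJ; congr mkbody; apply/seteqP; split => x [sx H]; split => // i.
  by move=> _; apply: H; apply/gJ; exists i.
by move=> /gJ[i' <-]; exact: (H i' (finset.in_setT _)).
Qed.

Lemma meetset_nonempty n (J : {set 'I_n}) (K : 'I_n -> KS) : hyperspheres K ->
  (#|J| <= d)%N -> meetset J K !=set0.
Proof.
move=> HK Jd; have [a aK] := hyperspheres_normals d0 HK.
have [V VE Vd] := perp_family a J.
rewrite (meetsetE aK) -VE; apply: (@great_subsphere_nonempty _ _ (\dim V).-1).
by exists V => //; move: Vd Jd; lia.
Qed.

Variable kappak : probability (borelK R d) R.
Hypothesis Hkappak : intersection_distribution kappa k kappak.
Variables (n : nat) (la : probability (hfam R d n) R).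
Hypothesis Hla : iid_law kappa la.

Lemma meet_law (J : {set 'I_n}) (B : set (borelK R d)) : #|J| = (d - k)%N ->
  measurable B -> la [set K : hfam R d n | B (meet J K)] = kappak B.
Proof.
move=> Jk mB; have [disp [X [P [S [HS kE]]]]] := Hkappak.
have [la1 [Hla1 la1E _]] := iid_hyperspheres_law HS.
have [g gI gJ] := enum_injection Jk.
have [la2 [la2E ?]] := pushforward_law la (@measurable_comp_fam R d _ _ g).
have Hla2 : iid_law kappa la2.
  by move=> C mC; apply: (eq_trans (la2E _)); exact: (iid_law_comp gI Hla).
have mM : measurable [set K : hfam R d (d - k) | B (meet [set: 'I_(d - k)]%SET K)].
  by have := @measurable_meet R d _ [set: 'I_(d - k)]%SET measurableT _ mB; rewrite setTI.
transitivity (la2 [set K : hfam R d (d - k) | B (meet [set: 'I_(d - k)]%SET K)]).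
  rewrite la2E; congr (la _); apply/seteqP; split => K /=; by rewrite (meet_comp _ gJ).
rewrite (iid_law_unique Hla2 Hla1 mM) kE//; apply: (eq_trans (la1E _)); congr (P _).
have HSw w : hyperspheres (sample S w) by have [H _ _] := HS => i; exact: H.
have mE w : meetset [set: 'I_(d - k)]%SET (sample S w) = \bigcap_i sset (S i w).
  apply/seteqP; split => x.
    by move=> [_ H] i _; exact: (H i (finset.in_setT _)).
  move=> H; split; last by move=> i _; exact: H.
  (* As [d - k] is positive, the plain intersection already lies on the sphere. *)
  have i0 : (0 < d - k)%N by rewrite subn_gt0.
  exact: (sset_sphere (H (Ordinal i0) I)).
apply/seteqP; split => w /=; rewrite -mE.
  move=> BM; exists (meet [set: 'I_(d - k)]%SET (sample S w)) => //.
  by apply: sset_meet; apply: meetset_nonempty => //; rewrite cardsT card_ord leq_subr.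
by move=> [K BK KE]; rewrite /preimage /= /meet -KE mkbody_sset.
Qed.

Variable mu : R.-pker (borelK R d) ~> (borelE R d).

Let section_event (A B : set (borelK R d)) (p : borelK R d * hfam R d (n - (d - k))) : \bar R :=
  mu p.1 [set x | A (cell p.2 p.1 x)] * (\1_B p.1 : R)%:E.

Let section_event_ge0 A B p : 0 <= section_event A B p.
Proof. by rewrite mule_ge0// lee_fin. Qed.

Let measurable_section_event A B : measurable A -> measurable B ->
  measurable_fun setT (section_event A B).
Proof.
move=> mA mB; apply: emeasurable_funM; first exact: measurable_cell_event.
by apply: measurableT_comp => //; apply: measurableT_comp => //.
Qed.

Lemma measurable_meet_section (J : {set 'I_n}) (g : 'I_(n - (d - k)) -> 'I_n)
    (A B : set (borelK R d)) : measurable A -> measurable B ->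
  measurable_fun setT (fun K : hfam R d n =>
    mu (meet J K) [set x | A (cell (K \o g) (meet J K) x)] * (\1_B (meet J K) : R)%:E).
Proof.
move=> mA mB; have mpair : measurable_fun setT (fun K : hfam R d n =>
    (meet J K : borelK R d, K \o g : hfam R d (n - (d - k)))).
  apply: measurable_fun_pair; first exact: measurable_meet.
  exact: measurable_comp_fam.
exact: (measurableT_comp (measurable_section_event mA mB) mpair).
Qed.

(* Given the hyperspheres indexed by [J], which determine [meet J], the
   remaining ones are still independent with distribution [kappa]. *)
Lemma zero_cell_law_meet (J : {set 'I_n}) (g : 'I_(n - (d - k)) -> 'I_n)
    (lam : probability (hfam R d (n - (d - k))) R) (A B : set (borelK R d)) :
  iid_law kappa lam -> #|J| = (d - k)%N -> injective g ->
  (forall i, g i \notin J) -> measurable A -> measurable B ->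
  \int[la]_K (mu (meet J K) [set x | A (cell (K \o g) (meet J K) x)] *
    (\1_B (meet J K) : R)%:E) =
  \int[kappak]_(L in B) zero_cell_law mu lam L A.
Proof.
move=> Hlam Jk gI gJ mA mB.
have mf : measurable_fun setT (fun K : hfam R d n => section_event A B (meet J K, K \o g)).
  exact: measurable_meet_section.
transitivity (\int[la]_K (section_event A B (meet J K, K \o g))) => //.
rewrite (iid_law_merge J Hla mf); last by move=> K; exact: section_event_ge0.
have [lag [lagE lagI]] := pushforward_law la (@measurable_comp_fam R d _ _ g).
have Hlag : iid_law kappa lag.
  by move=> C mC; rewrite lagE; exact: (iid_law_comp gI Hla).
have mz := measurable_zero_cell_law d0 mu lam mA.
have [lak [lakE lakI]] := pushforward_law la (@measurable_meet R d n J).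
pose F L := zero_cell_law mu lam L A * (\1_B L : R)%:E.
have F0 L : 0 <= F L by rewrite mule_ge0// ?lee_fin//; apply: integral_ge0.
have mF : measurable_fun setT F.
  apply: emeasurable_funM => //; apply: measurableT_comp => //.
transitivity (\int[la]_K F (meet J K)).
  apply: eq_integral => K _.
  have mergeE K' : meet J (merge J K K') = meet J K.
    congr mkbody; apply/seteqP; split => y [sy H]; split => // i iJ;
      by have := H i iJ; rewrite /merge iJ.
  have compE K' : merge J K K' \o g = K' \o g.
    by apply/funext => i /=; rewrite /merge (negbTE (gJ i)).
  under eq_integral do rewrite /= mergeE compE.
  rewrite /section_event /F -(zero_cell_law_unique mu _ _ Hlag Hlam).
  rewrite /zero_cell_law lagI; last 2 first.
  - exact: measurable_zero_cell_section.
  - by move=> K'; exact: measure_ge0.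
  rewrite /= ge0_integralZr//.
  have mc : measurable_fun setT (fun K0 : hfam R d n => K0 \o g : hfam R d (n - (d - k))).
    exact: measurable_comp_fam.
  pose z (K0 : hfam R d (n - (d - k))) := mu (meet J K) [set x | A (cell K0 (meet J K) x)].
  have mzK : measurable_fun setT z by exact: measurable_zero_cell_section.
  exact: (measurableT_comp mzK mc).
rewrite -lakI// [RHS]integral_mkcond.
transitivity (\int[kappak]_L F L).
  apply: eq_measure_integral => M mM _; apply: (eq_trans (lakE M)).
  exact: meet_law.
apply: eq_integral => L _; rewrite patchE /F indicE.
by case: ifP; rewrite ?mule1 ?mule0.
Qed.

End meets.

Lemma ae_forall_countType (disp : measure_display) (T : measurableType disp)
    (R : realType) (mu : {measure set T -> \bar R}) (I : countType) (Q : I -> T -> Prop) :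
  (forall i, {ae mu, forall x, Q i x}) -> {ae mu, forall x i, Q i x}.
Proof.
move=> HQ; apply: negligibleS (negligible_bigcup_countType HQ) => x /= H.
by apply: contrapT => H'; apply: H => i; apply: contrapT => Hi; apply: H'; exists i.
Qed.

(** * The law of the weighted typical face *)

Section weighted_face.
Variables (R : realType) (d k n : nat).
Notation E := 'rV[R]_d.+1.
Notation KS := (sbody R d).
Variables (kappa kappak : probability (borelK R d) R).
Hypothesis d0 : (0 < d)%N.
Hypothesis kd : (k < d)%N.
Hypothesis dkn : (d - k <= n)%N.
Hypothesis Hkappa : nondegenerate_directional_distribution kappa.
Hypothesis Hkappak : intersection_distribution kappa k kappak.
Variable mu : R.-pker (borelK R d) ~> (borelE R d).
Hypothesis mu_self : forall L : KS, great_subsphere k (sset L) ->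
  mu L (sset L) = 1%E.
Local Open Scope ereal_scope.
Notation Js := (subsets_of_size n (d - k)).
Hypothesis mu_skel : forall (K : 'I_n -> KS) (z : E), hyperspheres K ->
  usphere z -> off K z ->
  (forall J : {set 'I_n}, J \in Js -> great_subsphere k (meetset J K)) ->
  (forall (J : {set 'I_n}) (j : 'I_n), J \in Js -> j \notin J ->
     mu (meet J K) (sset (K j)) = 0) ->
  forall A : set E, measurable (A : set (borelE R d)) ->
  normalized_hausdorff k (skel k (cells K (point : KS))) A =
  \sum_(J in Js) (#|Js|%:R^-1)%:E * mu (meet J K) A.

Lemma ae_great_meet (la : probability (hfam R d n) R) : iid_law kappa la ->
  {ae la, forall (K : hfam R d n) (J : {set 'I_n}), J \in Js ->
    great_subsphere k (meetset J K)}.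
Proof.
move=> Hla; apply: ae_forall_countType => J.
have [|JJ] := boolP (J \in Js); last by apply: aeW => K.
rewrite inE => /eqP Jk; have Jd : (#|J| <= d)%N by rewrite Jk leq_subr.
have := ae_general_position d0 Hkappa Hla Jd; rewrite Jk subKn; last exact: ltnW.
by apply: (filterS (F := almost_everywhere la)) => K gK _.
Qed.

Lemma ae_null_meet (la : probability (hfam R d n) R) : iid_law kappa la ->
  {ae la, forall (K : hfam R d n) (Jj : {set 'I_n} * 'I_n), Jj.1 \in Js ->
    Jj.2 \notin Jj.1 -> mu (meet Jj.1 K) (sset (K Jj.2)) = 0}.
Proof.
move=> Hla; apply: ae_forall_countType => -[J j] /=.
have [jJ|jJ] := boolP (j \notin J); last by apply: aeW => K.
apply: (filterS2 (F := almost_everywhere la)) (ae_great_meet Hla) (ae_kernel_meet0 d0 Hkappa mu_self Hla jJ).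
move=> K gK H JJ _; apply: H.
by rewrite sset_meet; [exact: gK|exact: great_subsphere_nonempty (gK J JJ)].
Qed.

Context (disp : measure_display) (Omega : measurableType disp)
  (P : probability Omega R) (S : 'I_n -> {RV P >-> borelK R d})
  (W : {RV P >-> borelK R d}).
Let T w := tessellation (fun i => sset (S i w)).
Hypothesis HS : iid_hyperspheres kappa S.
Hypothesis HW : weighted_typical_face k T W.

Let HSw w : hyperspheres (sample S w).
Proof. by have [H _ _] := HS => i; exact: H. Qed.

Let TE : T = fun w => cells (sample S w) point.
Proof. by apply/funext => w; exact: (tessellationE d0 (HSw w)). Qed.

Let Tbody w X : T w X -> exists K : KS, X = sset K.
Proof. by rewrite TE; exact: (cells_body d0 HSw). Qed.

Let Tfin w : finite_set (T w).
Proof. by rewrite TE; exact: cells_finite. Qed.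

(** After [disintegration], the terms of the mixture over [J] all have the same value by
    [zero_cell_law_meet], and the weights sum to 1. *)
Lemma weighted_face_law (lam : probability (hfam R d (n - (d - k))) R)
    (A B : set (borelK R d)) : iid_law kappa lam -> measurable A -> measurable B ->
  P (W @^-1` A `&` (fun w => direction (W w)) @^-1` B) =
  \int[kappak]_(L in B) zero_cell_law mu lam L A.
Proof.
move=> Hlam mA mB.
have [la [Hla laE laI]] := iid_hyperspheres_law HS.
(* A fixed point, almost surely off all hyperspheres; such a point gives the direction in which
   adjacent cells are found. *)
have [z sz] := great_subsphere_nonempty (great_subsphere_usphere R d).
have good : {ae la, forall K : hfam R d n, off K z /\
    (forall J : {set 'I_n}, J \in Js -> great_subsphere k (meetset J K)) /\
    forall Jj : {set 'I_n} * 'I_n, Jj.1 \in Js -> Jj.2 \notin Jj.1 ->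
      mu (meet Jj.1 K) (sset (K Jj.2)) = 0}.
  exact: filterI (ae_off d0 Hkappa Hla sz) (filterI (ae_great_meet Hla) (ae_null_meet Hla)).
have [N [mN N0 NP]] := ae_sample laE good.
have {}NP w : ~ N w -> [/\ off (sample S w) z,
    forall J, J \in Js -> great_subsphere k (meetset J (sample S w)) &
    forall J j, J \in Js -> j \notin J -> mu (meet J (sample S w)) (sset (S j w)) = 0].
  move=> Nw; apply: contrapT => H; apply: Nw; apply: NP => -[zoff [H1 H2]]; apply: H.
  by split => // J j; exact: (H2 (J, j)).
have [v [Hv HvW]] := HW.
have TM : <<s collection_events T >> `<=` measurable.
  apply: smallest_sub; first exact: sigma_algebra_measurable.
  move=> _ [C mC <-]; rewrite TE.
  exact: (measurable_cells_event point d0 (measurable_sample S) HSw mC).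
have mJ (J : {set 'I_n}) : measurable_fun setT (fun w => meet J (sample S w) : borelK R d).
  exact: (measurableT_comp (@measurable_meet R d n J) (measurable_sample S)).
pose ker J := kpull mu (mJ J).
pose c : R := (#|Js|%:R^-1)%R.
have c0 : (0 <= c)%R by rewrite invr_ge0.
have HX H C : <<s collection_events T >> H -> measurable C ->
    P (H `&` v @^-1` C) = \sum_(J <- enum Js) c%:E * \int[P]_(w in H) ker J w C.
  move=> HH mC; rewrite Hv//; have mH := TM H HH.
  transitivity (\int[P]_(w in H) \sum_(J <- enum Js) c%:E * ker J w C).
    rewrite integral_mkcond [RHS]integral_mkcond.
    (* The measure of the skeleton is not known to be a measurable function of [w]; it agrees with
       the mixture off [N]. *)
    apply: (ge0_eq_integral_off mN N0) => [w|w|w Nw]; rewrite !patchE; case: ifP => // _.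
    - by rewrite mule_ge0// ?hausdorff_measure_ge0// inve_ge0 hausdorff_measure_ge0.
    - by apply: sume_ge0 => J _; rewrite mule_ge0.
    - have [zoff gJ nJ] := NP w Nw.
      by rewrite big_enum TE (mu_skel (HSw w) sz zoff gJ nJ mC).
  rewrite ge0_integral_sum//; last 2 first.
  - by move=> J; apply: measurable_funeM; apply: measurable_funTS; exact: measurable_kernel.
  - by move=> J w _; rewrite mule_ge0.
  apply: eq_bigr => J _; rewrite ge0_integralZl//.
  by apply: measurable_funTS; exact: measurable_kernel.
pose M := [set p : g_sigma_algebraType (collection_events T) * borelE R d |
  (A `&` direction (d := d) @^-1` B) (face_of_point T p.1 p.2)].
have mAB : measurable (A `&` direction (d := d) @^-1` B : set (borelK R d)).
  apply: measurableI => //; rewrite -[X in measurable X]setTI.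
  exact: measurable_direction.
have mM : measurable M.
  have := measurable_face_of_point Tfin Tbody.
  by move=> /(_ measurableT _ mAB); rewrite setTI.
have [mM' PM] := disintegration c0 TM HX mM.
have fopE w x : usphere x -> ~ N w ->
    face_of_point T w x = mkbody (facset (sample S w) x).
  move=> sx /NP[zoff _ _]; rewrite /face_of_point TE.
  by rewrite (bigcap_tessellation d0 (HSw w) sx sz zoff).
have mXM : measurable [set w | M (w, v w)].
  have mp : measurable_fun setT (fun w => (w, v w)) by apply: measurable_fun_pair.
  by have := mp measurableT _ mM'; rewrite setTI.
have -> : P (W @^-1` A `&` (fun w => direction (W w)) @^-1` B) = P [set w | M (w, v w)].
  apply: ae_eq_measure => //.
    apply: measurableI; first exact: measurable_funPTI.
    have := measurableT_comp (@measurable_direction R d) (measurable_funPT W).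
    by move=> /(_ measurableT _ mB); rewrite setTI.
  have notN : {ae P, forall w, ~ N w} by exists N; split => // w /= /contrapT.
  apply: (filterS2 (F := almost_everywhere P)) HvW notN => w [FW rW] Nw.
  have {}FW : faces k (cells (sample S w) point) (sset (W w)) by move: FW; rewrite TE.
  have [WE sv] := relint_face d0 (HSw w) FW rW.
  by rewrite /M /= fopE// -WE mkbody_sset.
rewrite PM big_enum/=.
have termE J : J \in Js -> \int[P]_w ker J w [set y | M (w, y)] =
    \int[kappak]_(L in B) zero_cell_law mu lam L A.
  move=> JJ; have Jk : #|J| = (d - k)%N by move: JJ; rewrite inE => /eqP.
  (* [g] enumerates the hyperspheres outside [J], which tessellate the section by the intersection
     over [J]. *)
  have [g gI gJ] : exists2 g : 'I_(n - (d - k)) -> 'I_n, injective g &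
      forall j, j \in (~: J)%SET <-> exists i, g i = j.
    by apply: enum_injection; rewrite cardsCs finset.setCK card_ord Jk.
  have gnJ i : g i \notin J by rewrite -finset.in_setC; apply/gJ; exists i.
  have mf := measurable_meet_section d0 mu J g mA mB.
  rewrite -(zero_cell_law_meet d0 kd Hkappak Hla mu Hlam Jk gI gnJ mA mB) laI//.
  apply: (ge0_eq_integral_off mN N0) => [w|w|w Nw]; [exact: measure_ge0| |].
    by rewrite mule_ge0// lee_fin.
  have [zoff gm nm] := NP w Nw.
  set L := meet J (sample S w).
  have LE : sset L = meetset J (sample S w).
    by apply: sset_meet; exact: great_subsphere_nonempty (gm J JJ).
  have gL : great_subsphere k (sset L) by rewrite LE; exact: gm.
  have [N' [mN' N'0 N'P]] := @kernel_null_outside _ _ _ _ mu_self _ L (sample S w) J gL (nm J ^~ JJ).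
  have mMw : measurable [set y | M (w, y)].
    rewrite (_ : [set y | _] = xsection M w); first exact: measurable_xsection.
    by rewrite xsectionE.
  (* Almost every point of [L] is off the hyperspheres outside [J]; its smallest face is then a cell
     of the section and spans [L]. *)
  have key x : ~ N' x -> face_of_point T w x = cell (sample S w \o g) L x /\
      direction (face_of_point T w x) = L.
    move=> /N'P[Lx xoff]; have sx := sset_sphere Lx.
    have xJ : meetset J (sample S w) x by rewrite -LE.
    rewrite fopE//; split.
      rewrite (facset_cellset d0 (g := g) (HSw w) _ xJ xoff); last first.
        by move=> j; rewrite -finset.in_setC; apply: (iffP idP) => /gJ.
      rewrite /cell; case: asboolP => // -[]; split => // i; exact: HSw.
    apply: sset_inj; rewrite /= mkbodyK; last exact: facset_convex.
    by rewrite (lin_facset d0 (HSw w) xJ xoff) LE.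
  rewrite -[ker J w]/(mu L) indicE; have [BL|BL] := pselect (B L).
    rewrite mem_set// mule1; apply: ae_eq_measure => //.
      have mp : measurable_fun setT (fun x : borelE R d =>
          ((sample S w \o g : hfam R d _, L : borelK R d), x)).
        by apply: measurable_fun_pair => //; exact: measurable_id.
      have := measurableT_comp (@measurable_cell R d _ d0) mp.
      by move=> /(_ measurableT _ mA); rewrite setTI.
    exists N'; split => // x /= H; apply: contrapT => /key[fE dE]; apply: H.
    by rewrite /M /= dE -fE; split => [[]|].
  rewrite memNset// mule0 -(measure0 (mu L)); apply: ae_eq_measure => //.
  exists N'; split => // x /= H; apply: contrapT => /key[fE dE]; apply: H.
  by rewrite /M /= dE; split => // -[].
rewrite (eq_bigr (fun=> c%:E * \int[kappak]_(L in B) zero_cell_law mu lam L A)); last first.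
  by move=> J /termE ->.
rewrite -ge0_sume_distrl//; first last.
rewrite sumEFin sumr_const /c -[X in X%:E]mulr_natl divff ?mul1e//.
by rewrite pnatr_eq0 -lt0n card_subsets_of_size.
Qed.

End weighted_face.

(** * Identification of the conditional law *)

Section countable_pi_system.
Variables (R : realType) (d : nat).

(** Indexed by finite lists, these sets are countably many, so that agreement of two kernels on all
    of them holds outside one null set. *)
Definition hits_all (s : seq ('rV[rat]_d.+1 * nat)) : set (borelK R d) :=
  [set K | forall b, b \in s -> hits b K].

Lemma measurable_hits_all s : measurable (hits_all s).
Proof.
have -> : hits_all s = \bigcap_b (if b \in s then hits b else setT).
  apply/seteqP; split => K H b; first by case: ifP => // bs _; exact: H.
  by move=> bs; have := H b I; rewrite bs.
by apply: bigcap_countType_measurable => b; case: ifP => // _; exact: measurable_hits.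
Qed.

Lemma probability_hits_all (m m' : {measure set (borelK R d) -> \bar R}) :
  m setT = 1%E -> (forall s, m (hits_all s) = m' (hits_all s)) ->
  forall A, measurable A -> m A = m' A.
Proof.
move=> m1 H; have h0 : hits_all [::] = setT by apply/seteqP; split.
apply: (@measure_unique _ R (borelK R d) (range hits_all) (fun=> setT)) => //.
- rewrite borelK_generated; apply/seteqP; split.
    apply: smallest_sub; first exact: smallest_sigma_algebra.
    move=> _ [b _ <-]; apply: sub_gen_smallest; exists [:: b] => //.
    by apply/seteqP; split => K; [apply; rewrite inE|move=> Kb b'; rewrite inE => /eqP ->].
  apply: smallest_sub; first exact: smallest_sigma_algebra.
  by move=> _ [s _ <-]; rewrite -borelK_generated; exact: measurable_hits_all.
- move=> _ _ [s _ <-] [s' _ <-]; exists (s ++ s') => //.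
  apply/seteqP; split => K.
    by move=> HK; split => b bs; apply: HK; rewrite mem_cat bs ?orbT.
  by move=> [HK HK'] b; rewrite mem_cat => /orP[]; [exact: HK|exact: HK'].
- by move=> _; exists [::].
- by apply/seteqP; split => // K _; exists 0%N.
- by move=> _ [s _ <-].
- by move=> _; rewrite m1 ltry.
Qed.

End countable_pi_system.

Theorem corollary4p2 (R : realType) (d k n : nat)
    (hd : (1 <= d)%N) (hk : (k < d)%N) (hn : (d - k <= n)%N)
    (kappa : probability (borelK R d) R)
    (hkappa : nondegenerate_directional_distribution kappa)
    (kappak : probability (borelK R d) R)
    (hkappak : intersection_distribution kappa k kappak)
    (disp : measure_display) (Omega : measurableType disp)
    (P : probability Omega R)
    (S : 'I_n -> {RV P >-> borelK R d})
    (hS : iid_hyperspheres kappa S)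
    (W : {RV P >-> borelK R d})
    (hW : weighted_typical_face k
            (fun w => tessellation (fun i => sset (S i w))) W)
    (Q : R.-pker (borelK R d) ~> (borelK R d))
    (hQ : regular_conditional_distribution W (fun w => direction (W w)) Q) :
  {ae kappak, forall S0 : borelK R d, great_subsphere k (sset S0) ->
    forall (disp' : measure_display) (Omega' : measurableType disp')
      (P' : probability Omega' R)
      (S' : 'I_(n - (d - k)) -> {RV P' >-> borelK R d})
      (U : {RV P' >-> borelE R d}) (Z : {RV P' >-> borelK R d}),
      let T' w := section (tessellation (fun i => sset (S' i w))) (sset S0) in
      iid_hyperspheres kappa S' ->
      uniform_on k (sset S0) U ->
      independent_of T' U ->
      cell_containing T' U Z ->
      forall A : set (borelK R d), measurable A ->
        Q S0 A = P' (Z @^-1` A)}.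
Proof.
(* If no great [k]-subsphere carries a normalized Hausdorff probability measure, then [uniform_on]
   contradicts itself and the claim is void. *)
have [[Sref [mu_ref [great_ref mu_refE]]]|none] := pselect
    (exists Sref (mu_ref : probability (borelE R d) R), great_subsphere k Sref /\
     forall A : set 'rV[R]_d.+1, measurable (A : set (borelE R d)) ->
       mu_ref A = normalized_hausdorff k Sref A); last first.
  apply: aeW => S0 gS0 disp' X' P' S' U Z HS' HU _ _ A _; exfalso; apply: none.
  by exists (sset S0); exists (distribution P' U); split.
pose mu := uniform_kernel great_ref mu_refE.
have muE (L : sbody R d) (A : set 'rV[R]_d.+1) : great_subsphere k (sset L) ->
    measurable (A : set (borelE R d)) -> mu L A = normalized_hausdorff k (sset L) A.
  by move=> gL mA; exact: (unifE great_ref mu_refE gL mA).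
have mu_self (L : sbody R d) : great_subsphere k (sset L) -> mu L (sset L) = 1%E.
  by move=> gL; exact: (unif_self great_ref mu_refE gL).
have mu_skel (K : 'I_n -> sbody R d) z HK sz zoff gJ nJ A mA :=
  @normalized_hausdorff_skel R d k Sref mu_ref great_ref mu_refE hk n K z HK sz zoff gJ nJ A hn mA.
have [la [Hla _ _]] := iid_hyperspheres_law hS.
(* The law of an independent family of [n - (d - k)] hyperspheres is taken as a marginal of the
   given one, so it is available before [S'] is introduced. *)
pose g : 'I_(n - (d - k)) -> 'I_n := widen_ord (leq_subr _ _).
have gI : injective g by move=> i j /(congr1 val) ij; exact: val_inj.
have [lam [lamE _]] := pushforward_law la (@measurable_comp_fam R d _ _ g).
have Hlam : iid_law kappa lam.
  by move=> C mC; apply: (eq_trans (lamE _)); exact: (iid_law_comp gI Hla).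
have WL A B := weighted_face_law hd hk hn hkappa hkappak mu_self mu_skel hS hW
  (A := A) (B := B) Hlam.
have mdir : measurable_fun setT (fun w => direction (W w) : borelK R d).
  exact: (measurableT_comp (@measurable_direction R d) (measurable_funPT W)).
have [lad [ladE ladI]] := pushforward_law P mdir.
(* The direction of [W] has law [kappak]: this is [weighted_face_law] for the full space [A]. *)
have dirE B : measurable B -> lad B = kappak B.
  move=> mB; rewrite ladE.
  have := WL setT B measurableT mB; rewrite preimage_setT setTI => ->.
  under eq_integral do rewrite zero_cell_law_setT.
  by rewrite integral_cst// mul1e.
have mQ A : measurable A -> measurable_fun setT (Q ^~ A) by exact: measurable_kernel.
(* Both sides are the probability that [W] is in [A] and its direction in [B]. As [B] varies, the
   integrands must agree [kappak]-almost everywhere. *)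
have QE A B : measurable A -> measurable B ->
    (\int[kappak]_(L in B) Q L A = \int[kappak]_(L in B) zero_cell_law mu lam L A)%E.
  move=> mA mB; rewrite -WL// hQ// integral_mkcond [RHS]integral_mkcond.
  have mQB : measurable_fun setT ((Q ^~ A) \_ B) by apply/(measurable_restrictT _ mB); exact: measurable_funTS (mQ A mA).
  have QB0 L : (0 <= ((Q ^~ A) \_ B) L)%E by rewrite patchE; case: ifP.
  transitivity (\int[lad]_L ((Q ^~ A) \_ B) L)%E.
    by apply: eq_measure_integral => M mM _; exact: esym (dirE M mM).
  by rewrite ladI.
have Qae A : measurable A -> {ae kappak, forall L, Q L A = zero_cell_law mu lam L A}.
  move=> mA; have : ae_eq kappak setT (Q ^~ A) (zero_cell_law mu lam ^~ A).
    apply: integral_ae_eq => //; last by move=> B _ mB; exact: QE.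
    - apply: (@le_integrable _ _ _ kappak setT measurableT _ (cst 1%E)).
      + exact: mQ.
      + move=> L _ /=; rewrite gee0_abs// normr1.
        have <- : Q L setT = 1%E by exact: prob_kernel.
        by apply: le_measure; rewrite ?inE.
      + exact: finite_measure_integrable_cst.
    - exact: measurable_zero_cell_law.
  by apply: (filterS (F := almost_everywhere kappak)) => L; apply.
(* The null set serves all lists [s] at once and is fixed before [U] and [Z] are introduced. *)
have := ae_forall_countType (fun s => Qae _ (@measurable_hits_all R d s)).
apply: (filterS (F := almost_everywhere kappak)) => S0 QS0 gS0 disp' X' P' S' U Z /=.
move=> HS' HU TU HZ.
have ZL A : measurable A -> P' (Z @^-1` A) = zero_cell_law mu lam S0 A.
  exact: (section_cell_law hd hkappa mu_self muE HS' gS0 HU TU HZ Hlam).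
apply: (@probability_hits_all R d (Q S0) (distribution P' Z)).
  exact: prob_kernel.
move=> s; rewrite QS0; apply/esym/ZL; exact: measurable_hits_all.
Qed.
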